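(* Let $\beta = \frac14 e^{-1/2}$ and let $\varepsilon>0$ be fixed. For a cube-free integer $q$, let $E_\varepsilon(q)$ be the number of integers $a\in\{0,\ldots,q-1\}$ with $\gcd(a,q)=1$ for which there do not exist integers $n_1,\ldots,n_7$ with $$n_1 n_2\cdots n_7\equiv a \pmod q,\qquad 1\le n_1,\ldots,n_7\le q^{\beta+\varepsilon}.$$ Then $E_\varepsilon(q)=o(q)$ as $q\to\infty$ through cube-free integers.
   Context: An integer $q\ge 1$ is cube-free if no prime $p$ satisfies $p^3 \mid q$. *)

(* Defs.v *)
From mathcomp Require Import all_boot all_order all_algebra.
From mathcomp Require Import all_classical all_reals all_analysis.
Set Implicit Arguments.
Unset Strict Implicit.
Unset Printing Implicit Defensive.
Import Order.TTheory GRing.Theory Num.Theory.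
Import numFieldNormedType.Exports.
Local Open Scope classical_set_scope.
Local Open Scope ring_scope.

Definition cube_free (q : nat) : Prop :=
  (1 <= q)%N /\ forall p : nat, prime p -> ~~ (p ^ 3 %| q)%N.

Definition cube_free_oo : set_system nat := within [set q | cube_free q] \oo.

Definition beta (R : realType) : R := 4^-1 * expR (- 2^-1).

(* The factors are at least 1, so they range over [nat] rather than [int]. *)
Definition seven_fold_product (R : realType) (eps : R) (q a : nat) : Prop :=
  exists n : 'I_7 -> nat,
    (\prod_(i < 7) n i = a %[mod q])%N /\
    forall i : 'I_7, (1 <= n i)%N /\ (n i)%:R <= (q%:R : R) `^ (beta R + eps).

Definition exceptional_count (R : realType) (eps : R) (q : nat) : nat :=
  #|[set a : 'I_q | coprime a q && ~~ `[< seven_fold_product eps q a >]]%SET|.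

(* Main.v *)
(* Let U be the integers up to X = q^(1/4+eps) coprime to q and A the N-smooth ones among them, where
   N = q^(beta+eps).  By Mertens, since (1/4+eps)/(beta+eps) < e^(1/2), A makes up more than half of U
   by a positive proportion, unless phi(q) is negligible.  Weight u in U by w(u) = 1 if u lies in A
   and -1 otherwise, and let D(a) be the sum of w(u) over the solutions of u u' z_1 ... z_m = a mod q
   with u, u' in U and the z_i tiny.  If u and u' are both smooth, each is a product of three factors
   up to N, and the z_i can be distributed over these six factors and a seventh one; hence an
   exceptional a has no solution with u, u' both in A, and then D(a) <= 0 by symmetry.  The mean of D
   is positive, so it remains to bound the variance of D, a sum over nonprincipal characters of
   |W U Z^m|^2.  Burgess' bound saves a power of q in the character sum over U, and the mean value
   theorem for characters, applied according to the size of Z, takes care of the rest.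

   Burgess' bound for a cube-free modulus rests on complete sums modulo p^2, which are elementary, and
   modulo p, where Weil's bound is proved by Stepanov's method for all characters at once: the number
   of points of the curves y^(p-1) = f(x) over extensions of F_p bounds the power sums of the inverse
   roots of the L-functions. *)

Require Import Defs.
From HB Require Import structures.
From mathcomp Require Import all_boot all_order all_algebra all_fingroup all_solvable all_field all_character.
From mathcomp Require Import ring lra zify.
From mathcomp Require boolp.
Set Implicit Arguments.
Unset Strict Implicit.
Unset Printing Implicit Defensive.
Import Order.TTheory GRing.Theory Num.Theory.
Local Open Scope ring_scope.

(** * Stepanov's method *)

(** The smooth set enters only through the sign [w], whose character sum is bounded trivially: all
    cancellation comes from the second large factor, which runs over the full set [U]. Burgess'
    bound takes effect just beyond q^(1/4), hence the size of [X]. Seven is a matter of size: two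
    large factors and enough tiny ones must together pass q for the mean value theorem, and the
    factors of size N reach q^(7 beta), where 7 beta > 1 but 6 beta < 1. Stepanov's method bounds
    point counts only from above; a lower bound follows because the counts over all values of the
    norm add up to the size of the field. It yields a bound for all nontrivial characters together,
    and only the isolation of single roots in the power sums separates them. Before the last part
    small powers of q are replaced by integers such as [tau] or [h] with a prescribed power at most
    q, and the divisor bound is stated for powers of the divisor function. *)

Lemma dvdp_sum (K : fieldType) I (r : seq I) (P : pred I) (F : I -> {poly K}) d :
  (forall i, P i -> d %| F i) -> d %| \sum_(i <- r | P i) F i.
Proof.
move=> H; apply: (big_ind (fun u => d %| u)) => // u v.
exact: dvdp_add.
Qed.

Lemma poly_XaYM (K : comNzRingType) (p q : {poly K}) :
  poly_XaY (p * q) = poly_XaY p * poly_XaY q.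
Proof. by rewrite /poly_XaY rmorphM /= comp_polyM. Qed.

Lemma poly_XaYX (K : comNzRingType) n :
  poly_XaY ('X^n : {poly K}) = ('X + 'X%:P) ^+ n.
Proof. by rewrite /poly_XaY map_polyXn comp_Xn_poly. Qed.

(* The [l]-th Hasse derivative: the coefficient of [T ^ l] in [p(X + T)]. *)
Definition hasse (K : comNzRingType) l (p : {poly K}) : {poly K} :=
  (poly_XaY p)`_l.

Section Hasse.
Variable K : fieldType.
Implicit Types (p q f : {poly K}) (x a : K).

Lemma hasse_is_linear l a p q :
  hasse l (a *: p + q) = a *: hasse l p + hasse l q.
Proof.
rewrite /hasse /poly_XaY rmorphD /= comp_polyD coefD; congr (_ + _).
by rewrite map_polyZ /= comp_polyZ coefZ mul_polyC.
Qed.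

HB.instance Definition _ l :=
  GRing.isLinear.Build K {poly K} {poly K} *:%R (@hasse K l) (hasse_is_linear l).

Lemma hasseM l p q :
  hasse l (p * q) = \sum_(i < l.+1) hasse i p * hasse (l - i) q.
Proof. by rewrite /hasse poly_XaYM coefM. Qed.

Lemma size_hasse l p : (size (hasse l p) <= size p)%N.
Proof.
by rewrite -[X in (_ <= X)%N]size_poly_XaY -swapXY_poly_XaY -sizeYE max_size_coefXY.
Qed.

Lemma hasse0 p : hasse 0 p = p.
Proof.
rewrite /hasse -horner_coef0 horner_poly_XaY add0r; exact: comp_polyXr.
Qed.

(** By Leibniz' rule an [l]-th derivative removes at most [l] of the [w] factors [f]. *)
Lemma dvdp_hasse f w l p : f ^+ (w - l) %| hasse l (f ^+ w * p).
Proof.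
elim: w l => [|w IHw] l; first by rewrite sub0n dvd1p.
rewrite exprS -mulrA hasseM; apply: dvdp_sum => i _.
have := IHw (l - i)%N; case: i => [[|i] /= lti].
  rewrite hasse0 subn0 => dv.
  have [le_lw | lt_wl] := leqP l w; first by rewrite subSn // exprS dvdp_mul.
  by rewrite (_ : (w.+1 - l = 0)%N) ?dvd1p //; apply/eqP; rewrite subn_eq0.
move=> dv; apply: dvdp_mull; apply: dvdp_trans dv; apply: dvdp_exp2l; lia.
Qed.

(** In characteristic [c], [(X + T) ^ (k * c ^ n)] is [(X ^ (c ^ n) + T ^ (c ^ n)) ^ k], which has
    no term [T ^ i] with [0 < i < c ^ n]. Derivatives of order below [c ^ n] thus treat such a power
    as a constant. *)
Lemma hasse_pow_pcharM (c : nat) n k l p : c \in [pchar K] ->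
  (l < c ^ n)%N -> hasse l ('X ^+ (k * c ^ n) * p) = 'X ^+ (k * c ^ n) * hasse l p.
Proof.
move=> pc lt_l; have c2 : c \in [pchar {poly {poly K}}].
  by rewrite !pchar_poly.
rewrite hasseM big_ord_recl subn0 hasse0 big1 ?addr0 // => i _.
suff -> : hasse (lift ord0 i) ('X^(k * c ^ n) : {poly K}) = 0 by rewrite mul0r.
rewrite /hasse poly_XaYX mulnC exprM.
rewrite exprDn_pchar; last first.
  by rewrite pnatX pnatE ?(pcharf_prime pc) ?c2.
rewrite -rmorphXn /=.
elim: (k) => [|m IHm]; first by rewrite expr0 coef1.
rewrite exprS mulrDl coefD coefXnM coefCM IHm mulr0 addr0.
by rewrite (leq_trans _ lt_l) // /bump /= add1n ltnS ltn_ord.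
Qed.

(** The Hasse derivatives at [x] are the Taylor coefficients at [x]. No factorial is divided by, so
    they detect multiplicities in every characteristic. *)
Lemma dvdp_hasse0 x m p :
  (forall l, (l < m)%N -> (hasse l p).[x] = 0) -> ('X - x%:P) ^+ m %| p.
Proof.
move=> H; set q := p \Po (x%:P + 'X).
have coefq l : q`_l = (hasse l p).[x].
  rewrite /q -horner_evalE /hasse -coef_map /=; congr (_`_l).
  rewrite /poly_XaY map_comp_poly /= rmorphD /= !map_polyX map_polyC /= horner_evalE hornerX.
  rewrite -map_poly_comp; rewrite (_ : map_poly _ p = p) 1?addrC //.
  by apply/polyP => i; rewrite coef_map /= horner_evalE hornerC.
have : 'X^m %| q.
  rewrite -(poly_take_drop m q) dvdp_add ?dvdp_mull //.
  rewrite (_ : take_poly m q = 0) ?dvdp0 //.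
  by apply/polyP=> i; rewrite coef_take_poly coef0; case: ifP => // /H; rewrite coefq.
move=> /(dvdp_comp_poly ('X - x%:P)); rewrite comp_Xn_poly /q -comp_polyA.
by rewrite comp_polyD comp_polyC comp_polyX [x%:P + _]addrC subrK comp_polyXr.
Qed.

Lemma size_dvdp_XsubC_exp (s : seq K) m p : uniq s -> p != 0 ->
  (forall x, x \in s -> ('X - x%:P) ^+ m %| p) -> (size s * m < size p)%N.
Proof.
elim: s p => [|x s IHs] p /=; first by rewrite mul0n size_poly_gt0.
move=> /andP[xs us] p0 H.
have /dvdpP[q Dp] := H x (mem_head _ _).
have q0 : q != 0 by apply: contraNneq p0 => q0; rewrite Dp q0 mul0r.
have : (size s * m < size q)%N.
  apply: IHs => // y ys; have := H y; rewrite inE ys orbT => /(_ isT).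
  rewrite Dp Gauss_dvdpl // coprimep_expl // coprimep_expr // coprimep_XsubC.
  by rewrite root_XsubC; apply: contraNneq xs => ->.
rewrite Dp size_Mmonic ?monic_exp ?monicXsubC // size_exp_XsubC; lia.
Qed.

(** All later terms are divisible by ['X^(e 0 + G)], hence so is the first. As [u 0] is coprime to
    ['X], this makes ['X^G] divide [h 0], which is too short to be nonzero. *)
Lemma sum_sparse_eq0 G M (h u : nat -> {poly K}) (e : nat -> nat) :
  (forall i, size (h i) <= G)%N -> (forall i, (u i).[0] != 0) ->
  (forall i j, i < j -> e i + G <= e j)%N ->
  \sum_(i < M) h i * 'X^(e i) * u i = 0 -> forall i, (i < M)%N -> h i = 0.
Proof.
elim: M h u e => // M IHM h u e sh u0 e_incr.
rewrite big_ord_recl /= => sum0.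
have dvd_tl : 'X^(e 0%N + G) %| \sum_(i < M) h i.+1 * 'X^(e i.+1) * u i.+1.
  apply: dvdp_sum => i _; by rewrite -mulrA dvdp_mull // dvdp_mulr // dvdp_exp2l // e_incr.
have h00 : h 0%N = 0.
  have : 'X^(e 0%N + G) %| h 0%N * 'X^(e 0%N) * u 0%N.
    by move/eqP: sum0; rewrite addr_eq0 => /eqP->; rewrite dvdpNr.
  rewrite mulrAC exprD mulrC dvdp_mul2r ?expf_neq0 ?polyX_eq0 //.
  rewrite Gauss_dvdpl; last first.
    by rewrite coprimep_expl // -['X]subr0 coprimep_sym coprimep_XsubC rootE.
  move=> dvh; apply/eqP/negPn/negP => h0.
  by have := dvdp_leq h0 dvh; rewrite size_polyXn ltnNge sh.
case=> // i lti; apply: (IHM (fun i => h i.+1) (fun i => u i.+1) (fun i => e i.+1)) => //.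
- by move=> j k ltjk; apply: e_incr.
- by move: sum0; rewrite h00 !mul0r add0r.
Qed.

Lemma linear_matrix_of (V : lmodType K) c e (F : 'I_c -> 'I_e -> V -> K) :
  (forall i j, scalar (F i j)) -> linear (fun v => \matrix_(i, j) F i j v).
Proof. by move=> H b u v; apply/matrixP => i j; rewrite !mxE H. Qed.

Lemma exists_kernel_mx (a b c e : nat) (phi : {linear 'M[K]_(a, b) -> 'M[K]_(c, e)}) :
  (c * e < a * b)%N -> exists2 v, v != 0 & phi v = 0.
Proof.
move=> lt_ce; have : kermx (lin_mx phi) != 0.
  rewrite -mxrank_eq0 mxrank_ker -lt0n subn_gt0.
  exact: leq_ltn_trans (rank_leq_col _) lt_ce.
case/rowV0Pn => v /sub_kermxP v_ker v0; exists (vec_mx v).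
  by rewrite -(inj_eq (can_inj (@mxvecK K a b))) linear0 vec_mxK.
by apply/(can_inj mxvecK); rewrite -mul_vec_lin vec_mxK v_ker linear0.
Qed.
End Hasse.

(* The auxiliary polynomial
   [\sum_i f ^ mu * h_i * X ^ (i / d * Q) * f ^ (i % d * G)] agrees, together with its first
   [mu] Hasse derivatives, with polynomials of low degree on the points counted. *)
Section Stepanov.
Variables (K : fieldType) (c n d G k : nat) (f1 : {poly K}) (a : K).
Hypotheses (pc : c \in [pchar K]) (d0 : (0 < d)%N) (k0 : (0 < k)%N).
Let Q := (c ^ n)%N.
Hypothesis (QE : Q = (d * G).+1).
Hypothesis f10 : f1.[0] != 0.
Local Definition f : {poly K} := 'X * f1.
Let D := size f1.
Hypothesis big_G : (k * (d * (k * (d * D).+1)) <= G)%N.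
(** There are [M * G] unknown coefficients, against [mu] polynomial conditions with [S] coefficients
    each; [big_G] is what makes [mu * S < M * G]. *)
Let M := (k * d)%N.
Let mu := M.-1.
Let S := (G + mu * D + k)%N.

Let f10' : f1 != 0.
Proof. by apply: contraNneq f10 => ->; rewrite horner0. Qed.
Local Lemma f0 : f != 0.
Proof. by rewrite mulf_neq0 ?polyX_eq0 ?f10'. Qed.
Local Lemma size_f : size f = D.+1.
Proof. by rewrite /f mulrC size_mulX. Qed.
Local Lemma size_fX w : size (f ^+ w) = (w * D).+1.
Proof.
have := size_exp f w; rewrite size_f /= mulnC => <-.
by rewrite prednK // size_poly_gt0 expf_neq0 // f0.
Qed.

(** The division is exact by [dvdp_hasse]. Its point is that the size of the quotient is bounded in
    terms of [l] and not of [w]. *)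
Local Definition red w l (h : {poly K}) : {poly K} := hasse l (f ^+ w * h) %/ f ^+ (w - l).

Local Lemma redE w l (h : {poly K}) : hasse l (f ^+ w * h) = f ^+ (w - l) * red w l h.
Proof. by rewrite /red [RHS]mulrC divpK // dvdp_hasse. Qed.

Local Lemma red_linear w l b (g h : {poly K}) :
  red w l (b *: g + h) = b *: red w l g + red w l h.
Proof. by rewrite /red mulrDr -scalerAr linearP /= divpD divpZl. Qed.

Local Lemma size_red w l (h : {poly K}) : (l <= w)%N -> (size h <= G)%N -> (size (red w l h) <= G + l * D)%N.
Proof.
move=> lw sh; rewrite size_divp ?expf_neq0 ?f0 // size_fX /=.
have h1 := size_hasse l (f ^+ w * h); have := size_polyMleq (f ^+ w) h.
rewrite size_fX /= => h2; rewrite leq_subLR.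
have -> : ((w - l) * D + (G + l * D) = G + w * D)%N.
  by rewrite mulnBl; have := leq_mul2r D l w; rewrite lw orbT; lia.
by apply: leq_trans h1 (leq_trans h2 _); rewrite addnC leq_add2r.
Qed.

Local Definition hp (v : 'M[K]_(M, G)) (i : 'I_M) : {poly K} := rVpoly (row i v).
(** At the points counted [x ^+ Q = x] and [f ^+ G = a]. After these substitutions the [l]-th Hasse
    derivative of [aux] is [f ^+ (mu - l)] times this polynomial, so its vanishing is a linear
    condition on [v] of low cost. *)
Local Definition cond (v : 'M[K]_(M, G)) l : {poly K} :=
  \sum_(i < M) a ^+ (i %% d) *: ('X^(i %/ d) * red (mu + i %% d * G) l (hp v i)).
Local Definition phi (v : 'M[K]_(M, G)) : 'M[K]_(mu, S) := \matrix_(l, j) (cond v l)`_j.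

Local Lemma phi_linear : linear phi.
Proof.
apply: (linear_matrix_of (F := fun l j v => (cond v l)`_j)) => l j b u v /=.
have -> : cond (b *: u + v) l = b *: cond u l + cond v l.
  rewrite /cond scaler_sumr -big_split; apply: eq_bigr => i _ /=.
  have -> : hp (b *: u + v) i = b *: hp u i + hp v i by rewrite /hp !linearP.
  by rewrite red_linear mulrDr -scalerAr scalerDr !scalerA mulrC.
by rewrite coefD coefZ.
Qed.

Local Lemma size_cond v l : (l < mu)%N -> (size (cond v l) <= S)%N.
Proof.
move=> lmu; apply: (leq_trans (size_sum _ _ _)); apply/bigmax_leqP => i _.
apply: (leq_trans (size_scale_leq _ _)).
apply: (leq_trans (size_polyMleq _ _)); rewrite size_polyXn /=.
have h1 : (size (red (mu + i %% d * G) l (hp v i)) <= G + l * D)%N.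
  apply: size_red; first by rewrite (leq_trans (ltnW lmu)) ?leq_addr.
  by rewrite /hp; apply: size_poly.
have : (i %/ d < k)%N by rewrite ltn_divLR // ltn_ord.
have : (l * D <= mu * D)%N by rewrite leq_mul2r (ltnW lmu) orbT.
by rewrite /S => h2 h3; apply: leq_trans (leq_add (leqnn _) h1) _; lia.
Qed.

Local Definition aux (v : 'M[K]_(M, G)) : {poly K} := \sum_(i < M) f ^+ mu * (hp v i * 'X^(i %/ d * Q) * f ^+ (i %% d * G)).

Local Lemma Gpos : (0 < G)%N.
Proof. by apply: leq_trans big_G; rewrite !muln_gt0 k0 d0. Qed.

(** Since [f = 'X * f1] and [Q = d * G + 1], the term of index [i] starts at the exponent
    [i * G + i %/ d]. Successive starts are at least [G] apart, as [sum_sparse_eq0] requires. *)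
Local Lemma auxN0 v : aux v = 0 -> v = 0.
Proof.
rewrite /aux -mulr_sumr => /eqP; rewrite mulf_eq0 expf_eq0 (negPf f0) andbF /= => /eqP aux0.
pose h i := if insub i is Some j then hp v j else 0.
have sh i : (size (h i) <= G)%N.
  by rewrite /h; case: insubP => [j _ _|_]; rewrite ?size_poly0 // /hp; apply: size_poly.
have h0 : forall i, (i < M)%N -> h i = 0.
  apply: (@sum_sparse_eq0 _ G M h (fun i => f1 ^+ (i %% d * G)) (fun i => (i * G + i %/ d)%N)) => //.
  - by move=> i; rewrite horner_exp expf_neq0.
  - move=> i j ltij; have : (i %/ d <= j %/ d)%N by rewrite leq_div2r // ltnW.
    have : (i.+1 * G <= j * G)%N by rewrite leq_mul2r ltij orbT.
    rewrite mulSn; lia.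
  - rewrite -[RHS]aux0; apply: eq_bigr => i _.
    rewrite /h valK /f exprMn -!mulrA; congr (_ * _); rewrite !mulrA -exprD; congr ('X^_ * _).
    by rewrite QE {1}(divn_eq i d); ring.
apply/row_matrixP => i; rewrite row0; apply/(can_inj (@rVpolyK _ _)).
by have := h0 i (ltn_ord i); rewrite /h valK /hp => ->; rewrite linear0.
Qed.

Local Lemma size_aux v : (size (aux v) <= mu * D + G + k * Q + d * G * D + 2)%N.
Proof.
apply: (leq_trans (size_sum _ _ _)); apply/bigmax_leqP => i _.
have h1 : (size (hp v i) <= G)%N by apply: size_poly.
have h2 : (i %/ d * Q <= k * Q)%N by rewrite leq_mul2r ltnW ?orbT // ltn_divLR.
have h3 : (i %% d * G * D <= d * G * D)%N by rewrite !leq_mul2r ltnW ?orbT // ltn_pmod.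
have h4 := size_polyMleq (f ^+ mu) (hp v i * 'X^(i %/ d * Q) * f ^+ (i %% d * G)).
have h5 := size_polyMleq (hp v i * 'X^(i %/ d * Q)) (f ^+ (i %% d * G)).
have h6 := size_polyMleq (hp v i) 'X^(i %/ d * Q).
rewrite !size_fX size_polyXn in h4 h5 h6; lia.
Qed.

Lemma stepanov (s : seq K) : uniq s ->
  (forall x, x \in s -> [/\ x ^+ Q = x, x * f1.[x] != 0 & (x * f1.[x]) ^+ G = a]) ->
  (size s * (k * d).-1 <= (k * d) * D + G + k * Q + d * G * D + 2)%N.
Proof.
move=> us Hs.
pose phiL : {linear 'M[K]_(M, G) -> 'M[K]_(mu, S)} :=
  HB.pack phi (GRing.isLinear.Build _ _ _ _ phi phi_linear).
have Mpos : (0 < M)%N by rewrite muln_gt0 k0.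
have few : (mu * S < M * G)%N.
  have ME : M = mu.+1 by rewrite prednK.
  have : (mu * (mu * D + k) < G)%N.
    have [->|mu0] := posnP mu; first by rewrite mul0n; exact: Gpos.
    move: big_G; rewrite mulnA -/M ME; nia.
  by rewrite ME mulSn /S -addnA mulnDr; lia.
have [v v0 phiv] := exists_kernel_mx phiL few.
have cond0 l : (l < mu)%N -> cond v l = 0.
  move=> lmu; apply/polyP => j; rewrite coef0.
  have [jS|jS] := ltnP j S; last by rewrite nth_default // (leq_trans (size_cond v lmu)).
  have := congr1 (fun A : 'M_(mu, S) => A (Ordinal lmu) (Ordinal jS)) phiv.
  by rewrite /= !mxE.
(* The derivative orders must stay below [Q] for [hasse_pow_pcharM]. *)
have muQ : (mu <= Q)%N.
  have : (M <= Q)%N; last by rewrite /mu; lia.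
  rewrite QE /M; have : (k <= G)%N by move: big_G; nia.
  nia.
have auxv0 : aux v != 0 by apply: contra v0 => /eqP/auxN0->.
have /(size_dvdp_XsubC_exp us auxv0) : forall x, x \in s -> ('X - x%:P) ^+ mu %| aux v.
  move=> x /Hs[xQ fx0 fxG]; apply: dvdp_hasse0 => l lmu.
  have fxE : f.[x] = x * f1.[x] by rewrite hornerM hornerX.
  have -> : (hasse l (aux v)).[x] = f.[x] ^+ (mu - l) * (cond v l).[x]; last first.
    by rewrite cond0 // horner0 mulr0.
  rewrite /aux linear_sum /= !horner_sum mulr_sumr; apply: eq_bigr => i _.
  have -> : f ^+ mu * (hp v i * 'X^(i %/ d * Q) * f ^+ (i %% d * G))
          = 'X^(i %/ d * Q) * (f ^+ (mu + i %% d * G) * hp v i) by rewrite exprD; ring.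
  rewrite (hasse_pow_pcharM _ _ pc) ?(leq_trans lmu) // redE.
  rewrite !(hornerM, hornerXn, hornerZ, horner_exp).
  rewrite mulnC exprM xQ hornerX -addnBAC 1?ltnW // exprD [(_ * G)%N]mulnC exprM fxG.
  ring.
move=> lt_aux; apply: leq_trans (ltnW lt_aux) (leq_trans (size_aux v) _).
by rewrite -/M; have : (mu * D <= M * D)%N; [rewrite leq_mul2r leq_pred orbT | lia].
Qed.
End Stepanov.

(** * Frobenius orbits *)

Section FiniteSubfields.
Variables (p : nat) (p_pr : prime p) (K : closedFieldType).
Hypothesis pc : p \in [pchar K].
Implicit Types x y : K.

Lemma frobD i x y : (x + y) ^+ (p ^ i) = x ^+ (p ^ i) + y ^+ (p ^ i).
Proof. by rewrite exprDn_pchar // pnatX pnatE ?pc. Qed.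

Lemma frobN i x : (- x) ^+ (p ^ i) = - x ^+ (p ^ i).
Proof.
by apply/eqP; rewrite -addr_eq0 -frobD addNr expr0n expn_eq0 -leqn0 leqNgt prime_gt0.
Qed.

Lemma frobB i x y : (x - y) ^+ (p ^ i) = x ^+ (p ^ i) - y ^+ (p ^ i).
Proof. by rewrite frobD frobN. Qed.

Lemma frobDn i j x : x ^+ (p ^ (i + j)) = (x ^+ (p ^ i)) ^+ (p ^ j).
Proof. by rewrite expnD exprM. Qed.

Lemma frob_inj i : injective (fun x : K => x ^+ (p ^ i)).
Proof.
move=> x y /= /eqP; rewrite -subr_eq0 -frobB expf_eq0 subr_eq0 => /andP[_ /eqP//].
Qed.

Lemma fixed_frob_mul d j x : x ^+ (p ^ d) = x -> x ^+ (p ^ (j * d)) = x.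
Proof.
by move=> xd; elim: j => [|j IHj]; rewrite ?mul0n ?expr1 // mulSn frobDn xd.
Qed.

Lemma fixed_frob_roots n : (0 < n)%N ->
  {s : seq K | [/\ uniq s, size s = (p ^ n)%N & forall x, (x \in s) = (x ^+ (p ^ n) == x)]}.
Proof.
move=> n0; set g : {poly K} := 'X^(p ^ n) - 'X.
have p2 := prime_gt1 p_pr.
have q1 : (1 < p ^ n)%N by rewrite -[1%N](exp1n n) ltn_exp2r.
have sg : size g = (p ^ n).+1.
  by rewrite /g size_polyDl size_polyXn // size_polyN size_polyX ltnS.
have gm : g \is monic by rewrite monicE lead_coefE sg /= coefB coefXn eqxx coefX gtn_eqF // subr0.
have [s Ds] := closed_field_poly_normal g; rewrite (monicP gm) scale1r in Ds.
exists s; split.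
- rewrite -separable_prod_XsubC -Ds separable_poly.unlock /g derivB derivXn derivX.
  have -> : ('X^((p ^ n).-1) : {poly K}) *+ (p ^ n) = 0.
    rewrite -mulr_natr; have -> : ((p ^ n)%:R : {poly K}) = 0; last by rewrite mulr0.
    by rewrite natrX (pcharf0 (_ : p \in [pchar {poly K}])) ?pchar_poly // expr0n gtn_eqF.
  have -> : (0 - 1 : {poly K}) = (-1) *: 1 by rewrite scaleN1r sub0r.
  by rewrite coprimepZr ?oppr_eq0 ?oner_eq0 // coprimep1.
- by apply/eq_add_S; rewrite -sg Ds size_prod_XsubC.
- by move=> x; rewrite -root_prod_XsubC -Ds /g rootE !hornerE subr_eq0.
Qed.

Definition fixfrob n : seq K :=
  if insub n is Some n' then sval (fixed_frob_roots (valP (n' : {n | (0 < n)%N}))) else [::].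

Lemma fixfrobP n : (0 < n)%N ->
  [/\ uniq (fixfrob n), size (fixfrob n) = (p ^ n)%N &
      forall x, (x \in fixfrob n) = (x ^+ (p ^ n) == x)].
Proof. by move=> n0; rewrite /fixfrob insubT; case: fixed_frob_roots. Qed.

(** For [x] in the field with [p ^ n] elements this is the norm to the prime field. *)
Definition frobnorm n x := \prod_(i < n) x ^+ (p ^ i).

Lemma frobnormM n : {morph frobnorm n : x y / x * y}.
Proof. by move=> x y; rewrite -big_split; apply: eq_bigr => i _; rewrite exprMn. Qed.

Lemma frobnorm_mul d j x : x ^+ (p ^ d) = x -> frobnorm (j * d) x = frobnorm d x ^+ j.
Proof.
move=> xd; elim: j => [|j IHj]; first by rewrite mul0n /frobnorm big_ord0.
rewrite mulSn /frobnorm big_split_ord /= exprS -IHj; congr (_ * _).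
by apply: eq_bigr => i _; rewrite frobDn xd.
Qed.

Lemma fixed_frobnorm n x : (0 < n)%N -> x ^+ (p ^ n) = x -> frobnorm n x ^+ p = frobnorm n x.
Proof.
case: n => // n _ xn; rewrite /frobnorm -prodrXl.
under eq_bigr => i _ do rewrite -exprM -expnSr.
rewrite big_ord_recr /= [RHS]big_ord_recl /= xn mulrC expr1.
by congr (_ * _); apply: eq_bigr => i _; rewrite lift0.
Qed.

Variable emb : {rmorphism 'F_p -> K}.

Lemma emb_frob a i : emb a ^+ (p ^ i) = emb a.
Proof.
elim: i => [|i IHi]; first by rewrite expr1.
rewrite expnSr exprM IHi -rmorphXn /=; congr (emb _).
by have := expf_card a; rewrite card_Fp.
Qed.

Lemma fixed_frob_emb x : x ^+ p = x -> exists a, x = emb a.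
Proof.
move=> xp; have [us ss ms] := @fixfrobP 1 isT.
have : {subset codom emb <= fixfrob 1}.
  by move=> _ /codomP[a ->]; rewrite ms emb_frob.
have uc : uniq (codom emb) by rewrite map_inj_uniq ?enum_uniq //; exact: fmorph_inj.
have sz : (size (fixfrob 1) <= size (codom emb))%N.
  by rewrite ss size_codom card_Fp // expn1.
move=> /(uniq_min_size uc)/(_ sz)[_ eqi].
have : x \in fixfrob 1 by rewrite ms expn1 xp.
by rewrite -eqi => /codomP[a ->]; exists a.
Qed.

Lemma frob_root (g : {poly 'F_p}) x i :
  root (map_poly emb g) x -> root (map_poly emb g) (x ^+ (p ^ i)).
Proof.
rewrite !rootE => /eqP gx.
have -> : (map_poly emb g).[x ^+ (p ^ i)] = (map_poly emb g).[x] ^+ (p ^ i).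
  rewrite !horner_coef; elim/big_rec2: _ => [|j u v _ IH].
    by rewrite expr0n expn_eq0 -leqn0 leqNgt prime_gt0.
  by rewrite frobD IH exprMn coef_map /= emb_frob -!exprM mulnC.
by rewrite gx expr0n expn_eq0 -leqn0 leqNgt prime_gt0.
Qed.

Lemma poly_emb (g : {poly K}) : (forall i, g`_i ^+ p = g`_i) ->
  exists h, g = map_poly emb h.
Proof.
move=> H; pose c i : 'F_p := if [pick a | emb a == g`_i] is Some a then a else 0.
exists (\poly_(i < size g) c i); apply/polyP => i.
rewrite coef_map coef_poly; case: ltnP => [lti|lei]; last by rewrite nth_default //; exact/esym/rmorph0.
rewrite /c; case: pickP => [a /eqP/esym//|no].
by have [a ga] := fixed_frob_emb (H i); have := no a; rewrite ga eqxx.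
Qed.

Section Orbit.
Variables (x : K) (n : nat) (n0 : (0 < n)%N) (xn : x ^+ (p ^ n) = x).

Let ex_deg : exists e, (0 < e)%N && (x ^+ (p ^ e) == x).
Proof. by exists n; rewrite n0 xn eqxx. Qed.

(** [P] is the minimal polynomial of [x] over the prime field, built as the product over the
    Frobenius orbit. Frobenius permutes the factors, so it fixes the coefficients. *)
Lemma orbit_poly_exists : exists (e : nat) (P : {poly 'F_p}),
  [/\ (0 < e)%N, P \is monic, size P = e.+1,
   forall j, (x ^+ (p ^ j) == x) = (e %| j)%N &
   [/\ forall g, (P %| g) = root (map_poly emb g) x,
    mup x (map_poly emb P) = 1%N &
    forall c, emb P.[c] = frobnorm e (emb c - x)]].
Proof.
case: (ex_minnP ex_deg) => e /andP[e0 /eqP xe] emin.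
pose o := [seq x ^+ (p ^ i) | i <- iota 0 e].
have divE j : (x ^+ (p ^ j) == x) = (e %| j)%N.
  apply/idP/idP => [/eqP xj|/dvdnP[k ->]]; last by rewrite fixed_frob_mul.
  rewrite /dvdn; apply: contraT; rewrite -lt0n => r0.
  have := emin (j %% e)%N; rewrite r0 leqNgt ltn_pmod //= => H.
  by move: xj; rewrite {1}(divn_eq j e) frobDn fixed_frob_mul // => /eqP/H.
have uo : uniq o.
  rewrite map_inj_in_uniq ?iota_uniq // => i j.
  rewrite !mem_iota /= !add0n.
  wlog leij : i j / (i <= j)%N => [H lti ltj E|].
    by have [/H->//|/ltnW/H E'] := leqP i j; rewrite E'.
  move=> lti ltj; rewrite -(subnK leij) frobDn => /frob_inj/esym/eqP.
  rewrite divE => /dvdn_leq; have [|_ /(_ isT)] := posnP (j - i); first by lia.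
  lia.
pose PK : {poly K} := \prod_(i < e) ('X - (x ^+ (p ^ i))%:P).
have PKE : PK = \prod_(z <- o) ('X - z%:P) by rewrite /PK big_map -[in RHS](subn0 e) big_mkord.
have [|P DP] := @poly_emb PK.
  move=> i; have PKfix : map_poly (pFrobenius_aut pc) PK = PK.
    rewrite rmorph_prod /PK -(prednK e0) big_ord_recr [RHS]big_ord_recl /= mulrC.
    congr (_ * _); first by rewrite map_polyXsubC /= pFrobenius_autE -exprM -expnSr prednK // xe expr1.
    by apply: eq_bigr => j _; rewrite map_polyXsubC /= pFrobenius_autE -exprM -expnSr.
  by rewrite -[in RHS]PKfix coef_map.
have mP : P \is monic by rewrite -(map_monic emb) -DP monic_prod // => i _; exact: monicXsubC.
have sP : size P = e.+1.
  by rewrite -(size_map_poly emb) -DP PKE size_prod_XsubC size_map size_iota.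
exists e, P; split=> //; split.
- move=> g; rewrite -(dvdp_map emb) -DP; apply/idP/idP => [dv|rx].
    case/dvdpP: dv => q ->; rewrite rootM PKE root_prod_XsubC; apply/orP; right.
    by apply/mapP; exists 0%N; rewrite ?mem_iota ?expr1.
  rewrite PKE; apply: uniq_roots_dvdp; last by rewrite uniq_rootsE.
  by apply/allP => _ /mapP[i _ ->]; exact: frob_root.
- rewrite -DP PKE mu_prod_XsubC count_uniq_mem //; apply/eqP; rewrite eqb1.
  by apply/mapP; exists 0%N; rewrite ?mem_iota ?expr1.
- move=> c; rewrite -horner_map -DP horner_prod; apply: eq_bigr => i _.
  by rewrite hornerXsubC frobB emb_frob.
Qed.

End Orbit.
End FiniteSubfields.

(** * The L-function of a multiplicative character *)

Section Monic.
Variable F : finFieldType.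

Definition monic_of n (v : 'rV[F]_n) : {poly F} := 'X^n + rVpoly v.

Lemma size_monic_of n (v : 'rV[F]_n) : size (monic_of v) = n.+1.
Proof. by rewrite size_polyDl size_polyXn // ltnS size_poly. Qed.

Lemma monic_of_monic n (v : 'rV[F]_n) : monic_of v \is monic.
Proof.
rewrite monicE lead_coefE size_monic_of /= coefD coefXn eqxx.
by rewrite nth_default ?addr0 // size_poly.
Qed.

Lemma monic_ofK n (v : 'rV[F]_n) : poly_rV (monic_of v - 'X^n) = v.
Proof. by rewrite /monic_of addrC addKr rVpolyK. Qed.

Lemma poly_rV_monicK n (g : {poly F}) : g \is monic -> size g = n.+1 ->
  monic_of (poly_rV (g - 'X^n) : 'rV_n) = g.
Proof.
move=> mg sg; rewrite /monic_of poly_rV_K ?subrKC //.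
apply/leq_sizeP => j; rewrite leq_eqVlt => /orP[/eqP<-|ltj].
  rewrite coefB coefXn eqxx; apply/eqP; rewrite subr_eq0.
  by move: mg; rewrite monicE lead_coefE sg.
by rewrite coefB coefXn gtn_eqF // nth_default ?sg // subrr.
Qed.

Lemma sum_monic_dvd (C : nmodType) n e (P : {poly F}) (Phi : {poly F} -> C) :
  P \is monic -> size P = e.+1 -> (e <= n)%N ->
  \sum_(v : 'rV[F]_n | P %| monic_of v) Phi (monic_of v)
  = \sum_(w : 'rV[F]_(n - e)) Phi (P * monic_of w).
Proof.
move=> mP sP le_en.
have sPM w : size (P * monic_of (w : 'rV_(n - e))) = n.+1.
  by rewrite size_Mmonic ?monic_neq0 ?monic_of_monic // sP size_monic_of; lia.
have mPM w : P * monic_of (w : 'rV_(n - e)) \is monic by rewrite monicMl // monic_of_monic.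
rewrite (reindex_onto (fun w : 'rV_(n - e) => poly_rV (P * monic_of w - 'X^n) : 'rV_n)
  (fun v => poly_rV (monic_of v %/ P - 'X^(n - e)))) /=; last first.
  move=> v Pv; rewrite poly_rV_monicK 1?mulrC ?divpK ?monic_ofK //.
    by rewrite -(monicMr _ mP) divpK // monic_of_monic.
  by rewrite size_divp ?monic_neq0 // size_monic_of sP /= subSn.
apply: eq_big => [w|w _]; last by rewrite poly_rV_monicK.
rewrite poly_rV_monicK // dvdp_mulr // [P * _]mulrC mulpK ?monic_neq0 //.
by rewrite monic_ofK eqxx.
Qed.
End Monic.

Section LFunction.
Variables (p : nat) (p_pr : prime p) (K : closedFieldType).
Hypothesis pc : p \in [pchar K].
Variable emb : {rmorphism 'F_p -> K}.
Variables (C : fieldType) (psi : 'F_p -> C) (cs : seq ('F_p * nat)).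
Hypotheses (psi0 : psi 0 = 0) (psi1 : psi 1 = 1) (psiM : {morph psi : a b / a * b}).

(** Composed with [psi] this is a completely multiplicative function of monic polynomials. The node
    0, with exponent one, stands for the simple linear factor of the character sum. *)
Definition eval_at (g : {poly 'F_p}) : 'F_p := g.[0] * \prod_(c <- cs) g.[c.1] ^+ c.2.

(** [x * cofactor_poly.[x]] is [0 - x] times the powers of [c - x]. The norm of [c - x] is the value
    at [c] of the minimal polynomial of [x], so the norm of this product is [eval_at] of that
    polynomial. *)
Definition cofactor_poly : {poly K} := - \prod_(c <- cs) ((emb c.1)%:P - 'X) ^+ c.2.

Definition char_ext (y : K) : C := if [pick a | emb a == y] is Some a then psi a else 0.

Definition Lcoef n : C := \sum_(v : 'rV['F_p]_n) psi (eval_at (monic_of v)).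

Definition power_sum n : C :=
  \sum_(x <- fixfrob p_pr pc n) char_ext (frobnorm p n (x * cofactor_poly.[x])).

Lemma char_ext_emb a : char_ext (emb a) = psi a.
Proof.
rewrite /char_ext; case: pickP => [b /eqP/fmorph_inj->//|/(_ a)].
by rewrite eqxx.
Qed.

Lemma psiX a n : psi (a ^+ n) = psi a ^+ n.
Proof. by elim: n => [|n IHn]; rewrite ?expr0 // !exprS psiM IHn. Qed.

Lemma eval_atM g h : eval_at (g * h) = eval_at g * eval_at h.
Proof.
rewrite /eval_at hornerM mulrACA -big_split /=; congr (_ * _).
by apply: eq_bigr => c _; rewrite hornerM exprMn.
Qed.

Lemma cofactorE x : x * cofactor_poly.[x] = - x * \prod_(c <- cs) (emb c.1 - x) ^+ c.2.
Proof.
rewrite /cofactor_poly hornerN horner_prod mulrN mulNr; congr (- (_ * _)).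
by apply: eq_bigr => c _; rewrite horner_exp hornerD hornerN hornerC hornerX.
Qed.

Lemma frobnorm1 n : frobnorm p n (1 : K) = 1.
Proof. by rewrite /frobnorm big1 // => i _; rewrite expr1n. Qed.

Lemma frobnormX n (x : K) k : frobnorm p n (x ^+ k) = frobnorm p n x ^+ k.
Proof.
by elim: k => [|k IHk]; rewrite ?expr0 ?frobnorm1 // !exprS frobnormM IHk.
Qed.

Lemma cofactor_fixed x e : x ^+ (p ^ e) = x ->
  (x * cofactor_poly.[x]) ^+ (p ^ e) = x * cofactor_poly.[x].
Proof.
move=> xe; rewrite cofactorE exprMn frobN // xe -prodrXl; congr (_ * _).
by apply: eq_bigr => c _; rewrite exprAC frobB // emb_frob // xe.
Qed.

(* The multiplicity of [x] summed over all monic polynomials: a polynomial vanishing at [x] is a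
   multiple of the minimal polynomial of [x], so the sum satisfies a recursion in the degree. *)
Lemma sum_mup_monic x N n : (0 < N)%N -> x ^+ (p ^ N) = x ->
  \sum_(v : 'rV['F_p]_n) psi (eval_at (monic_of v)) * (mup x (map_poly emb (monic_of v)))%:R
  = \sum_(1 <= j < n.+1) Lcoef (n - j) *
      (if x ^+ (p ^ j) == x then char_ext (frobnorm p j (x * cofactor_poly.[x])) else 0).
Proof.
move=> N0 xN.
have [e [P [e0 mP sP divE [rootP mupP evP]]]] := orbit_poly_exists p_pr pc emb N0 xN.
have evPE : emb (eval_at P) = frobnorm p e (x * cofactor_poly.[x]).
  rewrite cofactorE /eval_at rmorphM /= evP rmorph0 sub0r frobnormM rmorph_prod /=.
  congr (_ * _); rewrite (big_morph _ (frobnormM p e) (frobnorm1 e)).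
  by apply: eq_bigr => c _; rewrite rmorphXn /= evP frobnormX.
have xe : x ^+ (p ^ e) = x by apply/eqP; rewrite divE.
have termE j : (if x ^+ (p ^ j) == x then char_ext (frobnorm p j (x * cofactor_poly.[x])) else 0)
     = if (e %| j)%N then psi (eval_at P) ^+ (j %/ e) else 0.
  rewrite divE; case: ifP => // dej; rewrite -{1}(divnK dej).
  by rewrite frobnorm_mul ?cofactor_fixed // -evPE -rmorphXn char_ext_emb psiX.
under [RHS]eq_bigr => j _ do rewrite termE.
elim/ltn_ind: n => n IHn.
have mup0 v : ~~ (P %| monic_of (v : 'rV_n)) -> mup x (map_poly emb (monic_of v)) = 0%N.
  by rewrite rootP => /mupNroot.
rewrite (bigID (fun v => P %| monic_of v)) /= [X in _ + X]big1 ?addr0; last first.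
  by move=> v /mup0->; rewrite mulr0.
have [lt_ne|le_en] := ltnP n e.
  rewrite big1 => [|v Pv]; last first.
    have := dvdp_leq (monic_neq0 (monic_of_monic v)) Pv.
    by rewrite sP size_monic_of ltnS leqNgt lt_ne.
  rewrite big_nat big1 // => j /andP[j1 jn]; case: ifP => [/dvdn_leq|]; last by rewrite mulr0.
  by lia.
rewrite (sum_monic_dvd (fun g => psi (eval_at g) * (mup x (map_poly emb g))%:R) mP sP le_en).
have mupE w : (mup x (map_poly emb (P * monic_of (w : 'rV_(n - e)))))
            = (mup x (map_poly emb (monic_of w))).+1.
  rewrite rmorphM /= mupM ?mupP // map_poly_eq0 monic_neq0 // monic_of_monic //.
rewrite (eq_bigr (fun w => psi (eval_at P) * psi (eval_at (monic_of w)) + psi (eval_at P) *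
    (psi (eval_at (monic_of w)) * (mup x (map_poly emb (monic_of w)))%:R))); last first.
  move=> w _; transitivity (psi (eval_at (P * monic_of w)) * (mup x (map_poly emb (monic_of w))).+1%:R).
    by congr (_ * _%:R); exact: mupE.
  by rewrite eval_atM psiM -natr1 mulrDr mulr1 addrC mulrA.
rewrite big_split -!mulr_sumr /= IHn; last by lia.
rewrite -/(Lcoef (n - e)).
rewrite (@big_cat_nat _ _ _ e 1%N n.+1) /= ?(leqW le_en) //.
rewrite [X in _ = X + _]big_nat [X in _ = X + _]big1 ?add0r; last first.
  move=> j /andP[j1 je]; case: ifP => [/dvdn_leq|]; last by rewrite mulr0.
  by lia.
rewrite [RHS]big_ltn ?ltnS // dvdnn divnn e0 expr1 [psi _ * Lcoef _]mulrC; congr (_ + _).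
rewrite mulr_sumr -(add1n e) [RHS]big_addn subSn //; apply: eq_bigr => j _.
rewrite [(j + e)%N]addnC subnDA dvdn_addr ?dvdnn // mulrCA; case: ifP => // dj; last by rewrite mulr0.
by rewrite divnDl // divnn e0 add1n exprS.
Qed.

(** A root of a polynomial of degree [n] over the prime field has degree at most [n], and this
    divides [n!]. One finite field thus contains the roots of all these polynomials. *)
Lemma mup_sum_roots n (v : 'rV['F_p]_n) :
  \sum_(x <- fixfrob p_pr pc n`!) mup x (map_poly emb (monic_of v)) = n.
Proof.
set g := map_poly emb (monic_of v).
have [s Ds] := closed_field_poly_normal g.
have gm : g \is monic by rewrite map_monic monic_of_monic.
rewrite (monicP gm) scale1r in Ds.
have ss : size s = n.
  by apply/eq_add_S; rewrite -(size_prod_XsubC s id) -Ds size_map_poly size_monic_of.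
have [uX _ mX] := fixfrobP p_pr pc (fact_gt0 n).
have sX x : x \in s -> x \in fixfrob p_pr pc n`!.
  move=> xs; have rgx : root g x by rewrite Ds root_prod_XsubC.
  rewrite mX; have : ~~ uniq [seq x ^+ (p ^ i) | i <- iota 0 n.+1].
    apply/negP => u; have := @max_poly_roots _ g _ (monic_neq0 gm) _ u.
    rewrite size_map size_iota size_map_poly size_monic_of ltnn => /(_ _)/notF; apply.
    by apply/allP => _ /mapP[i _ ->]; exact: frob_root.
  case/(uniqPn 0) => i [j] [ltij]; rewrite size_map size_iota => ltj.
  rewrite !(nth_map 0%N) ?size_iota ?nth_iota ?add0n ?(ltn_trans ltij ltj) //.
  rewrite -(subnK (ltnW ltij)) frobDn => /(frob_inj p_pr pc)/esym xji.
  have /dvdnP[k ->] : (j - i %| n`!)%N by rewrite dvdn_fact // subn_gt0 ltij /=; lia.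
  by rewrite fixed_frob_mul.
rewrite Ds (eq_bigr (fun x => count_mem x s)) => [|x _]; last exact: mu_prod_XsubC.
rewrite -[RHS]ss; elim: s sX {Ds ss} => [|y s IHs] sX; first by rewrite big1.
rewrite /= big_split /= IHs ?add1n => [|x xs]; last by rewrite sX // inE xs orbT.
rewrite (bigD1_seq y) ?sX ?mem_head //= eqxx big1 ?addn0 // => x.
by rewrite eq_sym => /negPf->.
Qed.

(** The coefficient form of the logarithmic derivative of the L-function. The degree [n] is written
    as the sum of the multiplicities of the roots, and the sum over polynomials is then carried out
    for each root. *)
Lemma power_sum_recurrence n :
  n%:R * Lcoef n = \sum_(1 <= j < n.+1) Lcoef (n - j) * power_sum j.
Proof.
rewrite mulrC [X in X * _]/Lcoef mulr_suml.
under eq_bigr => v _ do rewrite -{2}(mup_sum_roots v) natr_sum mulr_sumr.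
rewrite exchange_big /=.
have [uX _ mX] := fixfrobP p_pr pc (fact_gt0 n).
have fixX x : x \in fixfrob p_pr pc n`! -> x ^+ (p ^ n`!) = x by rewrite mX => /eqP.
rewrite (eq_big_seq _ (fun x xX => sum_mup_monic n (fact_gt0 n) (fixX x xX))).
rewrite exchange_big /= !big_nat; apply: eq_bigr => j /andP[j1 jn].
rewrite -mulr_sumr; congr (_ * _); rewrite -big_mkcond /= -big_filter /power_sum.
apply: perm_big; have [uj _ mj] := fixfrobP p_pr pc j1.
apply: uniq_perm => // [|x]; first exact: filter_uniq.
rewrite mem_filter mX mj andbC; apply/andb_idl => /eqP xj.
have /dvdnP[k ->] : (j %| n`!)%N by rewrite dvdn_fact // j1.
by rewrite fixed_frob_mul.
Qed.

Lemma Lcoef0 : Lcoef 0 = 1.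
Proof.
rewrite /Lcoef (big_pred1 0) => [|v]; last by rewrite /= [v]thinmx0 eqxx.
rewrite /monic_of linear0 addr0 expr0 /eval_at hornerC mul1r big1 // => c _.
by rewrite hornerC expr1n.
Qed.

(** Adding multiples of [h], which vanishes at the nodes of [cs] but not at 0, permutes the monic
    polynomials of degree [n] and changes only their value at 0. This value runs through the whole
    field, where [psi] sums to 0. *)
Lemma Lcoef_eq0 n b : p%:R != 0 :> C -> psi b != 1 -> b != 0 -> (forall c, c \in cs -> c.1 != 0) ->
  (size cs < n)%N -> Lcoef n = 0.
Proof.
move=> Cp psib b0 cs0 ltn.
pose h : {poly 'F_p} := \prod_(c <- cs) ('X - c.1%:P).
have sh : size h = (size cs).+1.
  by rewrite /h -(big_map fst xpredT (fun c => 'X - c%:P)) size_prod_XsubC size_map.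
have h0 : h.[0] != 0.
  rewrite horner_prod prodf_seq_neq0; apply/allP => c /cs0.
  by rewrite hornerXsubC sub0r oppr_eq0.
have hc c : c \in cs -> h.[c.1] = 0.
  by move=> ccs; rewrite horner_prod (big_rem c) //= hornerXsubC subrr mul0r.
have sum0 : \sum_(t : 'F_p) psi t = 0.
  have : \sum_t psi t * (psi b - 1) = 0.
    rewrite -mulr_suml mulrBr mulr1 mulr_suml; apply/eqP; rewrite subr_eq0; apply/eqP.
    rewrite [RHS](reindex_inj (mulIf b0)) /=.
    by apply: eq_bigr => t _; rewrite psiM.
  by rewrite -mulr_suml => /eqP; rewrite mulf_eq0 subr_eq0 (negPf psib) orbF => /eqP.
have shiftE t : Lcoef n = \sum_(v : 'rV['F_p]_n) psi (eval_at (monic_of v + t *: h)).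
  rewrite {1}/Lcoef (reindex_inj (addIr (poly_rV (t *: h)))) /=.
  apply: eq_bigr => v _; rewrite /monic_of linearD /= poly_rV_K ?addrA //.
  by apply: leq_trans (size_scale_leq _ _) _; rewrite sh.
have : \sum_(t : 'F_p) Lcoef n = 0.
  rewrite (eq_bigr _ (fun t _ => shiftE t)) exchange_big /= big1 // => v _.
  pose E := \prod_(c <- cs) (monic_of v).[c.1] ^+ c.2.
  rewrite (eq_bigr (fun t => psi ((monic_of v).[0] + t * h.[0]) * psi E)); last first.
    move=> t _; rewrite -psiM /eval_at hornerD hornerZ; congr (psi (_ * _)).
    by apply: eq_big_seq => c /hc hc0; rewrite hornerD hornerZ hc0 mulr0 addr0.
  rewrite -mulr_suml (_ : \sum_t _ = 0) ?mul0r // -[RHS]sum0.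
  pose k t : 'F_p := (monic_of v).[0] + t * h.[0].
  have kI : injective k by move=> s t /addrI/(mulIf h0).
  by rewrite [RHS](reindex_inj kI).
rewrite sumr_const card_Fp // -mulr_natr => /eqP; rewrite mulf_eq0 (negPf Cp) orbF.
by move/eqP.
Qed.
End LFunction.

(** * Weil's bound *)

Lemma newton_prod (R : idomainType) (ws : seq R) n :
  n%:R * (\prod_(w <- ws) (1 - w *: 'X))`_n =
  \sum_(1 <= j < n.+1) (\prod_(w <- ws) (1 - w *: 'X))`_(n - j) * - \sum_(w <- ws) w ^+ j.
Proof.
elim: ws n => [|w ws IHws] n.
  rewrite !big_nil; under eq_bigr => j _ do rewrite !big_nil oppr0 mulr0.
  rewrite big1 // coef1; case: eqP => [->|_]; by rewrite ?mul0r ?mulr0.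
rewrite !big_cons; set q := \prod_(w <- ws) _ in IHws *.
have coefE i : ((1 - w *: 'X) * q)`_i = q`_i - w * (if i is i'.+1 then q`_i' else 0).
  by rewrite mulrBl mul1r coefB -scalerAl coefZ coefXM; case: i.
under [RHS]eq_bigr => j _ do rewrite big_cons coefE opprD mulrDr.
rewrite coefE big_split /=.
have -> : \sum_(1 <= j < n.+1) (q`_(n - j) - w * (if (n - j)%N is i'.+1 then q`_i' else 0)) * - w ^+ j
   = - (w * (if n is n'.+1 then q`_n' else 0)).
  case: n => [|n]; first by rewrite big_geq // mulr0 oppr0.
  rewrite big_add1 /=.
  pose u j := w ^+ j.+1 * (if (n.+1 - j)%N is i'.+1 then q`_i' else 0).
  rewrite (eq_big_nat _ _ (F2 := fun j => u j.+1 - u j)) => [|j /andP[_ jn]].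
    by rewrite telescope_sumr // /u subnn mulr0 sub0r subn0 expr1.
  rewrite /u subSS subSn //.
  by case: (n - j)%N => [|i]; rewrite ?exprS; ring.
have -> : \sum_(1 <= j < n.+1) (q`_(n - j) - w * (if (n - j)%N is i'.+1 then q`_i' else 0)) *
      - (\sum_(j0 <- ws) j0 ^+ j)
   = n%:R * q`_n - w * (if n is n'.+1 then n'%:R * q`_n' else 0).
  under eq_bigr => j _ do rewrite mulrBl.
  rewrite big_split /= -IHws; congr (_ + _); rewrite sumrN; congr (- _).
  case: n => [|n]; first by rewrite big_geq // mulr0.
  rewrite IHws mulr_sumr big_nat_recr //= subnn !mulr0 mul0r addr0.
  rewrite !big_nat; apply: eq_bigr => j /andP[_ jn]; rewrite subSn // mulrA //.
case: n => [|n]; first by rewrite !mul0r mulr0 subr0 oppr0 addr0.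
by rewrite -natr1; ring.
Qed.

Lemma newton_roots (F : closedFieldType) (a S : nat -> F) m :
  a 0%N = 1 -> (forall n, (m < n)%N -> a n = 0) ->
  (forall n, n%:R * a n = \sum_(1 <= j < n.+1) a (n - j)%N * S j) ->
  exists2 ws : seq F, (size ws <= m)%N &
    forall n, (0 < n)%N -> S n = - \sum_(w <- ws) w ^+ n.
Proof.
move=> a0 am rec; pose L := \poly_(i < m.+1) a i.
have LE n : L`_n = a n by rewrite coef_poly; case: ltnP => // /am->.
have [r Dr] := closed_field_poly_normal L.
have L0 : L.[0] = 1 by rewrite horner_coef0 LE.
have r0 z : z \in r -> z != 0.
  move=> zr; apply/eqP => z0; have : root L z by rewrite Dr rootZ ?root_prod_XsubC // lead_coef_eq0;
    apply/eqP => L00; have := oner_neq0 F; rewrite -L0 L00 horner0 eqxx.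
  by rewrite z0 rootE L0 oner_eq0.
have prodE : L = \prod_(w <- [seq z^-1 | z <- r]) (1 - w *: 'X).
  have E : \prod_(z <- r) ('X - z%:P) = (\prod_(z <- r) (- z)) *: \prod_(w <- [seq z^-1 | z <- r]) (1 - w *: 'X).
    rewrite big_map -scaler_prod !big_seq; apply: eq_bigr => z /r0 z0.
    by rewrite scalerBr scalerA mulNr divff // scaleN1r opprK addrC -alg_polyC scaleNr.
  rewrite {1}Dr E scalerA (_ : _ * _ = 1) ?scale1r //.
  rewrite -[RHS]L0 [in RHS]Dr hornerZ horner_prod; congr (_ * _).
  by apply: eq_bigr => z _; rewrite hornerXsubC sub0r.
exists [seq z^-1 | z <- r].
  rewrite size_map -ltnS -(size_prod_XsubC r id) -(size_scale _ (_ : lead_coef L != 0)) -?Dr ?size_poly //.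
  by rewrite lead_coef_eq0; apply/eqP => L00; have := oner_neq0 F; rewrite -L0 L00 horner0 eqxx.
elim/ltn_ind => n IHn n0.
have := newton_prod [seq z^-1 | z <- r] n; rewrite -prodE LE rec.
rewrite !big_nat_recr //= subnn LE a0 !mul1r.
under [X in _ = X + _]eq_bigr => j _ do rewrite LE.
have -> : \sum_(1 <= i < n) a (n - i)%N * S i = \sum_(1 <= i < n) a (n - i)%N * - (\sum_(w <- [seq z^-1 | z <- r]) w ^+ i).
  by rewrite !big_nat; apply: eq_bigr => i /andP[i0 ltin]; rewrite IHn.
by move/addrI.
Qed.

Lemma bernoulli (R : numDomainType) (x : R) n : 0 <= x -> 1 + x *+ n <= (1 + x) ^+ n.
Proof.
move=> x0; elim: n => [|n IHn]; first by rewrite mulr0n addr0 expr0.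
rewrite exprS; apply: le_trans (ler_wpM2l _ IHn); last by rewrite addr_ge0.
rewrite mulrDl mul1r mulrDr mulr1 mulrS -!addrA lerD2l [X in _ <= X]addrCA lerD2l.
by rewrite lerDl mulr_ge0 // mulrn_wge0.
Qed.

(** If [x / s] exceeded 1, its powers would pass every constant by Bernoulli's inequality. *)
Lemma le_of_pow_le (x s B : algC) n0 : 0 <= x -> 0 <= s -> 0 <= B ->
  (forall n, (n0 <= n)%N -> x ^+ n <= B * s ^+ n) -> x <= s.
Proof.
move=> x0 s0 B0 H; rewrite real_leNgt ?ger0_real //; apply/negP => ltsx.
have [s00|sN0] := eqVneq s 0.
  have := H n0.+1 (leqnSn _); rewrite s00 expr0n mulr0 => h.
  have x00 : 0 < x by rewrite -s00.
  by have := lt_le_trans (exprn_gt0 n0.+1 x00) h; rewrite ltxx.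
have sp : 0 < s by rewrite lt0r sN0.
pose e := x / s - 1.
have e0 : 0 < e by rewrite subr_gt0 ltr_pdivlMr // mul1r.
have xE : x = (1 + e) * s by rewrite /e subrKC divfK.
have := archi_boundP (divr_ge0 B0 (ltW e0)); set N := Num.bound _ => ltN.
have := H (N + n0)%N (leq_addl _ _); rewrite xE exprMn ler_pM2r ?exprn_gt0 //.
move=> /(le_trans (bernoulli (N + n0) (ltW e0))); apply/negP; rewrite -real_ltNge ?realE ?B0 //.
  move: ltN; rewrite ltr_pdivrMr // mulr_natl => /lt_le_trans->//.
  by rewrite mulrnDr addrCA lerDl addr_ge0 // mulrn_wge0 // ltW.
by rewrite addr_ge0 // mulrn_wge0 // ltW.
Qed.

(* Applying [\prod_(y <> z) (E - y)], with [E] the shift, to the sequence of power sums isolates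
   the powers of [z]. *)
Lemma root_le_of_power_sums (zs : seq algC) (s B : algC) n0 : 0 <= s -> 0 <= B ->
  (forall n, (n0 <= n)%N -> `|\sum_(z <- zs) z ^+ n| <= B * s ^+ n) ->
  forall z, z \in zs -> `|z| <= s.
Proof.
move=> s0 B0 H z zzs; pose q := \prod_(y <- rem z (undup zs)) ('X - y%:P).
have qz : q.[z] != 0.
  rewrite -rootE root_prod_XsubC mem_rem_uniq ?undup_uniq //.
  by rewrite inE eqxx.
have qy y : y \in zs -> y != z -> q.[y] = 0.
  move=> yz ne; apply/rootP; rewrite root_prod_XsubC mem_rem_uniq ?undup_uniq //.
  by rewrite !inE mem_undup ne.
have isol n : \sum_(i < size q) q`_i * \sum_(y <- zs) y ^+ (n + i) = (count_mem z zs)%:R * z ^+ n * q.[z].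
  under eq_bigr => i _ do rewrite mulr_sumr.
  rewrite exchange_big /= (eq_bigr (fun y => y ^+ n * q.[y])); last first.
    move=> y _; rewrite horner_coef mulr_sumr; apply: eq_bigr => i _.
    by rewrite exprD mulrCA.
  rewrite (bigID (pred1 z)) /= [X in _ + X]big_seq_cond [X in _ + X]big1 ?addr0; last first.
    by move=> y /andP[yz ne]; rewrite qy // mulr0.
  rewrite (eq_bigr (fun=> z ^+ n * q.[z])); last by move=> y /eqP->.
  by rewrite big_const_seq iter_addr_0 -[RHS]mulrA mulr_natl.
pose c := `|(count_mem z zs)%:R * q.[z]|.
have c0 : 0 < c.
  by rewrite normr_gt0 mulf_neq0 // pnatr_eq0 -lt0n -has_count has_pred1.
apply: (@le_of_pow_le _ _ (\sum_(i < size q) `|q`_i| * (B * s ^+ i) / c) n0) => //.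
  by rewrite sumr_ge0 // => i _; rewrite !mulr_ge0 ?invr_ge0 ?(ltW c0) ?exprn_ge0.
move=> n le_n; rewrite -mulr_suml mulrAC ler_pdivlMr // /c -normrX -normrM.
have -> : z ^+ n * ((count_mem z zs)%:R * q.[z]) = (count_mem z zs)%:R * z ^+ n * q.[z] by ring.
rewrite -isol; apply: le_trans (ler_norm_sum _ _ _) _.
rewrite mulr_suml; apply: ler_sum => i _; rewrite normrM -mulrA ler_wpM2l //.
rewrite -mulrA -exprD [(i + n)%N]addnC; apply: H; exact: leq_trans (leq_addr _ _).
Qed.

Lemma sum_seq_fiber (R : pzSemiRingType) (T : Type) (A : finType) (s : seq T) (b : T -> A) (F : A -> R) :
  \sum_(x <- s) F (b x) = \sum_a (count (fun x => b x == a) s)%:R * F a.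
Proof.
elim: s => [|x s IHs]; first by rewrite big_nil big1 // => a _; rewrite mul0r.
rewrite big_cons IHs /=; under [RHS]eq_bigr => a _ do rewrite natrD mulrDl.
rewrite big_split /=; congr (_ + _); rewrite (bigD1 (b x)) //= eqxx mul1r big1 ?addr0 // => a.
by rewrite eq_sym => /negPf->; rewrite mul0r.
Qed.

Section Weil.
Variables (p : nat) (p_pr : prime p) (K : closedFieldType).
Hypothesis pc : p \in [pchar K].
Variable emb : {rmorphism 'F_p -> K}.
Variables (I : finType) (psi : I -> 'F_p -> algC) (i0 : I) (cs : seq ('F_p * nat)).
Hypotheses (psi0 : forall i, psi i 0 = 0) (psi1 : forall i, psi i 1 = 1).
Hypothesis psiM : forall i, {morph psi i : a b / a * b}.
Hypothesis psi_trivial : forall a, a != 0 -> psi i0 a = 1.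
Hypothesis psi_nontrivial : forall i, i != i0 -> exists2 b, b != 0 & psi i b != 1.
Hypothesis psi_orth : forall a, a != 0 -> \sum_i psi i a = (p.-1)%:R *+ (a == 1).
Hypothesis cs0 : forall c, c \in cs -> c.1 != 0.

Let f1 := cofactor_poly emb cs.
Let D := size f1.

Definition ground_norm n x : 'F_p := char_ext emb id (frobnorm p n (x * f1.[x])).
Definition norm_count n a := count (fun x => ground_norm n x == a) (fixfrob p_pr pc n).

Lemma ground_normE n x : (0 < n)%N -> x \in fixfrob p_pr pc n ->
  emb (ground_norm n x) = frobnorm p n (x * f1.[x]).
Proof.
move=> n0; have [_ _ ->] := fixfrobP p_pr pc n0 => /eqP xn.
have := fixed_frobnorm n0 (cofactor_fixed p_pr pc emb cs xn).
by move=> /(fixed_frob_emb p_pr pc emb)[a E]; rewrite /ground_norm E char_ext_emb.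
Qed.

Lemma char_extE i y : char_ext emb (psi i) y = psi i (char_ext emb id y).
Proof. by rewrite /char_ext; case: pickP => // _; rewrite psi0. Qed.

Lemma norm_count_total n : (0 < n)%N -> (\sum_a norm_count n a = p ^ n)%N.
Proof.
move=> n0; have [_ <- _] := fixfrobP p_pr pc n0.
have := sum_seq_fiber (fixfrob p_pr pc n) (ground_norm n) (fun=> 1%N).
rewrite sum1_size => ->; apply: eq_bigr => a _.
by rewrite mulr1 natn.
Qed.

Let f1_0 : f1.[0] != 0.
Proof.
rewrite hornerN oppr_eq0 horner_prod prodf_seq_neq0; apply/allP => c /cs0 c0 /=.
by rewrite horner_exp expf_neq0 // hornerD hornerN hornerC hornerX subr0 fmorph_eq0.
Qed.

Lemma norm_count0 n : (0 < n)%N -> (norm_count n 0%R <= D)%N.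
Proof.
move=> n0; rewrite /norm_count -size_filter -ltnS.
have f10 : f1 != 0 by apply: contraNneq f1_0 => ->; rewrite horner0.
have -> : D.+1 = size (f1 * 'X) by rewrite size_mulX.
have [us _ _] := fixfrobP p_pr pc n0.
apply: max_poly_roots; rewrite ?filter_uniq ?mulf_neq0 ?polyX_eq0 //.
apply/allP => x; rewrite mem_filter => /andP[/eqP b0 xs].
have := ground_normE n0 xs; rewrite b0 rmorph0 => /esym/eqP.
rewrite prodf_seq_eq0 => /hasP[i _ /andP[_]].
rewrite expf_eq0 => /andP[_ /eqP y0].
by rewrite rootE hornerM hornerX mulrC y0.
Qed.

(** The norm of [y] is [y ^ G] with [G = (p ^ n - 1) / (p - 1)], so [stepanov] applies with
    [d = p - 1]. The parameter [k = p ^ (nu - nu0)] is, up to a constant factor, the largest that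
    [big_G] permits; dividing by it leaves an error of order [p ^ nu], the square root of the field
    size. *)
Lemma norm_count_le : exists B nu0, forall nu a, (nu0 <= nu)%N -> a != 0 ->
  (p.-1 * norm_count (nu + nu) a <= p ^ (nu + nu) + B * p ^ nu)%N.
Proof.
have p1 := prime_gt1 p_pr.
set d := p.-1; have d0 : (0 < d)%N by rewrite /d; lia.
pose w := (d * (d * D).+1)%N; pose nu0 := w.+1.
exists (p ^ nu0 * (2 * D + 4))%N, nu0 => nu a le_nu a0.
set n := (nu + nu)%N; have n0 : (0 < n)%N by rewrite /n /nu0 in le_nu *; lia.
set G := (\sum_(i < n) p ^ i)%N; set k := (p ^ (nu - nu0))%N.
have QE : (p ^ n = (d * G).+1)%N by rewrite -predn_exp prednK // expn_gt0 prime_gt0.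
have k0 : (0 < k)%N by rewrite expn_gt0 prime_gt0.
have QkE : (p ^ n = k * (p ^ nu0 * p ^ nu))%N by rewrite -!expnD; congr (_ ^ _)%N; rewrite /n; lia.
have big_G : (k * (d * (k * (d * D).+1)) <= G)%N.
  have -> : (k * (d * (k * (d * D).+1)) = k * k * w)%N by rewrite /w; lia.
  apply: (@leq_trans (p ^ n.-1)); last first.
    by rewrite /G -(prednK n0) big_ord_recr /= leq_addl.
  have -> : (p ^ n.-1 = k * k * p ^ (nu0 + nu0).-1)%N.
    by rewrite /k -!expnD; congr (_ ^ _)%N; rewrite /n /nu0 in le_nu *; lia.
  rewrite leq_mul2l; apply/orP; right; apply: leq_trans (ltnW (ltn_expl w p1)) _.
  by rewrite leq_exp2l // /nu0; lia.
have kdG : (k * d <= G)%N.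
  by apply: leq_trans big_G; rewrite leq_pmul2l // leq_pmulr // muln_gt0 k0.
have G0 : (0 < G)%N by apply: leq_trans kdG; rewrite muln_gt0 k0.
pose s := [seq x <- fixfrob p_pr pc n | ground_norm n x == a].
have [us ss ms] := fixfrobP p_pr pc n0.
have sE : size s = norm_count n a by rewrite size_filter.
have s_le : (size s <= p ^ n)%N by rewrite -ss size_filter count_size.
have := @stepanov K p n d G k f1 (emb a) pc d0 k0 QE f1_0 big_G s (filter_uniq _ us).
rewrite -/D => /(_ _)/wrap[].
  move=> x; rewrite mem_filter => /andP[/eqP ba xs].
  have bE := ground_normE n0 xs; rewrite ba in bE.
  have yG : (x * f1.[x]) ^+ G = emb a by rewrite bE /frobnorm -expr_sum.
  split=> //; first by apply/eqP; rewrite -ms.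
  apply: contraNneq a0 => y0; move: yG; rewrite y0 expr0n => /esym/eqP.
  by rewrite gtn_eqF // fmorph_eq0.
rewrite -sE => bnd; rewrite -(leq_pmul2l k0).
have GQ : (G <= p ^ n)%N by rewrite QE ltnW // ltnS leq_pmull.
have h1 : (k * d * D <= p ^ n * D)%N by rewrite leq_mul2r (leq_trans kdG GQ) orbT.
have h2 : (d * G * D <= p ^ n * D)%N by rewrite leq_mul2r QE leqnSn orbT.
have h3 : (G.+1 <= p ^ n + 1)%N by rewrite addn1 ltnS.
have h4 : (0 < p ^ n)%N by rewrite expn_gt0 prime_gt0.
have h5 : (size s * (k * d) = size s * (k * d).-1 + size s)%N.
  by rewrite -{1}(prednK (_ : 0 < k * d)%N) ?muln_gt0 ?k0 // mulnS addnC.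
have -> : (k * (d * size s) = size s * (k * d))%N by lia.
have -> : (k * (p ^ n + p ^ nu0 * (2 * D + 4) * p ^ nu) = k * p ^ n + p ^ n * (2 * D + 4))%N.
  by rewrite mulnDr {3}QkE; lia.
have -> : (p ^ n * (2 * D + 4) = p ^ n * D + p ^ n * D + 4 * p ^ n)%N by lia.
move: h1 h2 bnd s_le h3 h4; rewrite h5.
move: (p ^ n * D)%N (k * p ^ n)%N (p ^ n)%N (d * G * D)%N (k * d * D)%N (size s * _)%N; lia.
Qed.

Lemma sum_psi_nontrivial a : \sum_(i | i != i0) psi i a = (p.-1)%:R *+ (a == 1) - (a != 0)%:R.
Proof.
have [->|a0] := eqVneq a 0.
  have -> : (0 == 1 :> 'F_p) = false by rewrite eq_sym; apply/negbTE/oner_neq0.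
  by rewrite mulr0n subr0 big1.
have := psi_orth a0; rewrite (bigD1 i0) //= psi_trivial // => <-.
by rewrite [1 + _]addrC addrK.
Qed.

(** By orthogonality the sum is [p - 1] times the count for norm 1, minus the count of all nonzero
    norms. One direction is [norm_count_le] for norm 1. The other applies it to the remaining
    [p - 2] nonzero norms, since all counts add up to [p ^ n]. *)
Lemma sum_power_sum_bound : exists (B : nat) nu0, forall nu, (nu0 <= nu)%N ->
  `|\sum_(i | i != i0) power_sum p_pr pc emb (psi i) cs (nu + nu)| <= B%:R * p%:R ^+ nu.
Proof.
have [B [nu0 HB]] := norm_count_le; have p1 := prime_gt1 p_pr.
exists (p.-1 * (B + D))%N, nu0.+1 => nu lt_nu; have n0 : (0 < nu + nu)%N by lia.
have {}HB a : a != 0 -> (p.-1 * norm_count (nu + nu) a <= p ^ (nu + nu) + B * p ^ nu)%N.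
  by apply: HB; exact: ltnW.
set n := (nu + nu)%N in n0 HB *.
have -> : \sum_(i | i != i0) power_sum p_pr pc emb (psi i) cs n =
    \sum_(x <- fixfrob p_pr pc n) \sum_(i | i != i0) psi i (ground_norm n x).
  rewrite exchange_big; apply: eq_bigr => i _; apply: eq_bigr => x _.
  by rewrite char_extE.
rewrite (sum_seq_fiber _ _ (fun a => \sum_(i | i != i0) psi i a)) -/(norm_count n _).
pose U := (\sum_(a | a != 0%R) norm_count n a)%N.
have totE : (norm_count n 0%R + U = p ^ n)%N.
  by rewrite -(norm_count_total n0) (bigD1 0%R).
have -> : \sum_a (norm_count n a)%:R * (\sum_(i | i != i0) psi i a) =
    (p.-1 * norm_count n 1%R)%N%:R - U%:R.
  under eq_bigr => a _ do rewrite sum_psi_nontrivial mulrBr.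
  rewrite big_split /= sumrN; congr (_ - _).
    rewrite (bigD1 (1 : 'F_p)) // eqxx mulr1n big1 => [|a /negPf->]; last by rewrite mulr0n mulr0.
    by rewrite /= addr0 natrM mulrC.
  rewrite /U natr_sum [RHS]big_mkcond; apply: eq_bigr => a _.
  by case: eqVneq; rewrite ?mulr0 ?mulr1.
have UE : U = (norm_count n 1%R + \sum_(a : 'F_p | (a != 0%R) && (a != 1%R)) norm_count n a)%N.
  by rewrite /U (bigD1 1%R) ?oner_eq0.
have up : (p.-1 * norm_count n 1%R <= U + p.-1 * (B + D) * p ^ nu)%N.
  have := HB 1 (oner_neq0 _); have := norm_count0 n0.
  have : (D <= D * p ^ nu)%N by rewrite leq_pmulr // expn_gt0 prime_gt0.
  have : (1 * ((B + D) * p ^ nu) <= p.-1 * ((B + D) * p ^ nu))%N by rewrite leq_mul2r; lia.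
  rewrite -mulnA; lia.
have lo : (U <= p.-1 * norm_count n 1%R + p.-1 * (B + D) * p ^ nu)%N.
  have h : (p.-1 * \sum_(a : 'F_p | (a != 0%R) && (a != 1%R)) norm_count n a
         <= (p.-1 - 1) * (p ^ n + B * p ^ nu))%N.
    rewrite big_distrr /=.
    apply: (@leq_trans (\sum_(a : 'F_p | (a != 0%R) && (a != 1%R)) (p ^ n + B * p ^ nu))%N).
      by apply: leq_sum => a /andP[a0 _]; exact: HB.
    rewrite sum_nat_const leq_mul2r; apply/orP; right.
    have := cardC (pred2 (0 : 'F_p) 1); 
    have e01 : (0 == 1 :> 'F_p) = false by rewrite eq_sym; apply/negbTE/oner_neq0.
    rewrite card2 card_Fp // e01 /=.
    have le2 m : (2 + m = p)%N -> (m <= p.-1 - 1)%N by lia.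
    move=> E; apply: le2; rewrite -[RHS]E; congr (2 + _)%N.
    by apply: eq_card => a; rewrite !inE negb_or.
  have h0 := norm_count0 n0.
  have h2 : (D <= D * p ^ nu)%N by rewrite leq_pmulr // expn_gt0 prime_gt0.
  have h3 : (p.-1 * norm_count n 0%R <= p.-1 * (D * p ^ nu))%N.
    by rewrite leq_mul2l (leq_trans h0 h2) orbT.
  move: h h3 totE; rewrite UE -(prednK (_ : 0 < p.-1)%N); last by lia.
  move: (p ^ n)%N (p ^ nu)%N (norm_count n 0%R) (norm_count n 1%R) (p.-1.-1).
  move: (\sum_(a : 'F_p | (a != 0%R) && (a != 1%R)) norm_count n a)%N => S Q r c0 c1 d.
  lia.
rewrite -natrX -natrM real_ler_distl; last by rewrite realB ?realn.
by rewrite -natrD ler_nat up andbT lerBlDr -natrD ler_nat.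
Qed.

Lemma power_sum1 i :
  power_sum p_pr pc emb (psi i) cs 1 = \sum_a psi i (a * \prod_(c <- cs) (c.1 + a) ^+ c.2).
Proof.
have [us ss ms] := fixfrobP p_pr pc (ltnSn 0).
have embs : perm_eq (fixfrob p_pr pc 1) (codom emb).
  rewrite uniq_perm ?(map_inj_uniq (@fmorph_inj _ _ emb)) ?enum_uniq // => x.
  rewrite ms expn1; apply/eqP/codomP => [/(fixed_frob_emb p_pr pc emb)//|[a ->]].
  by have := emb_frob p_pr emb a 1; rewrite expn1.
rewrite /power_sum (perm_big _ embs) big_image (reindex_inj (inv_inj opprK)).
apply: eq_big => // a _.
change (char_ext emb (psi i) (frobnorm p 1 (emb (- a) * (cofactor_poly emb cs).[emb (- a)]))
  = psi i (a * \prod_(c <- cs) (c.1 + a) ^+ c.2)).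
rewrite /frobnorm big_ord1 expr1 cofactorE rmorphN opprK.
rewrite (_ : emb a * _ = emb (a * \prod_(c <- cs) (c.1 + a) ^+ c.2)) ?char_ext_emb //.
rewrite rmorphM rmorph_prod; congr (_ * _); apply: eq_bigr => c _.
by rewrite -rmorphD -rmorphXn.
Qed.

(** The power sums are controlled for even exponents only, so the squares of the inverse roots are
    considered, for all nontrivial characters at once. All of them occur with the same sign and
    cannot cancel, hence each square has modulus at most [p]. *)
Lemma weil_of_embedding i : i != i0 ->
  `|\sum_a psi i (a * \prod_(c <- cs) (c.1 + a) ^+ c.2)| <= (size cs)%:R * sqrtC p%:R.
Proof.
move=> ii0.
have roots j : j != i0 -> exists ws : seq algC, (size ws <= size cs)%N /\
    forall n, (0 < n)%N -> power_sum p_pr pc emb (psi j) cs n = - \sum_(w <- ws) w ^+ n.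
  move=> jj0; have [b b0 psib] := psi_nontrivial jj0.
  have [||n|ws sws Hws] := @newton_roots algC (Lcoef (psi j) cs) (power_sum p_pr pc emb (psi j) cs) (size cs).
  - exact: Lcoef0.
  - move=> n; apply: (Lcoef_eq0 p_pr (psiM j) (b := b)) => //.
    by rewrite pnatr_eq0 -lt0n prime_gt0.
  - exact: power_sum_recurrence.
  by exists ws.
have /fin_all_exists[ws Hws] j : exists ws : seq algC, j != i0 -> (size ws <= size cs)%N /\
    forall n, (0 < n)%N -> power_sum p_pr pc emb (psi j) cs n = - \sum_(w <- ws) w ^+ n.
  by have [->|/roots[w]] := eqVneq j i0; [exists [::] | exists w].
pose zs := flatten [seq [seq w ^+ 2 | w <- ws j] | j <- enum I & j != i0].
have [B [nu0 HB]] := sum_power_sum_bound.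
have zsE n : \sum_(z <- zs) z ^+ n = \sum_(j | j != i0) \sum_(w <- ws j) w ^+ (n + n).
  rewrite /zs big_flatten big_map big_filter big_enum_cond /=.
  by apply: eq_bigr => j _; rewrite big_map; apply: eq_bigr => w _; rewrite -exprM mul2n addnn.
have le_p w : w \in ws i -> `|w| <= sqrtC p%:R.
  move=> wi; rewrite -(@ler_sqr _ `|w|) ?nnegrE ?sqrtC_ge0 ?ler0n // sqrtCK -normrX.
  apply: (@root_le_of_power_sums zs p%:R B%:R nu0.+1) => //.
    move=> n lt_n; rewrite zsE; have := HB n (ltnW lt_n).
    rewrite -normrN -sumrN (eq_bigr (fun j => \sum_(w <- ws j) w ^+ (n + n))) // => j /Hws[_ ->].
      by rewrite opprK.
    by lia.
  apply/flatten_mapP; exists i; first by rewrite mem_filter ii0 mem_enum.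
  by apply/mapP; exists w.
have [sws Hw] := Hws i ii0.
rewrite -power_sum1 Hw // normrN; apply: le_trans (ler_norm_sum _ _ _) _.
apply: (@le_trans _ _ (\sum_(w <- ws i) sqrtC p%:R)).
  by rewrite !big_seq; apply: ler_sum => w wi; rewrite expr1 le_p.
rewrite big_const_seq count_predT iter_addr_0 -[X in X <= _]mulr_natl ler_wpM2r ?sqrtC_ge0 ?ler0n //.
by rewrite ler_nat.
Qed.
End Weil.

Theorem weil_bound (p : nat) (p_pr : prime p) (I : finType) (psi : I -> 'F_p -> algC) (i0 : I)
    (cs : seq ('F_p * nat)) :
  (forall i, psi i 0 = 0) -> (forall i, psi i 1 = 1) ->
  (forall i, {morph psi i : a b / a * b}) ->
  (forall a, a != 0 -> psi i0 a = 1) ->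
  (forall i, i != i0 -> exists2 b, b != 0 & psi i b != 1) ->
  (forall a, a != 0 -> \sum_i psi i a = (p.-1)%:R *+ (a == 1)) ->
  (forall c, c \in cs -> c.1 != 0) ->
  forall i, i != i0 ->
  `|\sum_a psi i (a * \prod_(c <- cs) (c.1 + a) ^+ c.2)| <= (size cs)%:R * sqrtC p%:R.
Proof.
move=> psi0 psi1 psiM psit psin psio cs0 i.
have [K [emb _]] := countable_algebraic_closure 'F_p.
have pc : p \in [pchar K] by rewrite (rmorph_pchar emb) // pchar_Fp.
exact: (@weil_of_embedding p p_pr K pc emb I psi i0 cs psi0 psi1 psiM psit psin psio cs0).
Qed.

(** * Dirichlet characters *)

Definition dchar (q : nat) (chi : nat -> algC) : Prop :=
  [/\ chi 1%N = 1, forall m n, chi (m * n)%N = chi m * chi n,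
      forall n, chi (n %% q)%N = chi n & forall n, (chi n != 0) = coprime n q].

Section Dchar.
Variables (q : nat) (chi : nat -> algC) (chiP : dchar q chi).

Lemma dchar1 : chi 1%N = 1. Proof. by case: chiP. Qed.
Lemma dcharM m n : chi (m * n)%N = chi m * chi n. Proof. by case: chiP. Qed.
Lemma dchar_neq0 n : (chi n != 0) = coprime n q. Proof. by case: chiP. Qed.
Lemma dchar_eq0 n : ~~ coprime n q -> chi n = 0.
Proof. by rewrite -dchar_neq0 negbK => /eqP. Qed.

Lemma dchar_mod m n : m = n %[mod q] -> chi m = chi n.
Proof. by case: chiP => _ _ H _ mn; rewrite -H mn H. Qed.

Lemma dcharX n k : chi (n ^ k)%N = chi n ^+ k.
Proof.
by elim: k => [|k IHk]; rewrite ?expr0 ?dchar1 // expnS exprS dcharM IHk.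
Qed.

Lemma dchar_prod I (r : seq I) (P : pred I) (F : I -> nat) :
  chi (\prod_(i <- r | P i) F i)%N = \prod_(i <- r | P i) chi (F i).
Proof. by rewrite (big_morph chi dcharM dchar1). Qed.

Lemma dchar_totient n : coprime n q -> chi n ^+ totient q = 1.
Proof.
by move=> cnq; rewrite -dcharX (dchar_mod (Euler_exp_totient cnq)) dchar1.
Qed.

Lemma dchar_norm n : `|chi n| = (coprime n q)%:R.
Proof.
case: (boolP (coprime n q)) => [cnq|/dchar_eq0->]; last by rewrite normr0.
have [q0|q0] := posnP q.
  have n1 : n = 1%N by move: cnq; rewrite q0 /coprime gcdn0 => /eqP.
  by rewrite n1 dchar1 normr1.
apply/eqP; rewrite -(@pexpr_eq1 _ _ (totient q)) ?totient_gt0 //.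
by rewrite -normrX dchar_totient // normr1.
Qed.

Lemma dchar_norm_le1 n : `|chi n| <= 1.
Proof. by rewrite dchar_norm lern1 leq_b1. Qed.

Lemma dchar_conj : dchar q (fun n => (chi n)^*).
Proof.
case: chiP => c1 cM cq c0; split=> [|m n|n|n]; rewrite ?c1 ?cM ?cq ?rmorph1 ?rmorphM //.
by rewrite conjC_eq0 c0.
Qed.

Definition nonprincipal := exists2 b, coprime b q & chi b != 1.

Lemma dchar_sum0 : (0 < q)%N -> nonprincipal -> \sum_(a < q) chi a = 0.
Proof.
move=> q0 [b cbq bN1]; pose h (a : 'I_q) : 'I_q := Ordinal (ltn_pmod (a * b) q0).
have hI : injective h.
  move=> x y [/eqP]; wlog le_yx : x y / (y <= x)%N => [H E|].
    by have [/H|/ltnW/H] := leqP y x; [exact|move=> /(_ (_ : _))/esym; apply; rewrite eq_sym].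
  rewrite eqn_mod_dvd ?leq_mul2r ?le_yx ?orbT // -mulnBl Gauss_dvdl 1?coprime_sym //.
  move=> /dvdn_leq; have [/eqP|_ /(_ isT)] := posnP (x - y).
    by rewrite subn_eq0 => le_xy; move=> _; apply/val_inj/eqP; rewrite eqn_leq le_xy.
  by have := ltn_ord x; lia.
have : \sum_(a < q) chi a * (chi b - 1) = 0.
  rewrite -mulr_suml mulrBr mulr1 mulr_suml; apply/eqP; rewrite subr_eq0; apply/eqP.
  rewrite [RHS](reindex_inj hI) /=; apply: eq_bigr => a _.
  by rewrite -dcharM; apply: dchar_mod; rewrite modn_mod.
by rewrite -mulr_suml => /eqP; rewrite mulf_eq0 subr_eq0 (negPf bN1) orbF => /eqP.
Qed.
End Dchar.

Lemma dcharMl q chi1 chi2 : dchar q chi1 -> dchar q chi2 -> dchar q (fun n => chi1 n * chi2 n).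
Proof.
move=> h1 h2; split=> [|m n|n|n].
- by rewrite (dchar1 h1) (dchar1 h2) mulr1.
- by rewrite (dcharM h1) (dcharM h2) mulrACA.
- by congr (_ * _); [apply: (dchar_mod h1)|apply: (dchar_mod h2)]; rewrite modn_mod.
- by rewrite mulf_eq0 negb_or (dchar_neq0 h1) (dchar_neq0 h2) andbb.
Qed.

Section Dirichlet.
Variables (q : nat) (q1 : (1 < q)%N).
Let G := [set: {unit 'Z_q}]%G.

Definition dirichlet_index := Iirr G.
Definition dirichlet (i : dirichlet_index) (n : nat) : algC :=
  if insub (n%:R : 'Z_q) is Some u then 'chi_i (u : {unit 'Z_q}) else 0.

Lemma abelianG : abelian G. Proof. exact: units_Zp_abelian. Qed.

Lemma dirichlet_unit n : coprime n q -> exists2 u : {unit 'Z_q}, val u = n%:R &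
  forall i, dirichlet i n = 'chi_i u.
Proof.
move=> cnq; have un : (n%:R : 'Z_q) \is a GRing.unit by rewrite unitZpE // coprime_sym.
by exists (Sub (n%:R : 'Z_q) un : {unit 'Z_q}) => [|i]; rewrite ?SubK // /dirichlet insubT.
Qed.

Lemma dirichlet_dchar i : dchar q (dirichlet i).
Proof.
have lin : 'chi_i \is a linear_char by have /char_abelianP := abelianG; apply.
split=> [|m n|n|n].
- have [u uE ->] := dirichlet_unit (coprime1n q).
  by rewrite (_ : u = 1%g) ?lin_char1 //; apply: val_inj; rewrite uE.
- case: (boolP (coprime (m * n) q)) => [|cmn].
    move=> cmn; have [w wE ->] := dirichlet_unit cmn; move: cmn; rewrite coprimeMl => /andP[cm cn].
    have [u uE ->] := dirichlet_unit cm; have [v vE ->] := dirichlet_unit cn.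
    rewrite -lin_charM ?inE //; congr ('chi_i _); apply: val_inj.
    by rewrite wE natrM -uE -vE.
  have d0 k : ~~ coprime k q -> dirichlet i k = 0.
    by move=> ck; rewrite /dirichlet insubF // unitZpE // coprime_sym (negPf ck).
  rewrite d0 //; move: cmn; rewrite coprimeMl negb_and => /orP[]/d0->; by rewrite ?mul0r ?mulr0.
- by rewrite /dirichlet Zp_nat_mod.
- case: (boolP (coprime n q)) => [cn|cn].
    by have [u _ ->] := dirichlet_unit cn; rewrite lin_char_neq0 ?inE.
  by rewrite /dirichlet insubF ?eqxx // unitZpE // coprime_sym (negPf cn).
Qed.

Lemma dirichlet0 n : dirichlet 0 n = (coprime n q)%:R.
Proof.
case: (boolP (coprime n q)) => [cn|cn]; last by rewrite (dchar_eq0 (dirichlet_dchar 0)).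
by have [u _ ->] := dirichlet_unit cn; rewrite irr0 cfun1E inE.
Qed.

Lemma dirichlet_orth m n : coprime m q -> coprime n q ->
  \sum_i dirichlet i m * (dirichlet i n)^* = (totient q)%:R *+ (m == n %[mod q]).
Proof.
move=> cm cn; have [u uE uD] := dirichlet_unit cm; have [v vE vD] := dirichlet_unit cn.
under eq_bigr => i _ do rewrite uD vD.
rewrite second_orthogonality_relation ?inE //.
have -> : 'C_G[u]%g = G.
  by apply/setIidPl; rewrite sub_cent1 (subsetP (abelianG : G \subset 'C(G))%g) ?inE.
have -> : (v ^: G)%g = [set v]%SET by apply/abelian_classP; rewrite ?inE //; exact: abelianG.
rewrite inE cardsT -cardsT -/(units_Zp q) card_units_Zp; last exact: ltnW.
congr (_ *+ nat_of_bool _); apply/eqP/eqP => [uv|mn].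
  have := congr1 (fun u : {unit 'Z_q} => (val u : nat)) uv.
  by rewrite /= uE vE !val_Zp_nat.
apply: val_inj; apply: val_inj.
by rewrite /= uE vE !val_Zp_nat.
Qed.

Lemma dirichlet_parseval (D : nat -> algC) :
  \sum_i `|\sum_(a < q) D a * dirichlet i a| ^+ 2 =
  (totient q)%:R * \sum_(a < q | coprime a q) `|D a| ^+ 2.
Proof.
under eq_bigr => i _ do rewrite normCK rmorph_sum mulr_suml.
rewrite exchange_big /= mulr_sumr [RHS]big_mkcond; apply: eq_bigr => a _.
under eq_bigr => i _ do rewrite mulr_sumr.
rewrite exchange_big /=; case: ifP => [ca|/negbT ca]; last first.
  rewrite big1 // => b _; rewrite big1 // => i _.
  by rewrite (dchar_eq0 (dirichlet_dchar i) ca) mulr0 mul0r.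
rewrite (bigD1 a) //= [X in _ + X]big1 ?addr0 => [|b ne_ba].
  under eq_bigr => i _ do rewrite rmorphM /= mulrACA -normCK.
  by rewrite -mulr_sumr dirichlet_orth // eqxx mulr1n mulrC.
case: (boolP (coprime b q)) => [cb|cb]; last first.
  rewrite big1 // => i _.
  by rewrite (dchar_eq0 (dirichlet_dchar i) cb) mulr0 rmorph0 mulr0.
under eq_bigr => i _ do rewrite rmorphM /= mulrACA.
rewrite -mulr_sumr dirichlet_orth // !modn_small // eq_sym.
by rewrite -(inj_eq val_inj) in ne_ba; rewrite (negPf ne_ba) mulr0n mulr0.
Qed.

Lemma dirichlet_nonprincipal i : i != 0 -> nonprincipal q (dirichlet i).
Proof.
move=> i0; have : 'chi_i != 'chi_0 by rewrite (inj_eq irr_inj).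
move=> ne; have [u neu] : exists u, 'chi_i u != 'chi[G]_0 u.
  apply/existsP; apply: contraR ne => /existsPn H.
  by apply/eqP/cfunP => u; apply/eqP; move: (H u); rewrite negbK.
have cu : coprime (val u : 'Z_q) q.
  have := valP u; rewrite /= -{1}[val u]natr_Zp unitZpE // coprime_sym //.
exists (val u : 'Z_q) => //; have [v vE ->] := dirichlet_unit cu.
have -> : v = u by apply: val_inj; rewrite vE natr_Zp.
by move: neu; rewrite irr0 cfun1E inE.
Qed.

(** By Parseval some [dirichlet i] is not orthogonal to [chi]. Its product with the conjugate of
    [chi] is then a character with nonzero complete sum, hence principal. *)
Lemma dchar_dirichlet chi : dchar q chi -> exists i, chi =1 dirichlet i.
Proof.
move=> chiP; have q0 := ltnW q1.
have [i ine] : exists i, \sum_(a < q) (chi a)^* * dirichlet i a != 0.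
  apply/existsP; apply: contraT => /existsPn H.
  have := dirichlet_parseval (fun a => (chi a)^*).
  rewrite big1 => [|i _]; last by have /negPn/eqP-> := H i; rewrite normr0 expr0n.
  move/esym/eqP; rewrite mulf_eq0 pnatr_eq0 -leqn0 leqNgt totient_gt0 q0 /=.
  rewrite psumr_eq0 => [/allP/(_ (Ordinal q1) (mem_index_enum _))|a _]; last by rewrite exprn_ge0.
  by rewrite /= coprime1n norm_conjC (dchar1 chiP) normr1 expr1n oner_eq0.
exists i => n; have psiP := dcharMl (dchar_conj chiP) (dirichlet_dchar i).
have triv b : coprime b q -> (chi b)^* * dirichlet i b = 1.
  move=> cb; apply: contraNeq ine => ne1.
  by apply/eqP; apply: (dchar_sum0 psiP q0); exists b.
case: (boolP (coprime n q)) => [cn|cn]; last first.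
  by rewrite (dchar_eq0 chiP cn) (dchar_eq0 (dirichlet_dchar i) cn).
by rewrite -[LHS]mulr1 -(triv n cn) mulrA -normCK (dchar_norm chiP) cn expr1n mul1r.
Qed.
End Dirichlet.

Lemma dchar_weil p chi b (bs : seq (nat * nat)) : prime p -> dchar p chi -> nonprincipal p chi ->
  (forall c, c \in bs -> c.1 != b %[mod p]) ->
  `|\sum_(x < p) chi ((x + b) * \prod_(c <- bs) (x + c.1) ^ c.2)%N| <= (size bs)%:R * sqrtC p%:R.
Proof.
move=> p_pr chiP chiN bsN; have p1 := prime_gt1 p_pr; have p0 := ltnW p1.
have [i iE] := dchar_dirichlet p1 chiP.
have i0 : i != 0.
  apply/eqP => i0; case: chiN => c cp; by rewrite iE i0 (dirichlet0 p1) cp eqxx.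
pose psi (j : dirichlet_index p) (a : 'F_p) := dirichlet j (a : nat).
have copF (a : 'F_p) : coprime (a : nat) p = (a != 0).
  rewrite coprime_sym prime_coprime //.
  have := ltn_ord a; rewrite [X in (_ < X)%N]Fp_cast // => lt_ap.
  have [->|a0] := eqVneq a 0; first by rewrite dvdn0.
  by rewrite gtnNdvd // lt0n; apply: contra_neq a0 => a0; apply: val_inj.
have nat_mod m : (m%:R : 'F_p) = (m %% p)%N :> nat by rewrite val_Fp_nat.
pose cs := [seq ((c.1%:R - b%:R : 'F_p), c.2) | c <- bs].
have chiE m : chi m = psi i (m%:R : 'F_p).
  by rewrite iE /psi nat_mod (dchar_mod (dirichlet_dchar p1 i) (_ : m %% p = m %[mod p])) ?modn_mod.
have natF (a : 'F_p) : ((a : nat)%:R : 'F_p) = a by rewrite natr_Zp.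
have psiM j : {morph psi j : u v / u * v}.
  move=> u v; rewrite /psi -(dcharM (dirichlet_dchar p1 j)).
  apply: (dchar_mod (dirichlet_dchar p1 j)).
  by rewrite -{1}[u]natF -{1}[v]natF -natrM nat_mod modn_mod.
have := @weil_bound p p_pr (dirichlet_index p) psi 0 cs.
case/(_ _ _ _ _ _ _ _ i i0)/wrap.
- by move=> j; apply: (dchar_eq0 (dirichlet_dchar p1 j)); rewrite copF eqxx.
- by move=> j; rewrite -[RHS](dchar1 (dirichlet_dchar p1 j)).
- exact: psiM.
- by move=> a a0; rewrite /psi (dirichlet0 p1) copF a0.
- move=> j j0; have [c cp cN] := dirichlet_nonprincipal p1 j0.
  exists (c%:R : 'F_p); first by rewrite -copF nat_mod coprime_modl.
  by rewrite /psi nat_mod (dchar_mod (dirichlet_dchar p1 j) (_ : c %% p = c %[mod p])) ?modn_mod.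
- move=> a a0; have ca : coprime (a : nat) p by rewrite copF.
  have := dirichlet_orth p1 ca (coprime1n p); rewrite totient_prime //.
  under eq_bigr => j _ do rewrite (dchar1 (dirichlet_dchar p1 j)) rmorph1 mulr1.
  move=> ->; congr (_ *+ nat_of_bool _); rewrite -(inj_eq val_inj) /=.
  by rewrite !modn_small // -[X in (_ < X)%N](Fp_cast p_pr) ltn_ord.
- move=> _ /mapP[c /bsN cb ->] /=; rewrite subr_eq0; apply: contra cb => /eqP cb.
  by rewrite -!nat_mod cb.
rewrite size_map => le; apply: le_trans le; rewrite le_eqVlt; apply/orP; left; apply/eqP; congr `|_|.
(* The shift by [b] moves the simple factor to the node 0, where [weil_bound] has it. *)
rewrite [RHS](reindex_inj (addIr (b%:R : 'F_p))) /=.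
rewrite -(big_mkord xpredT (fun x => chi ((x + b) * \prod_(c <- bs) (x + c.1) ^ c.2)%N)).
rewrite -{1}(Fp_cast p_pr) big_mkord; apply: eq_bigr => x _.
rewrite chiE natrM natrD natF big_map natr_prod; congr (psi i (_ * _)).
by apply: eq_bigr => c _; rewrite natrX natrD natF /= addrCA subrK.
Qed.

(** * Complete character sums to cube-free moduli *)

Section PeriodicSums.
Variable V : nmodType.
Implicit Types g : nat -> V.

Lemma sum_mixed_radix g m n :
  \sum_(x < m * n) g x = \sum_(y < m) \sum_(z < n) g (y + m * z)%N.
Proof.
elim: n => [|n IHn].
  by rewrite muln0 big_ord0 big1 // => y _; rewrite big_ord0.
rewrite -(big_mkord xpredT g) (@big_cat_nat _ _ _ (m * n)%N) ?leq_mul2l ?leqnSn ?orbT //=.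
rewrite big_mkord IHn -{1}[(m * n)%N]add0n big_addn mulnS addnK big_mkord.
rewrite -big_split /=; apply: eq_bigr => y _.
by rewrite big_ord_recr.
Qed.

Lemma sum_periodic_bij q g (h k : nat -> nat) : (0 < q)%N -> (forall x, g (x %% q)%N = g x) ->
  (forall x, k (h x %% q)%N = x %[mod q]) -> (forall x, h (k x %% q)%N = x %[mod q]) ->
  \sum_(x < q) g (h x) = \sum_(x < q) g x.
Proof.
move=> q0 gq hk kh; pose H (x : 'I_q) : 'I_q := Ordinal (ltn_pmod (h x) q0).
pose L (x : 'I_q) : 'I_q := Ordinal (ltn_pmod (k x) q0).
rewrite [RHS](reindex H) /=; first by apply: eq_bigr => x _; rewrite gq.
exists L => x _; apply: val_inj => /=.
  by rewrite hk modn_small.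
by rewrite kh modn_small.
Qed.

Lemma sum_periodic_shift q g t : (0 < q)%N -> (forall x, g (x %% q)%N = g x) ->
  \sum_(x < q) g (x + t)%N = \sum_(x < q) g x.
Proof.
move=> q0 gq; apply: (@sum_periodic_bij q g (fun x => x + t)%N (fun x => x + (q - t %% q))%N) => // x.
  rewrite modnDml -addnA -modnDmr -(modnDml t) subnKC; last by rewrite ltnW ?ltn_pmod.
  by rewrite modnn addn0.
rewrite modnDml -addnA [(_ + t)%N]addnC -modnDmr -(modnDml t) subnKC; last by rewrite ltnW ?ltn_pmod.
by rewrite modnn addn0.
Qed.
End PeriodicSums.

Lemma sum_periodic_coprime (R : comPzRingType) m1 m2 (g1 g2 : nat -> R) :
  (0 < m1)%N -> (0 < m2)%N -> coprime m1 m2 ->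
  (forall x, g1 (x %% m1)%N = g1 x) -> (forall x, g2 (x %% m2)%N = g2 x) ->
  \sum_(x < m1 * m2) g1 x * g2 x = (\sum_(x < m1) g1 x) * (\sum_(x < m2) g2 x).
Proof.
move=> m10 m20 cop g1m g2m; have m0 : (0 < m1 * m2)%N by rewrite muln_gt0 m10.
rewrite mulr_suml; under [RHS]eq_bigr => x _ do rewrite mulr_sumr.
rewrite pair_big /=.
pose h (x : 'I_m1 * 'I_m2) : 'I_(m1 * m2) := Ordinal (ltn_pmod (chinese m1 m2 x.1 x.2) m0).
pose k (x : 'I_(m1 * m2)) : 'I_m1 * 'I_m2 := (Ordinal (ltn_pmod x m10), Ordinal (ltn_pmod x m20)).
have h1 x : (h x = x.1 %[mod m1])%N.
  by rewrite /h /= modn_dvdm ?dvdn_mulr // chinese_modl.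
have h2 x : (h x = x.2 %[mod m2])%N.
  by rewrite /h /= modn_dvdm ?dvdn_mull // chinese_modr.
rewrite (reindex h) /=; last first.
  exists k => x _.
    by rewrite [x]surjective_pairing /k; congr (_, _); apply: val_inj; rewrite /= ?(h1 x) ?(h2 x) modn_small.
  apply: val_inj; apply/eqP; rewrite -[val (h _)](modn_small (ltn_ord _)) -[val x](modn_small (ltn_ord _)).
  by rewrite chinese_remainder // h1 h2 /= !modn_mod !eqxx.
by apply: eq_bigr => x _; rewrite -g1m h1 g1m -g2m h2 g2m.
Qed.

Definition prod_shift (es : seq (nat * nat)) x := (\prod_(c <- es) (x + c.1) ^ c.2)%N.

Definition complete_sum q (chi : nat -> algC) es := \sum_(x < q) chi (prod_shift es x).

Lemma prod_shift_mod q es x : prod_shift es (x %% q) = prod_shift es x %[mod q].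
Proof.
rewrite /prod_shift; elim: es => [|c es IH]; first by rewrite !big_nil.
by rewrite !big_cons -modnMm IH -modnXm modnDml modnXm modnMm.
Qed.

Lemma complete_sum_trivial q chi es : dchar q chi -> `|complete_sum q chi es| <= q%:R.
Proof.
move=> chiP; apply: le_trans (ler_norm_sum _ _ _) _.
apply: (@le_trans _ _ (\sum_(x < q) 1)); first by apply: ler_sum => x _; exact: dchar_norm_le1 chiP _.
by rewrite sumr_const card_ord.
Qed.

(** * Complete sums modulo the square of a prime *)

Section PrimeSquare.
Variables (p : nat) (p_pr : prime p).

(** The logarithmic derivative of [prod_shift es], multiplied by the product of the linear factors
    to clear denominators. *)
Fixpoint log_deriv (es : seq (nat * nat)) y : nat :=
  if es is c :: es' then
    (c.2 * \prod_(d <- es') (y + d.1) + (y + c.1) * log_deriv es' y)%N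
  else 0.

Let PS (es : seq (nat * nat)) y := (\prod_(d <- es) (y + d.1))%N.

(** The binomial expansion to first order. The additional factor [y] avoids the exponent [e - 1] and
    any inverse of [y]. *)
Lemma expn_shift_mod y t e : ((y + p * t) ^ e * y = y ^ e * (y + p * t * e) %[mod p ^ 2])%N.
Proof.
elim: e => [|e IHe]; first by rewrite !expn0 muln0 addn0.
rewrite !(expnS _ e) -mulnA -modnMmr IHe modnMmr.
have -> : ((y + p * t) * (y ^ e * (y + p * t * e)) =
  y * y ^ e * (y + p * t * e.+1) + (y ^ e * t * t * e) * p ^ 2)%N.
  by rewrite -[e.+1]addn1; ring.
by rewrite addnC modnMDl.
Qed.

Lemma prod_shift_log_deriv es y z :
  (prod_shift es (y + p * z) * PS es y = prod_shift es y * (PS es y + p * z * log_deriv es y)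
    %[mod p ^ 2])%N.
Proof.
rewrite /prod_shift /PS; elim: es => [|c es IHes]; first by rewrite !big_nil /= muln0 addn0.
rewrite !big_cons /=; set A := (\prod_(d <- es) (y + d.1))%N in IHes *.
set U := (\prod_(_ <- es) (y + p * z + _) ^ _)%N in IHes *.
set V := (\prod_(_ <- es) (y + _) ^ _)%N in IHes *.
have -> : ((y + p * z + c.1) ^ c.2 * U * ((y + c.1) * A) =
   ((y + c.1 + p * z) ^ c.2 * (y + c.1)) * (U * A))%N.
  by rewrite [(y + p * z + c.1)%N]addnAC; ring.
rewrite -modnMm IHes expn_shift_mod modnMm.
have -> : ((y + c.1) ^ c.2 * (y + c.1 + p * z * c.2) * (V * (A + p * z * log_deriv es y)) =
  (y + c.1) ^ c.2 * V * ((y + c.1) * A + p * z * (c.2 * A + (y + c.1) * log_deriv es y)) +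
  (y + c.1) ^ c.2 * V * c.2 * z * z * log_deriv es y * p ^ 2)%N.
  by ring.
by rewrite addnC modnMDl.
Qed.

Variables (chi : nat -> algC) (chiP : dchar (p ^ 2) chi).
Hypothesis chi_prim : exists n, [/\ coprime n p, n = 1 %[mod p] & chi n != 1].

Let p0 : (0 < p)%N := prime_gt0 p_pr.

(** Primitivity supplies [n = 1 + p * w] with [chi n != 1]. Multiplication by [n] acts as the
    translation of [z] by [t], where [t * L = w * A] modulo [p]; so the sum equals [chi n] times
    itself. *)
Lemma sum_fiber_eq0 A L : ~~ (p %| L)%N -> \sum_(z < p) chi (A + p * z * L)%N = 0.
Proof.
move=> pL; have [n [cnp n1 chin]] := chi_prim.
have n_gt0 : (0 < n)%N.
  case: posnP => // n0; move: cnp; rewrite n0 /coprime gcd0n => /eqP p1.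
  by move: p_pr; rewrite p1.
have [w wE] : exists w, n = (1 + p * w)%N.
  have /eqP := n1; rewrite eqn_mod_dvd // => /dvdnP[w wE].
  by exists w; rewrite mulnC -wE subnKC.
have cLp : coprime L p by rewrite coprime_sym prime_coprime.
have [t tE] : exists t, (t * L = w * A %[mod p])%N.
  have L0 : (0 < L)%N by case: (L) pL => //; rewrite dvdn0.
  case: (egcdnP p L0) => u v uE _; exists (u * (w * A))%N.
  move: cLp; rewrite /coprime => /eqP cLp; rewrite cLp in uE.
  by rewrite mulnAC uE mulnDl mul1n mulnAC modnMDl.
have per x : chi (A + p * (x %% p) * L)%N = chi (A + p * x * L)%N.
  apply: (dchar_mod chiP).
  rewrite [in RHS](divn_eq x p); have -> : (A + p * (x %/ p * p + x %% p) * L =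
    (x %/ p * L) * p ^ 2 + (A + p * (x %% p) * L))%N by ring.
  by rewrite modnMDl.
have shiftE z : chi (A + p * (z + t) * L)%N = chi n * chi (A + p * z * L)%N.
  rewrite -(dcharM chiP); apply: (dchar_mod chiP); rewrite wE.
  have -> : ((1 + p * w) * (A + p * z * L) = (A + p * z * L + p * (w * A)) + (w * z * L) * p ^ 2)%N by ring.
  rewrite [in RHS]addnC modnMDl.
  have -> : (A + p * (z + t) * L = A + p * z * L + p * (t * L))%N by ring.
  by apply/eqP; rewrite eqn_modDl expnS expn1 -!muln_modr tE.
have := sum_periodic_shift t p0 (fun x => per x).
under eq_bigr => z _ do rewrite shiftE.
rewrite -mulr_sumr => /eqP; rewrite -subr_eq0 -{2}[\sum_(z < p) _]mul1r -mulrBl mulf_eq0.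
by rewrite subr_eq0 (negPf chin) => /eqP.
Qed.

(** The class of [y] modulo [p] contributes only if [y] is a zero of [log_deriv] modulo [p]. This
    polynomial has degree at most [size bs], and it is nonzero: at [- b] only the term of the shift
    [b] survives, with coefficient one and the nonzero differences to the other shifts. *)
Lemma complete_sum_prime_square b (bs : seq (nat * nat)) :
  (forall c, c \in bs -> (0 < c.2)%N) -> (forall c, c \in bs -> c.1 != b %[mod p]) ->
  `|complete_sum (p ^ 2) chi ((b, 1%N) :: bs)| <= (size bs)%:R * p%:R.
Proof.
move=> e0 bsN; set es := (b, 1%N) :: bs; pose F := prod_shift es; pose L := log_deriv es.
have e0' c : c \in es -> (0 < c.2)%N by rewrite inE => /orP[/eqP->|/e0].
have -> : complete_sum (p ^ 2) chi es = \sum_(y < p) \sum_(z < p) chi (F (y + p * z)%N).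
  by rewrite /complete_sum -mulnn; exact: (sum_mixed_radix (fun x => chi (F x))).
pose bad (y : 'I_p) := (p %| L y)%N && ~~ (p %| PS es y)%N.
have inner (y : 'I_p) : `|\sum_(z < p) chi (F (y + p * z)%N)| <= p%:R *+ bad y.
  case: (boolP (p %| PS es y)%N) => [pP|pP].
    rewrite big1 ?normr0 ?mulrn_wge0 // => z _; apply: (dchar_eq0 chiP).
    rewrite coprime_pexpr // coprime_sym prime_coprime // negbK.
    move: pP; rewrite /PS Euclid_dvd_prod // big_has => /hasP[c cs pc].
    rewrite /F /prod_shift (big_rem c) //= dvdn_mulr // Euclid_dvdX // e0' // andbT.
    by rewrite addnAC dvdn_addl // dvdn_mulr.
  have cP : chi (PS es y) != 0.
    by rewrite (dchar_neq0 chiP) coprime_pexpr // coprime_sym prime_coprime.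
  rewrite /bad pP andbT; case: (boolP (p %| L y)%N) => [pL|pL].
    rewrite mulr1n; apply: le_trans (ler_norm_sum _ _ _) _.
    apply: (@le_trans _ _ (\sum_(x < p) 1)); first by apply: ler_sum => x _; exact: dchar_norm_le1 chiP _.
    by rewrite sumr_const card_ord.
  rewrite mulr0n normr_le0; apply/eqP/(mulIf cP); rewrite mul0r mulr_suml.
  rewrite (eq_bigr (fun z : 'I_p => chi (F y) * chi (PS es y + p * z * L y)%N)) => [|z _].
    by rewrite -mulr_sumr sum_fiber_eq0 ?mulr0.
  by rewrite -!(dcharM chiP); apply: (dchar_mod chiP); exact: prod_shift_log_deriv.
apply: le_trans (ler_norm_sum _ _ _) _.
apply: (@le_trans _ _ (\sum_y p%:R *+ bad y)); first by apply: ler_sum => y _; exact: inner.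
rewrite sumrMnr -[X in X <= _]mulr_natl ler_wpM2r // ler_nat.
rewrite -big_mkcond sum1_card.
pose Pp (es : seq (nat * nat)) : {poly 'F_p} := \prod_(d <- es) ('X + (d.1%:R)%:P).
pose Lp := fix Lp (es : seq (nat * nat)) : {poly 'F_p} :=
  if es is c :: es' then c.2%:R *: Pp es' + ('X + (c.1%:R)%:P) * Lp es' else 0.
have PpE l y : (Pp l).[y%:R] = (PS l y)%:R.
  rewrite horner_prod natr_prod; apply: eq_bigr => d _.
  by rewrite hornerD hornerX hornerC natrD.
have LpE l y : (Lp l).[y%:R] = (log_deriv l y)%:R.
  elim: l => [|c l IHl]; first by rewrite horner0.
  by rewrite /= hornerD hornerZ hornerM PpE IHl hornerD hornerX hornerC natrD !natrM natrD.
have sP l : size (Pp l) = (size l).+1.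
  rewrite /Pp; under eq_bigr => d _ do rewrite -[_%:P]opprK -polyCN.
  by rewrite -(big_map (fun d : nat * nat => - (d.1%:R : 'F_p)) xpredT (fun a => 'X - a%:P)) size_prod_XsubC size_map.
have sL l : (size (Lp l) <= size l)%N.
  elim: l => [|c l IHl]; first by rewrite size_poly0.
  rewrite /=; apply: leq_trans (size_polyD _ _) _; rewrite geq_max; apply/andP; split.
    by apply: leq_trans (size_scale_leq _ _) _; rewrite sP.
  apply: leq_trans (size_polyMleq _ _) _.
  by rewrite size_XaddC.
have nat0 m : (m%:R == 0 :> 'F_p) = (p %| m)%N.
  by rewrite -(pcharf_eq0 (pchar_Fp p_pr)) || rewrite (dvdn_pcharf (pchar_Fp p_pr)).
have L0 : Lp es != 0.
  apply/eqP => L0; have := congr1 (fun g => g.[- b%:R]) L0.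
  rewrite /= horner0 hornerD scale1r hornerM hornerD hornerX hornerC addNr mul0r addr0 horner_prod.
  move/eqP; rewrite prodf_seq_eq0 => /hasP[c cbs /andP[_]].
  rewrite hornerD hornerX hornerC addrC subr_eq0 => /eqP cb.
  have := bsN c cbs; rewrite -!(val_Fp_nat p_pr) cb eqxx //.
have inj : injective (fun y : 'I_p => (y : nat)%:R : 'F_p).
  move=> x y /(congr1 val); rewrite /= !(val_Fp_nat p_pr) !modn_small //.
  exact: val_inj.
rewrite -ltnS; apply: leq_trans (sL es).
pose rs := image (fun y : 'I_p => (y : nat)%:R : 'F_p) bad.
have -> : #|bad| = size rs by rewrite size_map -cardE.
apply: max_poly_roots => //; last by rewrite map_inj_uniq ?enum_uniq.
apply/allP => _ /mapP[y + ->]; rewrite mem_enum => /andP[pL _].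
by rewrite rootE LpE nat0.
Qed.
End PrimeSquare.

(** For [q = p] this says that [chi] is nonprincipal, and for [q = p ^ 2] that it is nontrivial on
    the residues that are 1 modulo [p]: exactly the inputs of the two local bounds. *)
Definition primitive q (chi : nat -> algC) := forall p, prime p -> (p %| q)%N ->
  exists n, [/\ coprime n q, n = 1 %[mod q %/ p] & chi n != 1].

Section Split.
Variables (m1 m2 : nat) (chi : nat -> algC).
Hypotheses (m10 : (0 < m1)%N) (m20 : (0 < m2)%N) (cop : coprime m1 m2).
Hypothesis chiP : dchar (m1 * m2) chi.

(** The component of [chi] modulo [m1]: the argument is made 1 modulo [m2]. *)
Definition dchar_l n := chi (chinese m1 m2 n 1).

Lemma chinese_eq x y : x = y %[mod m1] -> x = y %[mod m2] -> chi x = chi y.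
Proof.
by move=> e1 e2; apply: (dchar_mod chiP); apply/eqP; rewrite chinese_remainder // e1 e2 !eqxx.
Qed.

Lemma dchar_lP : dchar m1 dchar_l.
Proof.
split=> [|m n|n|n].
- by rewrite -(dchar1 chiP); apply: chinese_eq; rewrite ?chinese_modl ?chinese_modr.
- rewrite -(dcharM chiP); apply: chinese_eq.
    by rewrite -modnMm !chinese_modl // modnMm.
  by rewrite -modnMm !chinese_modr // modnMm.
- by apply: chinese_eq; rewrite ?chinese_modl ?chinese_modr // modn_mod.
- rewrite (dchar_neq0 chiP) coprimeMr -coprime_modl chinese_modl // coprime_modl.
  by rewrite -[X in _ && X]coprime_modl chinese_modr // coprime_modl coprime1n andbT.
Qed.

Lemma dchar_l_primitive : primitive (m1 * m2) chi -> primitive m1 dchar_l.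
Proof.
move=> prim p p_pr pm; have [|n [cn n1 cN]] := prim p p_pr; first by rewrite dvdn_mulr.
move: cn; rewrite coprimeMr => /andP[cn1 cn2].
have q1 : (m1 * m2 %/ p = m1 %/ p * m2)%N by rewrite mulnC -muln_divA // mulnC.
have red d : (d %| m1 * m2 %/ p)%N -> n = 1 %[mod d].
  by move=> dv; rewrite -(modn_dvdm n dv) n1 modn_dvdm.
exists n; split=> //; first by apply: red; rewrite q1 dvdn_mulr.
rewrite /dchar_l (_ : chi _ = chi n) //; apply: chinese_eq; rewrite ?chinese_modl ?chinese_modr //.
by apply/esym/red; rewrite q1 dvdn_mull.
Qed.
End Split.

Lemma complete_sum_split m1 m2 chi es : (0 < m1)%N -> (0 < m2)%N -> coprime m1 m2 ->
  dchar (m1 * m2) chi ->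
  complete_sum (m1 * m2) chi es =
  complete_sum m1 (dchar_l m1 m2 chi) es * complete_sum m2 (dchar_l m2 m1 chi) es.
Proof.
move=> m10 m20 cop chiP; have cop' : coprime m2 m1 by rewrite coprime_sym.
have chiP' : dchar (m2 * m1) chi by rewrite mulnC.
have P1 := dchar_lP cop chiP; have P2 := dchar_lP cop' chiP'.
rewrite /complete_sum -(@sum_periodic_coprime _ m1 m2 (fun x => dchar_l m1 m2 chi (prod_shift es x))
  (fun x => dchar_l m2 m1 chi (prod_shift es x)) m10 m20 cop); last 2 first.
- by move=> x; apply: (dchar_mod P1); exact: prod_shift_mod.
- by move=> x; apply: (dchar_mod P2); exact: prod_shift_mod.
apply: eq_bigr => x _; rewrite -(dcharM chiP); apply: (chinese_eq cop chiP).
  by rewrite -modnMm chinese_modl // chinese_modr // modnMm muln1.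
by rewrite -modnMm chinese_modr // chinese_modl // modnMm mul1n.
Qed.

Definition diff_prod b (bs : seq (nat * nat)) := (\prod_(c <- bs) ((b - c.1) + (c.1 - b)))%N.

Lemma diff_prodP p b bs : prime p -> ~~ (p %| diff_prod b bs)%N ->
  forall c, c \in bs -> c.1 != b %[mod p].
Proof.
move=> p_pr; rewrite /diff_prod Euclid_dvd_prod // big_has => /hasPn H c /H.
apply: contra => /eqP cb.
have [le|/ltnW le] := leqP c.1 b; rewrite (eqP (le : _ - _ == 0)%N) ?addn0 ?add0n -eqn_mod_dvd // cb //.
Qed.

(** When [p] divides a difference of shifts, the trivial bound [p ^ a] is used. It exceeds the
    square root of [p ^ a] by a factor of at most [p], because [a <= 2], and the gcd pays for it.
    This is the place where cube-freeness matters. *)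
Lemma complete_sum_prime_power p a chi b bs : prime p -> (0 < a <= 2)%N ->
  dchar (p ^ a) chi -> primitive (p ^ a) chi -> (forall c, c \in bs -> (0 < c.2)%N) ->
  `|complete_sum (p ^ a) chi ((b, 1%N) :: bs)|
    <= (size bs).+1%:R * sqrtC (p ^ a)%:R * (gcdn (diff_prod b bs) (p ^ a))%:R.
Proof.
move=> p_pr a12 chiP prim e0; have p0 := prime_gt0 p_pr.
have a0 : (0 < a)%N by case/andP: a12.
have pa : (p %| p ^ a)%N by rewrite dvdn_exp.
have sq0 m : 0 <= sqrtC m%:R :> algC by rewrite sqrtC_ge0 ler0n.
have sqX (m : nat) : sqrtC (m ^ 2)%:R = m%:R :> algC by rewrite natrX sqrCK ?ler0n.
have [n [cn n1 cN]] := prim p p_pr pa.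
case: (boolP (p %| diff_prod b bs)%N) => [pD|pD]; last first.
  have bsN := diff_prodP p_pr pD.
  have -> : gcdn (diff_prod b bs) (p ^ a) = 1%N.
    by apply/eqP; rewrite -/(coprime _ _) coprime_sym coprime_pexpl // prime_coprime.
  rewrite mulr1; apply: (@le_trans _ _ ((size bs)%:R * sqrtC (p ^ a)%:R)); last first.
    by rewrite ler_wpM2r ?ler_nat.
  have {a12 a0} [a1|a2] : a = 1%N \/ a = 2%N by lia.
    rewrite a1 expn1 in chiP cn *.
    have := @dchar_weil p chi b bs p_pr chiP _ bsN; rewrite /complete_sum.
    move=> H; apply: le_trans (H _); last by exists n.
    rewrite le_eqVlt; apply/orP; left; apply/eqP; congr `|_|; apply: eq_bigr => x _.
    by rewrite /prod_shift big_cons expn1.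
  rewrite a2 sqX in chiP cn n1 *; apply: complete_sum_prime_square => //.
  exists n; split=> //; first by rewrite coprime_pexpr in cn.
  by move: n1; rewrite -mulnn mulKn.
apply: le_trans (complete_sum_trivial _ chiP) _; rewrite -mulrA.
apply: (@le_trans _ _ (sqrtC (p ^ a)%:R * (gcdn (diff_prod b bs) (p ^ a))%:R)); last first.
  by rewrite ler_peMl ?mulr_ge0 ?ler0n // ler1n.
rewrite -{1}[(p ^ a)%:R]sqrtCK expr2 ler_wpM2l //.
apply: (@le_trans _ _ p%:R); last first.
  rewrite ler_nat dvdn_leq ?gcdn_gt0 ?expn_gt0 ?p0 ?orbT //.
  by rewrite dvdn_gcd pD.
by rewrite -[leRHS]sqX ler_sqrtC ?nnegrE ?ler0n // ler_nat leq_exp2l ?prime_gt1 //; lia.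
Qed.

Lemma complete_sum_bound q chi b bs : (0 < q)%N -> (forall p, prime p -> ~~ (p ^ 3 %| q)%N) ->
  dchar q chi -> primitive q chi -> (forall c, c \in bs -> (0 < c.2)%N) ->
  `|complete_sum q chi ((b, 1%N) :: bs)|
    <= ((size bs).+1 ^ size (primes q))%:R * sqrtC q%:R * (gcdn (diff_prod b bs) q)%:R.
Proof.
elim/ltn_ind: q chi => q IHq chi q0 cf chiP prim e0.
have [q1|q1] := leqP q 1.
  have -> : q = 1%N by lia.
  have := complete_sum_trivial ((b, 1%N) :: bs) chiP.
  by rewrite (_ : q = 1%N) ?gcdn1 ?expn0 ?sqrtC1 ?mulr1 //; lia.
pose p := pdiv q; have p_pr : prime p := pdiv_prime q1; have p0 := prime_gt0 p_pr.
pose a := logn p q; have [q' pq' qE] := pfactor_coprime p_pr q0.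
rewrite -/a mulnC in qE.
have a0 : (0 < a)%N by rewrite /a logn_gt0 mem_primes p_pr q0 pdiv_dvd.
have a2 : (a <= 2)%N.
  have := cf p p_pr; rewrite pfactor_dvdn // -/a; lia.
have q'0 : (0 < q')%N by move: q0; rewrite qE muln_gt0 => /andP[].
have m0 : (0 < p ^ a)%N by rewrite expn_gt0 p0.
have cop : coprime (p ^ a) q' by rewrite coprime_pexpl.
have cop' : coprime q' (p ^ a) by rewrite coprime_sym.
have lt_q' : (q' < q)%N.
  rewrite qE ltn_Pmull //; apply: leq_trans (prime_gt1 p_pr) _.
  by rewrite -{1}[p]expn1 leq_exp2l // prime_gt1.
have chiP' : dchar (p ^ a * q') chi by rewrite -qE.
have chiP2 : dchar (q' * p ^ a) chi by rewrite mulnC.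
have prim' : primitive (p ^ a * q') chi by rewrite -qE.
have prim2 : primitive (q' * p ^ a) chi by rewrite mulnC.
have omegaE : size (primes q) = (size (primes q')).+1.
  apply: (@perm_size _ _ (p :: primes q')); apply: uniq_perm; rewrite ?primes_uniq //=.
    by rewrite primes_uniq andbT mem_primes p_pr q'0 -prime_coprime ?pq'.
  by move=> r; rewrite qE primesM // primesX // primes_prime // !inE.
have gcdE : (gcdn (diff_prod b bs) (p ^ a) * gcdn (diff_prod b bs) q' <= gcdn (diff_prod b bs) q)%N.
  rewrite dvdn_leq ?gcdn_gt0 ?q0 ?orbT // Gauss_dvd; last first.
    by apply: (coprime_dvdl (dvdn_gcdr _ _)); apply: (coprime_dvdr (dvdn_gcdr _ _)).
  apply/andP; split; rewrite dvdn_gcd dvdn_gcdl /= [X in (_ %| X)%N]qE.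
    by rewrite dvdn_mulr // dvdn_gcdr.
  by rewrite dvdn_mull // dvdn_gcdr.
rewrite {1}qE complete_sum_split // normrM.
have B1 := complete_sum_prime_power b p_pr (_ : 0 < a <= 2)%N (dchar_lP cop chiP')
  (dchar_l_primitive cop chiP' prim') e0.
have B2 := IHq q' lt_q' _ q'0 (_ : forall p, prime p -> ~~ (p ^ 3 %| q')%N) (dchar_lP cop' chiP2)
  (dchar_l_primitive cop' chiP2 prim2) e0.
have cf' r : prime r -> ~~ (r ^ 3 %| q')%N.
  by move=> /cf; apply: contra => dv; rewrite qE dvdn_mull.
apply: le_trans (ler_pM _ _ (B1 _) (B2 cf')) _; rewrite ?normr_ge0 ?a0 ?a2 //.
rewrite omegaE expnS natrM {1}qE [X in _ <= _ * sqrtC X * _]natrM sqrtCM ?nnegrE ?ler0n //.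
have -> (x1 x2 x3 y1 y2 y3 : algC) : x1 * x2 * x3 * (y1 * y2 * y3) = x1 * y1 * (x2 * y2) * (x3 * y3) by ring.
apply: ler_wpM2l; first by rewrite !mulr_ge0 ?sqrtC_ge0 ?ler0n.
by rewrite -natrM ler_nat.
Qed.

(** * Divisors and coprime counts *)

Local Open Scope nat_scope.

Definition num_divisors n := size (divisors n).

Lemma num_divisors_gt0 n : 0 < n -> 0 < num_divisors n.
Proof.
by move=> n0; rewrite /num_divisors -has_predT; apply/hasP; exists 1; rewrite -?dvdn_divisors.
Qed.

Lemma num_divisors_pfactor_le p a m : prime p -> 0 < m -> coprime p m ->
  num_divisors (p ^ a * m) <= a.+1 * num_divisors m.
Proof.
move=> p_pr m0 cpm; rewrite /num_divisors -(size_iota 0 a.+1).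
rewrite -(size_allpairs (fun i e => p ^ i * e)).
have p0 := prime_gt0 p_pr; have pm0 : 0 < p ^ a * m by rewrite muln_gt0 expn_gt0 p0.
apply: uniq_leq_size; first exact: divisors_uniq.
move=> d; rewrite -dvdn_divisors // => dpm.
have d0 : 0 < d := dvdn_gt0 pm0 dpm.
have [e cpe dE] := pfactor_coprime p_pr d0.
apply/allpairsP; exists (logn p d, e); rewrite /= mulnC -dE; split=> //.
  have := dvdn_leq_log p pm0 dpm; rewrite lognM ?expn_gt0 ?p0 // pfactorK // (logn_coprime cpm).
  by rewrite addn0 -ltnS => lt_a; rewrite -[_ :: _]/(iota 0 a.+1) mem_iota.
rewrite -dvdn_divisors //; have : e %| p ^ a * m by apply: dvdn_trans dpm; rewrite dE dvdn_mulr.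
by rewrite Gauss_dvdr // coprimeXr // coprime_sym.
Qed.

Lemma num_divisors_pfactor_ge p a m : prime p -> 0 < m -> 0 < a -> coprime p m ->
  2 * num_divisors m <= num_divisors (p ^ a * m).
Proof.
move=> p_pr m0 a0 cpm; rewrite /num_divisors mul2n -addnn.
rewrite -{2}(size_map (muln p)) -size_cat; have p0 := prime_gt0 p_pr.
have pm0 : 0 < p ^ a * m by rewrite muln_gt0 expn_gt0 p0.
apply: uniq_leq_size => [|d]; last first.
  rewrite mem_cat -!dvdn_divisors // => /orP[dm|/mapP[e]]; first by rewrite dvdn_mull.
  by rewrite -dvdn_divisors // => em ->; rewrite dvdn_mul // dvdn_exp.
rewrite cat_uniq divisors_uniq map_inj_uniq ?divisors_uniq ?andbT; last first.
  by move=> x y /eqP; rewrite eqn_pmul2l // => /eqP.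
apply/hasPn => _ /mapP[e _ ->]; rewrite -dvdn_divisors //; apply/negP => dv.
have : p %| m by apply: dvdn_trans dv; exact: dvdn_mulr.
by apply/negP; rewrite -prime_coprime.
Qed.

Lemma pfactor_ind (P : nat -> Prop) : P 1 ->
  (forall p a m, prime p -> 0 < a -> 0 < m -> coprime p m -> P m -> P (p ^ a * m)) ->
  forall n, 0 < n -> P n.
Proof.
move=> P1 PS; elim/ltn_ind => n IHn n0.
have [n1|n1] := leqP n 1; first by have -> : n = 1 by lia.
have p_pr := pdiv_prime n1; have [m cpm nE] := pfactor_coprime p_pr n0.
have a0 : 0 < logn (pdiv n) n by rewrite logn_gt0 mem_primes p_pr n0 pdiv_dvd.
have m0 : 0 < m by move: n0; rewrite nE muln_gt0 => /andP[].
rewrite nE mulnC; apply: PS => //; apply: IHn => //.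
rewrite [X in _ < X]nE ltn_Pmulr //; apply: leq_trans (prime_gt1 p_pr) _.
by rewrite -{1}[pdiv n]expn1 leq_exp2l // prime_gt1.
Qed.

Lemma size_primes_pfactor p a m : prime p -> 0 < a -> 0 < m -> coprime p m ->
  perm_eq (primes (p ^ a * m)) (p :: primes m).
Proof.
move=> p_pr a0 m0 cpm; apply: uniq_perm; rewrite ?primes_uniq //=.
  by rewrite primes_uniq andbT mem_primes p_pr m0 -prime_coprime ?cpm.
have pa0 : 0 < p ^ a by rewrite expn_gt0 prime_gt0.
by move=> r; rewrite primesM // primesX // primes_prime // !inE.
Qed.

Lemma exp2_omega_le n : 0 < n -> 2 ^ size (primes n) <= num_divisors n.
Proof.
move: n; apply: pfactor_ind => // p a m p_pr a0 m0 cpm IH.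
rewrite (perm_size (size_primes_pfactor p_pr a0 m0 cpm)) /= expnS.
by apply: leq_trans (num_divisors_pfactor_ge p_pr m0 a0 cpm); rewrite leq_mul2l.
Qed.

Lemma bin_le_exp2 n k : 'C(n, k) <= 2 ^ n.
Proof.
elim: n k => [|n IHn] [|k] //; first by rewrite bin0 expn_gt0.
by rewrite binS expnS mul2n -addnn leq_add.
Qed.

Lemma succ_exp_le a K : a.+1 ^ K <= (2 ^ K * K`!) * 2 ^ a.
Proof.
apply: (@leq_trans ((a + K) ^_ K)).
  elim: K => [|K IHK]; first by rewrite ffactn0.
  by rewrite addnS ffactSS expnS leq_mul // ltnS leq_addr.
rewrite -bin_ffact [X in _ <= X]mulnAC -expnD leq_mul2r; apply/orP; right.
by rewrite addnC bin_le_exp2.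
Qed.

(** A prime [p >= 2 ^ K] costs nothing, since [(a + 1) ^ K <= 2 ^ (a * K) <= p ^ a]. Each of the
    fewer than [2 ^ K] smaller primes costs the factor [B] of [succ_exp_le]. *)
Lemma divisor_bound K : exists2 C, 0 < C & forall n, 0 < n -> num_divisors n ^ K <= C * n.
Proof.
pose B := 2 ^ K * K`!; pose s n := [seq p <- primes n | p < 2 ^ K].
have B0 : 0 < B by rewrite muln_gt0 expn_gt0 fact_gt0.
have main n : 0 < n -> num_divisors n ^ K <= B ^ size (s n) * n.
  move: n; apply: pfactor_ind => [|p a m p_pr a0 m0 cpm IH].
    by rewrite (_ : num_divisors 1 = 1) // exp1n.
  have p0 := prime_gt0 p_pr.
  have h1 : num_divisors (p ^ a * m) ^ K <= (a.+1 * num_divisors m) ^ K.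
    have [->|K0] := posnP K; first by rewrite !expn0.
    by rewrite leq_exp2r // num_divisors_pfactor_le.
  apply: leq_trans h1 _; rewrite expnMn.
  have -> : size (s (p ^ a * m)) = (p < 2 ^ K) + size (s m).
    rewrite /s !size_filter; have := size_primes_pfactor p_pr a0 m0 cpm.
    by move=> /seq.permP/(_ (fun p => p < 2 ^ K)) ->.
  rewrite expnD [X in _ <= X](_ : _ = (B ^ (p < 2 ^ K) * p ^ a) * (B ^ size (s m) * m)); last by lia.
  apply: leq_mul => //; case: ltnP => [lt_p|le_p].
    apply: leq_trans (succ_exp_le a K) _; rewrite expn1 leq_mul2l.
    by rewrite leq_exp2r // prime_gt1 ?orbT.
  rewrite expn0 mul1n; apply: (@leq_trans ((2 ^ a) ^ K)).
    have [->|K0] := posnP K; first by rewrite !expn0.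
    by rewrite leq_exp2r // ltn_expl.
  by rewrite expnAC leq_exp2r.
exists (B ^ (2 ^ K)) => [|n n0]; first by rewrite expn_gt0 B0.
apply: leq_trans (main n n0) _; rewrite leq_mul2r; apply/orP; right.
rewrite leq_pexp2l // -[X in _ <= X](size_iota 0); apply: uniq_leq_size.
  by rewrite filter_uniq ?primes_uniq.
by move=> p; rewrite mem_filter mem_iota => /andP[].
Qed.

Lemma uniform_divisor_bound K : exists2 C, 0 < C & forall X, 0 < X ->
  exists D, [/\ 0 < D, D ^ K <= C * X & forall n, n <= X -> num_divisors n <= D].
Proof.
have [C C0 HC] := divisor_bound K; exists C => // X X0.
pose F (i : 'I_X.+1) := num_divisors i.
have [|i iE] := @bigop.eq_bigmax 'I_X.+1 F; first by rewrite card_ord.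
exists (\max_i F i); split.
- apply: leq_trans (leq_bigmax (F := F) (Ordinal (X0 : 1 < X.+1))).
  exact: num_divisors_gt0.
- have [i0|i0] := posnP i.
    have [->|K0] := posnP K; first by rewrite expn0 muln_gt0 C0.
    (* The maximum may be attained at 0, as [divisors 0] is a singleton by convention. *)
    by rewrite iE /F i0 (_ : num_divisors 0 = 1) // exp1n muln_gt0 C0.
  rewrite iE; apply: leq_trans (HC i i0) _; by rewrite leq_mul2l -ltnS ltn_ord orbT.
- by move=> n; rewrite -ltnS => lt_n; apply: (leq_bigmax (F := F) (Ordinal lt_n)).
Qed.

Lemma card_product_fiber (J : finType) M n : 0 < n ->
  #|[set f : {ffun J -> 'I_M} | \prod_j f j == n]| <= num_divisors n ^ #|J|.
Proof.
move=> n0; pose A := [pred x : 'I_M | (x : nat) %| n].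
apply: (@leq_trans (#|A| ^ #|J|)).
  rewrite -card_ffun_on; apply/subset_leq_card/subsetP => f; rewrite inE => /eqP fE.
  by apply/ffun_onP => j; rewrite inE -fE (bigD1 j) //= dvdn_mulr.
have [->|J0] := posnP #|J|; first by rewrite !expn0.
rewrite leq_exp2r // cardE -(size_map val); apply: uniq_leq_size.
  by rewrite map_inj_uniq ?enum_uniq //; exact: val_inj.
by move=> _ /mapP[x + ->]; rewrite mem_enum inE dvdn_divisors.
Qed.

Lemma sum_dvd_multiples (R : nmodType) X p (P : pred nat) (f : nat -> R) : 0 < p ->
  (\sum_(1 <= n < X.+1 | (p %| n)%N && P n) f n = \sum_(1 <= m < (X %/ p).+1 | P (p * m)%N) f (p * m)%N)%R.
Proof.
move=> p0; elim: X => [|X IHX]; first by rewrite div0n !big_geq.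
rewrite big_mkcond big_nat_recr //= -big_mkcond IHX divnS //.
case: ifP => [/andP[/[dup] pX -> PX]|]; rewrite ?add1n ?add0n.
  rewrite [RHS]big_mkcond big_nat_recr //= -big_mkcond.
  have -> : (p * (X %/ p).+1 = X.+1)%N.
    by have := divnS X p0; rewrite pX add1n => <-; rewrite mulnC divnK.
  by rewrite PX ?addr0.
case: (boolP (p %| X.+1)) => [pX /=|_]; rewrite ?addr0 // add1n => PX.
rewrite [RHS]big_mkcond big_nat_recr //= -big_mkcond.
have -> : (p * (X %/ p).+1 = X.+1)%N.
  by have := divnS X p0; rewrite pX add1n => <-; rewrite mulnC divnK.
by rewrite PX addr0.
Qed.

(** * Legendre's sieve for completely multiplicative functions *)

Section Sieve.
Variables (R : pzRingType) (f : nat -> R).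
Hypothesis fM : forall m n, f (m * n)%N = (f m * f n)%R.

Definition sieve l X := (\sum_(1 <= n < X.+1 | all (fun p => ~~ (p %| n)%N) l) f n)%R.

(** The discarded integers are the multiples [p * m], and the primes of [l] divide [p * m] exactly
    when they divide [m]. *)
Lemma sieve_cons p l X : prime p -> p \notin l -> all prime l ->
  sieve (p :: l) X = (sieve l X - f p * sieve l (X %/ p))%R.
Proof.
move=> p_pr pl lpr; apply/esym/eqP; rewrite subr_eq; apply/eqP.
rewrite {1}/sieve (bigID (fun n => p %| n)) /= addrC; congr (_ + _)%R.
  by apply: eq_bigl => n; rewrite andbC.
rewrite (eq_bigl (fun n => (p %| n) && all (fun p => ~~ (p %| n)) l)) => [|n]; last exact: andbC.
rewrite sum_dvd_multiples ?prime_gt0 // /sieve mulr_sumr; apply: eq_big => [m|m _]; last by rewrite fM.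
apply: eq_in_all => r rl; have r_pr := allP lpr r rl.
have -> : (r %| p * m)%N = (r %| m)%N.
  rewrite Euclid_dvdM // dvdn_prime2 //; case: eqP => // rp.
  by rewrite -rp rl in pl.
by [].
Qed.

Lemma sieve_coprime q X : (0 < q)%N -> sieve (primes q) X = (\sum_(1 <= n < X.+1 | coprime n q) f n)%R.
Proof.
move=> q0; rewrite /sieve [LHS]big_nat_cond [RHS]big_nat_cond; apply: eq_bigl => n.
have [/andP[n0 _]|] := boolP (1 <= n < X.+1)%N; last by rewrite !andFb.
rewrite !andTb.
apply/allP/idP => [H|cnq p]; last first.
  rewrite mem_primes => /and3P[p_pr _ pq]; rewrite -prime_coprime //.
  by apply: coprime_dvdl pq _; rewrite coprime_sym.
apply: contraT; rewrite /coprime => ne1; have g1 : (1 < gcdn n q)%N by have := gcdn_gt0 n q; rewrite n0 /=; lia.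
have := H (pdiv (gcdn n q)); rewrite mem_primes pdiv_prime // q0 /=.
by rewrite (dvdn_trans (pdiv_dvd _) (dvdn_gcdr _ _)) (dvdn_trans (pdiv_dvd _) (dvdn_gcdl _ _)) => /(_ isT).
Qed.
End Sieve.

Local Open Scope ring_scope.

(* With [Phi / P = \prod_(p <- l) (1 - 1 / p)], the count of [n <= X] free of primes of [l] is
   [X * Phi / P] up to [2 ^ size l - 1]. *)
Lemma sieve_count_bounds l X : uniq l -> all prime l ->
  let P := (\prod_(p <- l) p)%N in let Phi := (\prod_(p <- l) p.-1)%N in
  let S := sieve (fun=> 1 : int) l X in
  (S + 1) * P%:Z <= X%:Z * Phi%:Z + (2 ^ size l)%N%:Z * P%:Z /\
  X%:Z * Phi%:Z + P%:Z <= (S + (2 ^ size l)%N%:Z) * P%:Z.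
Proof.
elim: l X => [|p l IHl] X /=.
  rewrite !big_nil /sieve /= sumr_const_nat subn1 /= => _ _.
  by rewrite natz; split; lia.
move=> /andP[pl ul] /andP[p_pr lpr]; rewrite !big_cons sieve_cons //.
rewrite mul1r; have [l1 u1] := IHl X ul lpr; have [l2 u2] := IHl (X %/ p)%N ul lpr.
move: l1 u1 l2 u2; set P := (\prod_(p <- l) p)%N; set Phi := (\prod_(p <- l) p.-1)%N.
set S1 := sieve _ l X; set S2 := sieve _ l _; have p0 := prime_gt0 p_pr.
have PhiP : (Phi <= P)%N.
  by rewrite /Phi /P; apply: leq_prod => i _; exact: leq_pred.
have E := divn_eq X p; have m := ltn_pmod X p0.
move: E m; move: (X %/ p)%N (X %% p)%N => a r E m.
rewrite expnS; move: (2 ^ size l)%N => t.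
have pE : p = p.-1.+1 by rewrite prednK.
move: p.-1 pE => p' pE; subst p X => l1 u1 l2 u2.
have h1 : (r * Phi <= p' * P)%N by apply: leq_mul.
have h2 : (r * Phi <= p'.+1 * P)%N by apply: leq_trans h1 _; rewrite leq_mul2r leqnSn orbT.
clear IHl pl ul lpr m.
rewrite !PoszM !PoszD !PoszM in l1 u1 l2 u2 *.
have h1' : r%:Z * Phi%:Z <= p'%:Z * P%:Z by rewrite -!PoszM.
have pz : p'.+1%:Z = p'%:Z + 1 by lia.
rewrite !pz in l1 u1 l2 u2 *.
have p'0 : 0 <= p'%:Z by [].
have P0 : 0 <= P%:Z by [].
have Phi0 : 0 <= Phi%:Z by [].
have r0 : 0 <= r%:Z by [].
move: p'0 P0 Phi0 r0 l1 u1 l2 u2 h1' {h1 h2 pz PhiP p_pr p0}.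
move: S1 S2 (Posz P) (Posz Phi) (Posz p') (Posz r) (Posz t) (Posz a) => S1 S2 P' F q s t' a' q0 P0 F0 s0 l1 u1 l2 u2 h.
have := ler_wpM2l (addr_ge0 q0 ler01) l1; have := ler_wpM2l (addr_ge0 q0 ler01) u1.
have := ler_wpM2l (addr_ge0 q0 ler01) l2; have := ler_wpM2l (addr_ge0 q0 ler01) u2.
have := mulr_ge0 s0 F0; have := mulr_ge0 q0 P0.
by split; nia.
Qed.
Local Open Scope nat_scope.

Definition coprime_count q X := \sum_(1 <= n < X.+1 | coprime n q) 1.

Lemma totient_radical q : 0 < q ->
  totient q * (\prod_(p <- primes q) p) = q * (\prod_(p <- primes q) p.-1).
Proof.
move=> q0; have qE : q = \prod_(p <- primes q) (p * p ^ (logn p q).-1).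
  rewrite [LHS](prod_prime_decomp q0) prime_decompE big_map /= big_seq [RHS]big_seq.
  apply: eq_bigr => p; rewrite -logn_gt0 => l0.
  by rewrite -expnS prednK.
rewrite totientE // [X in _ = X * _]qE.
by rewrite -!big_split /=; apply: eq_bigr => p _; lia.
Qed.

Lemma prod_primes_gt0 q : 0 < \prod_(p <- primes q) p.
Proof. by rewrite big_seq prodn_cond_gt0 // => p; rewrite mem_primes => /andP[/prime_gt0]. Qed.

(** The sieve over [primes q], whose density [Phi / P] is [totient q / q] by [totient_radical];
    denominators are cleared to stay in [nat]. *)
Lemma coprime_count_bounds q X : 0 < q ->
  coprime_count q X * q <= X * totient q + 2 ^ size (primes q) * q /\
  X * totient q <= (coprime_count q X + 2 ^ size (primes q)) * q.
Proof.
move=> q0; have primes_pr : all prime (primes q).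
  by apply/allP => p; rewrite mem_primes => /andP[].
have := sieve_count_bounds X (primes_uniq q) primes_pr => /=.
rewrite sieve_coprime // (_ : (\sum_(_ <= _ < _ | _) 1 = (coprime_count q X)%:Z)%R); last first.
  by rewrite /coprime_count -natz natr_sum.
have P0 := prod_primes_gt0 q; have tr := totient_radical q0.
move: P0 tr; set P := \prod_(p <- primes q) p; set Phi := \prod_(p <- primes q) p.-1.
move: (coprime_count q X) (2 ^ size (primes q)) (totient q) => S t phi P0 tr [h1 h2].
have {}h1 : (S + 1) * P <= X * Phi + t * P by lia.
have {}h2 : X * Phi + P <= (S + t) * P by lia.
have m1 : (S + 1) * P * q <= (X * Phi + t * P) * q by rewrite leq_mul2r h1 orbT.
have m2 : (X * Phi + P) * q <= (S + t) * P * q by rewrite leq_mul2r h2 orbT.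
split; rewrite -(leq_pmul2r P0).
  have -> : (X * phi + t * q) * P = X * (phi * P) + t * q * P by lia.
  rewrite tr; lia.
have -> : X * phi * P = X * (phi * P) by lia.
rewrite tr; lia.
Qed.

Lemma leq_totient_omega q : 0 < q -> q <= totient q * 2 ^ size (primes q).
Proof.
move=> q0; rewrite -(leq_pmul2r (prod_primes_gt0 q)) mulnAC totient_radical // -!mulnA.
rewrite leq_mul2l; apply/orP; right.
have : all prime (primes q) by apply/allP => p; rewrite mem_primes => /andP[].
elim: (primes q) => [|p l IHl] /=; first by rewrite !big_nil.
move=> /andP[/prime_gt1 p1 /IHl H]; rewrite !big_cons expnS.
have -> : p.-1 * (\prod_(j <- l) j.-1) * (2 * 2 ^ size l) =
  (p.-1 * 2) * ((\prod_(j <- l) j.-1) * 2 ^ size l) by lia.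
by apply: leq_mul => //; lia.
Qed.

Lemma sum_gcd_le q B : 0 < q -> \sum_(1 <= t < B.+1) gcdn t q <= B * num_divisors q.
Proof.
move=> q0.
apply: (@leq_trans (\sum_(1 <= t < B.+1) \sum_(g <- divisors q | g %| t) g)).
  rewrite !big_nat; apply: leq_sum => t /andP[t0 _].
  have gq : gcdn t q \in divisors q by rewrite -dvdn_divisors // dvdn_gcdr.
  by rewrite (big_rem _ gq) /= dvdn_gcdl leq_addr.
rewrite (exchange_big_dep xpredT) //= /num_divisors mulnC -sum1_size big_distrl /= !big_seq.
apply: leq_sum => g; rewrite -dvdn_divisors // mul1n => gq.
have g0 := dvdn_gt0 q0 gq.
rewrite (eq_bigl (fun t => (g %| t) && xpredT t)) => [|t]; last by rewrite andbT.
rewrite (@sum_dvd_multiples _ B g xpredT (fun=> g)) // sum_nat_const_nat subn1 /=.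
exact: leq_trunc_div.
Qed.

(** The integers up to [Y] meet a residue class in at most [Y %/ q + 1] values, each taken at most
    [T] times. *)
Lemma card_congruent (I : finType) (v : I -> nat) (P : pred I) q Y T r : 0 < q ->
  (forall i, P i -> v i <= Y) -> (forall n, n <= Y -> #|[set i | P i && (v i == n)]| <= T) ->
  #|[set i | P i && (v i == r %[mod q])]| <= (Y %/ q).+1 * T.
Proof.
move=> q0 vY fT; rewrite -sum1_card.
rewrite (partition_big (fun i => inord (v i) : 'I_Y.+1) (fun n : 'I_Y.+1 => n == r %[mod q])) /=; last first.
  by move=> i; rewrite inE => /andP[Pi]; rewrite inordK // ltnS vY.
apply: (@leq_trans (\sum_(n : 'I_Y.+1 | n == r %[mod q]) T)).
  apply: leq_sum => n _; apply: leq_trans (fT n _); last by rewrite -ltnS.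
  rewrite -sum1_card [X in _ <= X](eq_bigl (fun i => P i && (v i == n))); last by move=> i; rewrite inE.
  rewrite big_mkcond [X in _ <= X]big_mkcond; apply: leq_sum => i _; rewrite inE.
  have [Pi|nPi] := boolP (P i); last by rewrite andFb.
  rewrite andTb; have [E|E] := eqVneq (inord (v i)) n; last by rewrite andbF.
  by rewrite -E inordK ?eqxx ?ltnS ?vY //; case: ifP.
rewrite sum_nat_const leq_mul2r; apply/orP; right.
pose k (n : 'I_Y.+1) : 'I_(Y %/ q).+1 := inord (n %/ q).
rewrite -[X in _ <= X]card_ord -[X in X <= _](card_in_imset (f := k)); first exact: max_card.
move=> m n; rewrite !unfold_in => /eqP mr /eqP nr /(congr1 val).
have lek (i : 'I_Y.+1) : i %/ q < (Y %/ q).+1 by rewrite ltnS leq_div2r // -ltnS.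
rewrite /= !inordK // => mn; apply: val_inj; rewrite /= (divn_eq m q) (divn_eq n q) mn mr nr.
by [].
Qed.

Lemma gcdn_mul_le a b c : 0 < c -> gcdn (a * b) c <= gcdn a c * gcdn b c.
Proof.
move=> c0; apply: dvdn_leq; first by rewrite muln_gt0 !gcdn_gt0 c0 !orbT.
rewrite muln_gcdr dvdn_gcd; apply/andP; split.
  by rewrite muln_gcdl dvdn_gcd dvdn_gcdl dvdn_mulr ?dvdn_gcdr.
by rewrite dvdn_mull ?dvdn_gcdr.
Qed.

Lemma gcdn_prod_le I (s : seq I) (F : I -> nat) c : 0 < c ->
  gcdn (\prod_(i <- s) F i) c <= \prod_(i <- s) gcdn (F i) c.
Proof.
move=> c0; elim: s => [|i s IHs]; first by rewrite !big_nil gcd1n.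
rewrite !big_cons; apply: leq_trans (gcdn_mul_le _ _ c0) _.
by rewrite leq_mul2l IHs orbT.
Qed.

(** * Moments of short sums *)

Local Open Scope ring_scope.

(* Such functions take at most [r] values on the [2 r] points. *)
Lemma card_no_isolated (J : finType) r B : (0 < r)%N -> #|J| = (r + r)%N ->
  (#|[set f : {ffun J -> 'I_B} | [forall j, [exists j', (j' != j) && (f j' == f j)]]]|
    <= r ^ (r + r) * B ^ r)%N.
Proof.
case: r => // r _ cJ.
pose comp (hg : {ffun J -> 'I_r.+1} * {ffun 'I_r.+1 -> 'I_B}) := [ffun j => hg.2 (hg.1 j)].
have -> : (r.+1 ^ (r.+1 + r.+1) * B ^ r.+1)%N =
    #|[set: {ffun J -> 'I_r.+1} * {ffun 'I_r.+1 -> 'I_B}]|.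
  by rewrite cardsT card_prod !card_ffun !card_ord cJ.
apply: leq_trans (leq_imset_card comp _).
apply/subset_leq_card/subsetP => f; rewrite inE => /forallP isoF.
have [j0 _] : exists j0 : J, true.
  by have /card_gt0P[j _] : (0 < #|J|)%N by [rewrite cJ]; exists j.
pose S := [set f x | x in J].
have cS : (#|S| <= r.+1)%N.
  have : (\sum_(v in S) 2 <= #|J|)%N.
    rewrite -sum1_card (partition_big_imset f) /=.
    apply: leq_sum => _ /imsetP[j _ ->].
    have /existsP[j' /andP[nj fj]] := isoF j.
    rewrite (bigD1 j) //= (bigD1 j') /=; last by rewrite fj nj.
    by [].
  by rewrite sum_nat_const cJ; lia.
apply/imsetP; pose en := enum S.
exists ([ffun j => inord (index (f j) en)], [ffun i : 'I_r.+1 => nth (f j0) en i]); first by rewrite inE.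
apply/ffunP => j; rewrite !ffunE /=.
have fjS : f j \in en by rewrite mem_enum imset_f ?inE.
by rewrite inordK ?nth_index // (leq_trans _ cS) // cardE index_mem.
Qed.

(** Conjugation as a power makes a product of values and conjugates the value of [chi] at one
    polynomial. The factor 2 keeps the exponent positive when [totient q] is 1, so that both sides
    vanish for [n] not coprime to [q]. *)
Lemma dchar_conj_exp q chi n : (0 < q)%N -> dchar q chi ->
  (chi n)^* = chi n ^+ (2 * totient q).-1.
Proof.
move=> q0 chiP; have t0 : (0 < totient q)%N by rewrite totient_gt0.
have E0 : (0 < (2 * totient q).-1)%N by lia.
case: (boolP (coprime n q)) => [cnq|/(dchar_eq0 chiP)->]; last first.
  by rewrite rmorph0 expr0n gtn_eqF.
have c0 : chi n != 0 by rewrite (dchar_neq0 chiP).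
apply: (mulfI c0); rewrite -exprS prednK; last by lia.
by rewrite mulnC exprM (dchar_totient chiP cnq) expr1n -normCK (dchar_norm chiP) cnq expr1n.
Qed.

Section Moment.
Variables (q : nat) (chi : nat -> algC) (B : nat).
Hypotheses (q0 : (0 < q)%N) (chiP : dchar q chi) (chiPr : primitive q chi).
Hypothesis cf : forall p, prime p -> ~~ (p ^ 3 %| q)%N.

Definition adist (a b : nat) : nat := ((a - b) + (b - a))%N.

Lemma sum_gcd_adist (b0 : 'I_B) :
  (\sum_(b < B | b != b0) gcdn (adist b0 b) q <= 2 * (B * num_divisors q))%N.
Proof.
pose G m := (\sum_(1 <= t < m) gcdn t q)%N.
have G_le m : (m <= B.+1)%N -> (G m <= B * num_divisors q)%N.
  move=> le_m; apply: leq_trans (sum_gcd_le B q0).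
  case: m le_m => [|m] le_m; first by rewrite /G big_geq.
  by rewrite /G [X in (_ <= X)%N](@big_cat_nat _ _ _ m.+1) //= leq_addr.
have lt0 := ltn_ord b0.
rewrite (eq_bigl (fun b : 'I_B => (b : nat) != b0)) //.
rewrite -(big_mkord (fun b => b != b0) (fun b => gcdn (adist b0 b) q)).
rewrite (@big_cat_nat _ _ _ b0) //=; last exact: ltnW.
rewrite [X in (_ + X <= _)%N]big_mkcond [X in (_ + X <= _)%N]big_ltn // eqxx /= add0n -big_mkcond mul2n -addnn.
apply: leq_add.
  rewrite big_nat_rev /= add0n; apply: leq_trans (G_le b0.+1 _); last by rewrite ltnW.
  rewrite /G big_add1 /= big_mkcond !big_nat; apply: leq_sum => b /andP[_ ltb].
  case: ifP => // _; rewrite /adist (_ : (b0 - (b0 - b.+1) + (b0 - b.+1 - b0) = b.+1)%N) //; lia.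
apply: leq_trans (G_le (B - b0)%N _); last by lia.
rewrite -[b0.+1]add1n big_addn /G big_mkcond; apply: leq_sum => b _.
case: ifP => // _; rewrite /adist (_ : (b0 - (b + b0) + (b + b0 - b0) = b)%N) //; lia.
Qed.

Section Isolated.
Variables (J : finType) (e : J -> nat) (j0 : J).
Hypotheses (e1 : e j0 = 1%N) (e0 : forall j, (0 < e j)%N).

Lemma complete_sum_isolated (f : J -> nat) :
  `|\sum_(x < q) \prod_j chi (x + f j) ^+ e j| <=
  (#|J| ^ size (primes q) * \prod_(j | j != j0) gcdn (adist (f j0) (f j)) q)%N%:R * sqrtC q%:R.
Proof.
pose bs := [seq (f j, e j) | j <- enum J & j != j0].
have e0' c : c \in bs -> (0 < c.2)%N by case/mapP => j _ ->; exact: e0.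
have sbs : ((size bs).+1 = #|J|)%N.
  rewrite size_map size_filter cardE -(count_predC (pred1 j0) (enum J)).
  by rewrite count_uniq_mem ?enum_uniq // mem_enum.
have -> : \sum_(x < q) \prod_j chi (x + f j) ^+ e j = complete_sum q chi ((f j0, 1%N) :: bs).
  apply: eq_bigr => x _; rewrite /prod_shift big_cons /= (dcharM chiP) (dchar_prod chiP).
  rewrite (bigD1 j0) //= e1 -(dcharX chiP); congr (_ * _).
  rewrite big_map big_filter big_enum_cond /=; apply: eq_bigr => j _.
  by rewrite (dcharX chiP).
apply: le_trans (complete_sum_bound (f j0) q0 cf chiP chiPr e0') _.
rewrite sbs mulrAC -natrM ler_wpM2r ?sqrtC_ge0 ?ler0n // ler_nat leq_mul2l; apply/orP; right.
apply: leq_trans (gcdn_prod_le _ _ q0) _.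
by rewrite big_map big_filter big_enum_cond.
Qed.
End Isolated.

(** The power is expanded over tuples of shifts. Tuples in which every value repeats are few and are
    bounded trivially; any other tuple has an isolated shift, to which the complete sum bound
    applies. Averaging the gcd factors over the tuples produces the power of [num_divisors q]. *)
Lemma moment_bound r : (0 < r)%N ->
  \sum_(x < q) `|\sum_(b < B) chi (x + b)| ^+ (r + r) <=
  (r ^ (r + r) * B ^ r * q)%N%:R +
  ((r + r) ^ (size (primes q)).+1 * (2 * num_divisors q) ^ (r + r).-1 * B ^ (r + r))%N%:R * sqrtC q%:R.
Proof.
move=> r0; pose J := ('I_r + 'I_r)%type; pose E := (2 * totient q).-1.
have E0 : (0 < E)%N by have : (0 < totient q)%N; [rewrite totient_gt0|rewrite /E; lia].
pose e (j : J) := if j is inl _ then 1%N else E.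
(* The exponents after complex conjugation, which gives exponent one to an isolated shift of a
   conjugated factor. *)
pose e' (j : J) := if j is inl _ then E else 1%N.
have ep j : (0 < e j)%N by case: j.
have ep' j : (0 < e' j)%N by case: j.
have cJ : #|{: J}| = (r + r)%N by rewrite card_sum !card_ord.
pose T (f : {ffun J -> 'I_B}) := \sum_(x < q) \prod_j chi (x + f j) ^+ e j.
have pos : 0 <= \sum_(x < q) `|\sum_(b < B) chi (x + b)| ^+ (r + r).
  by rewrite sumr_ge0 // => x _; rewrite exprn_ge0.
rewrite -(ger0_norm pos); have -> : \sum_(x < q) `|\sum_(b < B) chi (x + b)| ^+ (r + r) = \sum_f T f.
  rewrite /T exchange_big; apply: eq_bigr => x _ /=.
  rewrite -(bigA_distr_bigA (fun j (b : 'I_B) => chi (x + b) ^+ e j)) big_sumType /=.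
  rewrite !prodr_const !card_ord -exprMn; under [X in _ = (X * _) ^+ _]eq_bigr => b _ do rewrite expr1.
  under [X in _ = (_ * X) ^+ _]eq_bigr => b _ do rewrite -(dchar_conj_exp _ q0 chiP).
  by rewrite -rmorph_sum -normCK -exprM mul2n addnn.
pose bad (f : {ffun J -> 'I_B}) := [forall j, [exists j', (j' != j) && (f j' == f j)]].
(* The value 0 at coincidences allows summing over all tuples, where the sum factors over the
   coordinates. *)
pose w (j0 : J) (f : {ffun J -> 'I_B}) :=
  (\prod_(j | j != j0) (if f j == f j0 then 0 else gcdn (adist (f j0) (f j)) q))%N.
pose C := ((r + r) ^ size (primes q))%N.
have TJ (f : {ffun J -> 'I_B}) j0 : (forall j, j != j0 -> f j != f j0) -> `|T f| <= (C * w j0 f)%N%:R * sqrtC q%:R.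
  move=> iso; have -> : w j0 f = (\prod_(j | j != j0) gcdn (adist (f j0) (f j)) q)%N.
    by apply: eq_bigr => j /iso/negPf->.
  rewrite /C -cJ; case: j0 iso => [i|i] iso.
    exact: (@complete_sum_isolated J e (inl i) erefl ep).
  have -> : `|T f| = `|\sum_(x < q) \prod_j chi (x + f j) ^+ e' j|.
    rewrite -norm_conjC rmorph_sum; congr `|_|; apply: eq_bigr => x _.
    rewrite rmorph_prod; apply: eq_bigr => -[] k _ /=.
      by rewrite expr1 (dchar_conj_exp _ q0 chiP).
    by rewrite -(dchar_conj_exp _ q0 chiP) conjCK expr1.
  exact: (@complete_sum_isolated J e' (inr i) erefl ep').
apply: le_trans (ler_norm_sum _ _ _) _.
rewrite (bigID bad) /=; apply: lerD.
  apply: (@le_trans _ _ (\sum_(f | bad f) q%:R)).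
    apply: ler_sum => f _; apply: le_trans (ler_norm_sum _ _ _) _.
    apply: (@le_trans _ _ (\sum_(x < q) 1)); last by rewrite sumr_const card_ord.
    apply: ler_sum => x _; rewrite normr_prod; apply: prodr_ile1 => j _ /=.
    by rewrite normr_ge0 normrX exprn_ile1 ?normr_ge0 // (dchar_norm_le1 chiP).
  rewrite sumr_const -[X in X <= _]mulr_natl -natrM ler_nat leq_mul2r; apply/orP; right.
  by have := card_no_isolated B r0 cJ; rewrite cardsE.
apply: (@le_trans _ _ (\sum_(f | ~~ bad f) \sum_j0 (C * w j0 f)%N%:R * sqrtC q%:R)).
  apply: ler_sum => f; rewrite negb_forall => /existsP[j0 /existsPn iso].
  rewrite (bigD1 j0) //=; apply: le_trans (TJ f j0 _) _.
    by move=> j nj; have := iso j; rewrite nj.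
  by rewrite lerDl sumr_ge0 // => j _; rewrite mulr_ge0 ?sqrtC_ge0 ?ler0n.
apply: (@le_trans _ _ (\sum_f \sum_j0 (C * w j0 f)%N%:R * sqrtC q%:R)).
  rewrite [X in _ <= X](bigID (fun f => ~~ bad f)) /= lerDl sumr_ge0 // => f _.
  by rewrite sumr_ge0 // => j _; rewrite mulr_ge0 ?sqrtC_ge0 ?ler0n.
under eq_bigr => f _ do rewrite -mulr_suml -natr_sum.
rewrite -mulr_suml -natr_sum ler_wpM2r ?sqrtC_ge0 ?ler0n // ler_nat.
rewrite exchange_big /=.
apply: (@leq_trans (\sum_(j0 : J) C * (B * (2 * (B * num_divisors q)) ^ (r + r).-1))); last first.
  have [s sE] : exists s, (r + r = s.+1)%N by exists (r + r).-1; lia.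
  rewrite sum_nat_const cJ /C sE /= [in X in (_ <= X)%N]expnS [(B ^ s.+1)%N]expnS !expnMn.
  by apply: eq_leq; lia.
apply: leq_sum => j0 _; rewrite -big_distrr /= leq_mul2l; apply/orP; right.
pose g (b0 b : 'I_B) := if b == b0 then 0%N else gcdn (adist b0 b) q.
apply: (@leq_trans (\sum_(b0 < B) \sum_(f : {ffun J -> 'I_B}) \prod_j (if j == j0 then nat_of_bool (f j == b0) else g b0 (f j)))%N).
  rewrite exchange_big /=; apply: leq_sum => f _; rewrite (bigD1 (f j0)) //= (bigD1 j0) //= !eqxx mul1n.
  rewrite {1}/w (eq_bigr (fun j => if j == j0 then nat_of_bool (f j == f j0) else g (f j0) (f j))) ?leq_addr //.
  by move=> j /negPf->.
apply: (@leq_trans (\sum_(b0 < B) (2 * (B * num_divisors q)) ^ (r + r).-1)); last first.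
  by rewrite sum_nat_const card_ord.
apply: leq_sum => b0 _.
rewrite -(bigA_distr_bigA (fun j b => if j == j0 then nat_of_bool (b == b0) else g b0 b)) (bigD1 j0) //=.
rewrite eqxx (bigD1 b0) //= eqxx big1 ?addn0 ?mul1n => [|b /negPf-> //].
apply: (@leq_trans (\prod_(j | j != j0) (2 * (B * num_divisors q)))).
  apply: leq_prod => j /negPf->; rewrite (bigD1 b0) //= {1}/g eqxx add0n.
  apply: leq_trans (sum_gcd_adist b0); apply: eq_leq; apply: eq_bigr => b nb.
  by rewrite /g (negPf nb).
rewrite prod_nat_const; have -> : #|[pred j | j != j0]| = (r + r).-1; last by [].
by rewrite -cJ -(cardC1 j0); apply: eq_card => j; rewrite !inE.
Qed.
End Moment.

(** * Burgess' bound *)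

Section Holder.
Variables (T : finType) (R : numDomainType).
Implicit Types (w a b t : T -> R).

Lemma weighted_cauchy_schwarz w a b : (forall i, 0 <= w i) -> (forall i, a i \is Num.real) ->
  (forall i, b i \is Num.real) ->
  (\sum_i w i * (a i * b i)) ^+ 2 <= (\sum_i w i * a i ^+ 2) * (\sum_i w i * b i ^+ 2).
Proof.
move=> w0 ar br; rewrite -(ler_pM2l (ltr0n R 2)) -subr_ge0.
have -> : 2%:R * ((\sum_i w i * a i ^+ 2) * (\sum_i w i * b i ^+ 2)) -
    2%:R * (\sum_i w i * (a i * b i)) ^+ 2 =
    \sum_i \sum_j w i * w j * (a i * b j - a j * b i) ^+ 2.
  transitivity (\sum_i \sum_j (w i * a i ^+ 2 * (w j * b j ^+ 2) + w j * a j ^+ 2 * (w i * b i ^+ 2)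
     - 2%:R * (w i * (a i * b i) * (w j * (a j * b j))))); last first.
    by apply: eq_bigr => i _; apply: eq_bigr => j _; ring.
  under [RHS]eq_bigr => i _ do rewrite !big_split sumrN /= -!mulr_sumr -!mulr_suml.
  rewrite !big_split sumrN /= -!mulr_suml -!mulr_sumr -!mulr_suml; ring.
apply: sumr_ge0 => i _; apply: sumr_ge0 => j _; apply: mulr_ge0; first exact: mulr_ge0.
by rewrite real_exprn_even_ge0 // realB ?realM.
Qed.

(** The Cauchy-Schwarz inequality iterated [s] times. This is the reason for taking moments whose
    order is a power of two. *)
Lemma jensen_pow2 w t s : (forall i, 0 <= w i) -> (forall i, 0 <= t i) ->
  (\sum_i w i * t i) ^+ (2 ^ s) <= (\sum_i w i) ^+ (2 ^ s).-1 * \sum_i w i * t i ^+ (2 ^ s).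
Proof.
move=> w0 t0; have W0 : 0 <= \sum_i w i by apply: sumr_ge0.
elim: s => [|s IHs]; first by rewrite !expr1 expr0 mul1r; under [X in _ <= X]eq_bigr => i _ do rewrite expr1.
have -> : (2 ^ s.+1 = 2 ^ s * 2)%N by rewrite expnSr.
have s0 : (0 < 2 ^ s)%N by rewrite expn_gt0.
rewrite exprM; apply: (@le_trans _ _ (((\sum_i w i) ^+ (2 ^ s).-1 * \sum_i w i * t i ^+ (2 ^ s)) ^+ 2)).
  rewrite lerXn2r ?nnegrE ?exprn_ge0 ?mulr_ge0 ?exprn_ge0 ?sumr_ge0 // => i _; rewrite ?mulr_ge0 ?exprn_ge0 //.
have -> : ((2 ^ s * 2).-1 = (2 ^ s).-1 * 2 + 1)%N by lia.
rewrite exprMn exprD exprM expr1 -mulrA; apply: ler_wpM2l; first by rewrite !exprn_ge0.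
have := @weighted_cauchy_schwarz w (fun=> 1) (fun i => t i ^+ (2 ^ s)) w0
  (fun i => real1 R) (fun i => realX _ (ger0_real (t0 i))).
have -> : \sum_i w i * (1 * t i ^+ (2 ^ s)) = \sum_i w i * t i ^+ (2 ^ s).
  by apply: eq_bigr => i _; rewrite mul1r.
have -> : \sum_i w i * 1 ^+ 2 = \sum_i w i by apply: eq_bigr => i _; rewrite expr1n mulr1.
by under [X in _ <= _ * X -> _]eq_bigr => i _ do rewrite -exprM.
Qed.

Lemma holder_pow2 w t s : (forall i, 0 <= w i) -> (forall i, 0 <= t i) ->
  (\sum_i w i * t i) ^+ (2 ^ s * 2) <=
  (\sum_i w i) ^+ ((2 ^ s).-1 * 2) * (\sum_i w i ^+ 2) * \sum_i t i ^+ (2 ^ s * 2).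
Proof.
move=> w0 t0; have W0 : 0 <= \sum_i w i by apply: sumr_ge0.
rewrite exprM; apply: (@le_trans _ _ (((\sum_i w i) ^+ (2 ^ s).-1 * \sum_i w i * t i ^+ (2 ^ s)) ^+ 2)).
  rewrite lerXn2r ?nnegrE ?exprn_ge0 ?mulr_ge0 ?exprn_ge0 ?sumr_ge0 ?jensen_pow2 // => i _; rewrite ?mulr_ge0 ?exprn_ge0 //.
rewrite exprMn exprM -mulrA; apply: ler_wpM2l; first by rewrite !exprn_ge0.
have := @weighted_cauchy_schwarz (fun=> 1) w (fun i => t i ^+ (2 ^ s)) (fun i => ler01)
  (fun i => ger0_real (w0 i)) (fun i => realX _ (ger0_real (t0 i))).
under eq_bigr => i _ do rewrite mul1r.
under [X in _ <= X * _ -> _]eq_bigr => i _ do rewrite mul1r.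
by under [X in _ <= _ * X -> _]eq_bigr => i _ do rewrite mul1r -exprM.
Qed.
End Holder.

Lemma exprD_le (R : numDomainType) (x y : R) n : 0 <= x -> 0 <= y ->
  (x + y) ^+ n <= 2%:R ^+ n * (x ^+ n + y ^+ n).
Proof.
wlog le_xy : x y / x <= y => [H x0 y0|x0 y0].
  have [/H->//|/ltW/H] := real_leP (ger0_real x0) (ger0_real y0).
  by move=> H'; rewrite addrC [x ^+ n + _]addrC; apply: H'.
apply: (@le_trans _ _ ((2%:R * y) ^+ n)).
  by rewrite lerXn2r ?nnegrE ?addr_ge0 ?mulr_ge0 ?ler0n // mulr2n mulrDl mul1r lerD2r.
by rewrite exprMn ler_wpM2l ?exprn_ge0 ?ler0n // lerDr exprn_ge0.
Qed.

Section Shift.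
Variables (q : nat) (chi : nat -> algC).
Hypotheses (q0 : (0 < q)%N) (chiP : dchar q chi).

Definition char_sum Y := \sum_(1 <= n < Y.+1) chi n.

Lemma char_sum_shift Y t : `|char_sum Y - \sum_(1 <= n < Y.+1) chi (n + t)%N| <= (2 * t)%N%:R.
Proof.
elim: t => [|t IHt].
  rewrite /char_sum; under [X in _ - X]eq_bigr => n _ do rewrite addn0.
  by rewrite subrr normr0.
have step : `|\sum_(1 <= n < Y.+1) chi (n + t)%N - \sum_(1 <= n < Y.+1) chi (n + t.+1)%N| <= 2%:R.
  rewrite -sumrB (eq_big_nat _ _ (F2 := fun n => - (chi (n.+1 + t)%N - chi (n + t)%N))) => [|n _].
    rewrite sumrN normrN (telescope_sumr (fun n => chi (n + t)%N)) //.
    apply: le_trans (ler_normB _ _) _; rewrite (natrD _ 1 1).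
    by rewrite lerD // (dchar_norm_le1 chiP).
  by rewrite opprB addnS addSn.
have -> : char_sum Y - \sum_(1 <= n < Y.+1) chi (n + t.+1)%N =
   (char_sum Y - \sum_(1 <= n < Y.+1) chi (n + t)%N) +
   (\sum_(1 <= n < Y.+1) chi (n + t)%N - \sum_(1 <= n < Y.+1) chi (n + t.+1)%N) by ring.
apply: le_trans (ler_normD _ _) _; rewrite mulnS addnC natrD; exact: lerD.
Qed.

Lemma char_sum_le_modulus Y : (1 < q)%N -> nonprincipal q chi -> `|char_sum Y| <= q%:R.
Proof.
move=> q1 chiN.
have chi0 : chi 0%N = 0.
  by apply: (dchar_eq0 chiP); rewrite /coprime gcd0n gtn_eqF.
have -> : char_sum Y = \sum_(0 <= n < Y.+1) chi n by rewrite [RHS]big_ltn // chi0 add0r.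
rewrite {1}(divn_eq Y.+1 q) (@big_cat_nat _ _ _ (Y.+1 %/ q * q)%N) ?leq_addr //=.
rewrite [X in X + _](_ : _ = 0) ?add0r; last first.
  rewrite mulnC big_mkord (sum_mixed_radix chi) exchange_big big1 //= => z _.
  rewrite -[RHS](dchar_sum0 chiP q0 chiN); apply: eq_bigr => y _.
  by apply: (dchar_mod chiP); rewrite addnC mulnC modnMDl.
apply: le_trans (ler_norm_sum _ _ _) _.
apply: (@le_trans _ _ (\sum_(Y.+1 %/ q * q <= i < Y.+1 %/ q * q + Y.+1 %% q) 1)).
  by apply: ler_sum => i _; exact: (dchar_norm_le1 chiP).
by rewrite sumr_const_nat addKn ler_nat ltnW // ltn_pmod.
Qed.

(* Replacing [n] by [n + a b] and dividing by [a] turns the short sum into a sum of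
   [`|\sum_b chi (x + b)|] over the residues [x = n / a]. *)
Section Average.
Variables (A B Y T s : nat).
Hypothesis fiberT : forall n, (0 < n <= A * Y)%N -> (num_divisors n <= T)%N.
Let I := ('I_A * 'I_Y)%type.
Let admissible (i : I) := coprime i.1.+1 q.
Let residue (i : I) : 'I_q := Ordinal (ltn_pmod (i.2.+1 * i.1.+1 ^ (totient q).-1) q0).
Let nu (x : 'I_q) : nat := #|[set i | admissible i && (residue i == x)]|.
Let tt (x : 'I_q) : algC := `|\sum_(b < B) chi (x + b)|.
Let cA := coprime_count q A.

Lemma coprime_count_ord X : coprime_count q X = #|[set a : 'I_X | coprime a.+1 q]|.
Proof.
rewrite /coprime_count big_add1 /= big_mkord -sum1_card.
by apply: eq_bigl => a; rewrite inE.
Qed.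

Lemma inv_mod a : coprime a q -> (a * a ^ (totient q).-1 = 1 %[mod q])%N.
Proof.
by move=> ca; rewrite -expnS prednK ?totient_gt0 // Euler_exp_totient.
Qed.

Lemma sum_nu_by (F : 'I_q -> algC) :
  \sum_x (nu x)%:R * F x = \sum_(i | admissible i) F (residue i).
Proof.
rewrite [RHS](partition_big residue xpredT) //=; apply: eq_bigr => x _.
rewrite (eq_bigr (fun=> F x)) => [|i /andP[_ /eqP->] //].
rewrite sumr_const mulr_natl; congr (_ *+ _).
by rewrite /nu cardsE.
Qed.

Lemma card_admissible : #|[set i | admissible i]| = (cA * Y)%N.
Proof.
rewrite /cA coprime_count_ord -[in RHS](card_ord Y) -cardsT -cardsX.
by apply: eq_card => -[a n]; rewrite !inE andbT.
Qed.

Lemma sum_nu : \sum_x ((nu x)%:R : algC) = (cA * Y)%N%:R.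
Proof.
under eq_bigr => x _ do rewrite -[_%:R]mulr1.
by rewrite (sum_nu_by (fun=> 1)) sumr_const -card_admissible cardsE.
Qed.

(** The second moment counts the solutions of [a' * n = a * n'] modulo [q]. Exchanging [a] and [a']
    turns them into pairs of products [a * n] in one residue class, which [card_congruent] and the
    divisor bound control. *)
Lemma sum_nu_sq : \sum_x ((nu x)%:R : algC) ^+ 2 <= (cA * Y * (((A * Y) %/ q).+1 * T))%N%:R.
Proof.
under eq_bigr => x _ do rewrite expr2.
rewrite (sum_nu_by (fun x => (nu x)%:R)) -natr_sum ler_nat.
have step : (\sum_(i | admissible i) nu (residue i) <=
   \sum_(i | admissible i) \sum_(j | admissible j) (j.1.+1 * i.2.+1 == i.1.+1 * j.2.+1 %[mod q]))%N.
  apply: leq_sum => i ai; rewrite /nu -sum1_card big_mkcond [X in (_ <= X)%N]big_mkcond.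
  apply: leq_sum => j _; rewrite inE; case: ifP => // /andP[aj /eqP/(congr1 val)/= E].
  rewrite aj; have ci := inv_mod ai; have cj := inv_mod aj.
  suff -> : (j.1.+1 * i.2.+1 == i.1.+1 * j.2.+1 %[mod q])%N by [].
  apply/eqP.
  transitivity ((j.1.+1 * (i.1.+1 * (i.2.+1 * i.1.+1 ^ (totient q).-1))) %% q)%N.
    have -> : (j.1.+1 * (i.1.+1 * (i.2.+1 * i.1.+1 ^ (totient q).-1)) =
      (j.1.+1 * i.2.+1) * (i.1.+1 * i.1.+1 ^ (totient q).-1))%N by lia.
    by rewrite -[in RHS]modnMmr ci modnMmr muln1.
  rewrite mulnA -modnMmr -E modnMmr.
  have -> : (j.1.+1 * i.1.+1 * (j.2.+1 * j.1.+1 ^ (totient q).-1) =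
      (i.1.+1 * j.2.+1) * (j.1.+1 * j.1.+1 ^ (totient q).-1))%N by lia.
  by rewrite -[in LHS]modnMmr cj modnMmr muln1.
apply: leq_trans step _.
pose v (k : I) := (k.1.+1 * k.2.+1)%N.
have -> : (\sum_(i | admissible i) \sum_(j | admissible j) (j.1.+1 * i.2.+1 == i.1.+1 * j.2.+1 %[mod q]) =
   \sum_(k | admissible k) \sum_(l | admissible l) (v l == v k %[mod q]))%N.
  pose h (x : I * I) : I * I := ((x.2.1, x.1.2), (x.1.1, x.2.2)).
  have hK : involutive h by case=> [[a n] [a' n']].
  rewrite !pair_big /= (reindex_inj (inv_inj hK)) /=; apply: eq_big => [x|x _].
    by rewrite /admissible andbC.
  by rewrite eq_sym.
apply: (@leq_trans (\sum_(k | admissible k) (((A * Y) %/ q).+1 * T))%N); last first.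
  by rewrite sum_nat_const -card_admissible cardsE.
apply: leq_sum => k _; rewrite -big_mkcondr sum1dep_card.
apply: (@card_congruent _ v admissible) => // [i _|n le_n].
  by rewrite /v leq_mul.
have [->|n0] := posnP n; first by rewrite (eq_card0 (A := [set _ | _])) // => i; rewrite !inE andbF.
apply: (@leq_trans (num_divisors n)); last by apply: fiberT; rewrite n0.
rewrite cardE -(size_map (fun i : I => i.1.+1)); apply: uniq_leq_size.
  rewrite map_inj_in_uniq ?enum_uniq // => -[a m] [a' m']; rewrite !mem_enum !inE /= /v /=.
  move=> /andP[_ /eqP E1] /andP[_ /eqP E2] E; have aa : a = a' by apply: val_inj; case: E.
  move: E1; rewrite -E2 aa => /eqP; rewrite eqn_pmul2l // => /eqP[mm].
  by congr (_, _); apply: val_inj.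
move=> _ /mapP[i + ->]; rewrite mem_enum inE => /andP[_ /eqP <-].
by rewrite -dvdn_divisors /v // dvdn_mulr.
Qed.

(** The first term is Hölder's inequality for the multiplicities [nu] against the inner sums over
    [b]. The second is the error of the shifts, each at most [2 * (A * B)]. *)
Lemma average_le : ((cA * B)%N%:R * `|char_sum Y|) ^+ (2 ^ s * 2) <=
  2%:R ^+ (2 ^ s * 2) *
   ((cA * Y)%N%:R ^+ ((2 ^ s).-1 * 2) * (cA * Y * ((A * Y) %/ q).+1 * T)%N%:R *
      (\sum_(x < q) `|\sum_(b < B) chi (x + b)| ^+ (2 ^ s * 2)) +
    (cA * B * (2 * (A * B)))%N%:R ^+ (2 ^ s * 2)).
Proof.
have nu0 x : 0 <= ((nu x)%:R : algC) by [].
have tt0 x : 0 <= tt x by rewrite normr_ge0.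
have main : (cA * B)%N%:R * `|char_sum Y| <= \sum_x (nu x)%:R * tt x + (cA * B * (2 * (A * B)))%N%:R.
  pose C a b := \sum_(1 <= n < Y.+1) chi (n + a * b)%N.
  have -> : (cA * B)%N%:R * `|char_sum Y| = `|\sum_(a < A | coprime a.+1 q) \sum_(b < B) char_sum Y|.
    under eq_bigr => a _ do rewrite sumr_const card_ord.
    rewrite sumr_const (_ : #|_| = cA); last by rewrite /cA coprime_count_ord cardsE.
    by rewrite -mulrnA normrMn mulr_natl mulnC.
  have -> : \sum_(a < A | coprime a.+1 q) \sum_(b < B) char_sum Y =
     \sum_(a < A | coprime a.+1 q) \sum_(b < B) C a.+1 b +
     \sum_(a < A | coprime a.+1 q) \sum_(b < B) (char_sum Y - C a.+1 b).
    rewrite -big_split; apply: eq_bigr => a _; rewrite -big_split; apply: eq_bigr => b _ /=.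
    by rewrite addrC subrK.
  apply: le_trans (ler_normD _ _) _; apply: lerD; last first.
    apply: le_trans (ler_norm_sum _ _ _) _.
    apply: (@le_trans _ _ (\sum_(a < A | coprime a.+1 q) \sum_(b < B) (2 * (A * B))%N%:R)).
      apply: ler_sum => a _; apply: le_trans (ler_norm_sum _ _ _) _; apply: ler_sum => b _.
      apply: le_trans (char_sum_shift _ _) _; rewrite ler_nat leq_mul2l /=.
      by rewrite leq_mul // ltnW.
    under eq_bigr => a _ do rewrite sumr_const card_ord.
    rewrite sumr_const (_ : #|_| = cA); last by rewrite /cA coprime_count_ord cardsE.
    by rewrite -mulrnA -[X in X <= _]mulr_natr -natrM ler_nat; lia.
  rewrite (sum_nu_by tt); apply: le_trans (ler_norm_sum _ _ _) _.
  rewrite [X in _ <= X](eq_bigl (fun i : I => coprime i.1.+1 q && true)) => [|i]; last by rewrite andbT.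
  rewrite -(pair_big_dep (fun a : 'I_A => coprime a.+1 q) (fun _ _ => true) (fun a n => tt (residue (a, n)))) /=.
  apply: ler_sum => a ca.
  have -> : \sum_(b < B) C a.+1 b = \sum_(n < Y) chi a.+1 * \sum_(b < B) chi (residue (a, n) + b)%N.
    rewrite /C; under eq_bigr => b _ do rewrite big_add1 /= big_mkord.
    rewrite exchange_big; apply: eq_bigr => n _; rewrite mulr_sumr; apply: eq_bigr => b _.
    rewrite -(dcharM chiP) /=; apply: (dchar_mod chiP).
    have E : (a.+1 * ((n.+1 * a.+1 ^ (totient q).-1) %% q) = n.+1 %[mod q])%N.
      by rewrite modnMmr mulnCA -modnMmr (inv_mod ca) modnMmr muln1.
    by rewrite mulnDr -[in RHS]modnDml E modnDml.
  apply: le_trans (ler_norm_sum _ _ _) _; apply: ler_sum => n _.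
  by rewrite normrM (dchar_norm chiP) ca mul1r.
apply: (@le_trans _ _ ((\sum_x (nu x)%:R * tt x + (cA * B * (2 * (A * B)))%N%:R) ^+ (2 ^ s * 2))).
  by rewrite lerXn2r ?nnegrE ?mulr_ge0 ?addr_ge0 ?sumr_ge0 // => x _; rewrite mulr_ge0.
apply: le_trans (exprD_le _ _ _) _ => //; first by rewrite sumr_ge0 // => x _; rewrite mulr_ge0.
rewrite ler_wpM2l ?exprn_ge0 // lerD2r; apply: le_trans (holder_pow2 s nu0 tt0) _.
rewrite sum_nu; apply: ler_wpM2r; first by rewrite sumr_ge0 // => x _; rewrite exprn_ge0.
apply: ler_wpM2l; first by rewrite exprn_ge0.
by apply: le_trans sum_nu_sq _; rewrite !mulnA.
Qed.
End Average.
End Shift.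

Lemma exists_root n q : (0 < n)%N -> (0 < q)%N ->
  exists g, [/\ (0 < g)%N, (g ^ n <= q)%N & (q < (2 * g) ^ n)%N].
Proof.
move=> n0 q0; have ex : exists g, (0 < g)%N && (g ^ n <= q)%N by exists 1%N; rewrite exp1n.
have bnd g : (0 < g)%N && (g ^ n <= q)%N -> (g <= q)%N.
  move=> /andP[g0 le]; apply: leq_trans le.
  by rewrite -{1}[g]expn1 leq_pexp2l.
case: (ex_maxnP ex bnd) => g /andP[g0 le_g] max_g; exists g; split=> //.
rewrite ltnNge; apply/negP => le2; have := max_g g.+1.
have -> : (0 < g.+1)%N && (g.+1 ^ n <= q)%N; last by rewrite ltnn => /(_ isT).
by apply: leq_trans le2; rewrite leq_exp2r //; lia.
Qed.

Section BurgessCore.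
Variables (q : nat) (chi : nat -> algC) (s k g h D Y : nat).
Hypotheses (q0 : (0 < q)%N) (chiP : dchar q chi) (chiPr : primitive q chi).
Hypothesis cf : forall p, prime p -> ~~ (p ^ 3 %| q)%N.
Let r := (2 ^ s)%N.
Hypotheses (r8 : (8 <= r)%N) (rk : (2 * k <= r)%N) (k0 : (0 < k)%N).
Hypotheses (g_le : (g ^ (r + r) <= q)%N) (q_lt : (q < (2 * g) ^ (r + r))%N) (g0 : (0 < g)%N).
Hypotheses (Y_ge : (q ^ (k + 4) <= Y ^ (4 * k))%N) (Y_le : (Y <= q ^ 2)%N).
Hypothesis D_ge : forall n, (n <= q ^ 4)%N -> (num_divisors n <= D)%N.
Hypothesis h_le : (8 * h <= g)%N.
Hypothesis D_le : (h ^ (r + r) * (4 ^ r * (6 * (2 * D ^ 2 * D *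
  (r ^ (r + r) * 2 ^ r + (r + r) * D ^ (r + r) * (2 * D) ^ (r + r).-1)))) <= g ^ 6)%N.

(** Here [g] is about the [2 r]-th root of [q]. The shifts [a * b] with [a <= A] and [b < g] are at
    most about [Y / g], so they cost little, and [g ^ r] being about the square root of [q] balances
    the two terms of [moment_bound]. *)
Let A := (Y %/ g ^ 2)%N.
Let cA := coprime_count q A.
Let t := (2 ^ size (primes q))%N.
Let sq : algC := sqrtC q%:R.

(** From [g ^ (16 * k) <= g ^ (8 * r) <= q ^ 4], by [2 * k <= r]. The surplus of [Y] over the fourth
    root of [q] becomes a power of [g], from which the saving on the moment term is drawn. *)
Lemma root_scale : (q * g ^ 16 <= Y ^ 4)%N.
Proof.
rewrite -(leq_exp2r _ _ k0) -expnM; apply: leq_trans Y_ge.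
rewrite expnMn -expnM expnD leq_mul2l; apply/orP; right.
apply: (@leq_trans ((g ^ (r + r)) ^ 4)); last by rewrite leq_exp2r.
rewrite -expnM leq_pexp2l //.
by move: rk; generalize r => u; clear; lia.
Qed.

Lemma scale_gt0 : [/\ (0 < D)%N, (t <= D)%N, (g ^ 4 <= Y)%N & (0 < A)%N].
Proof.
have tD : (t <= D)%N.
  apply: leq_trans (exp2_omega_le q0) (D_ge _).
  by rewrite -{1}[q]expn1 leq_pexp2l.
have t0 : (0 < t)%N by rewrite expn_gt0.
have gY : (g ^ 4 <= Y)%N.
  rewrite -(leq_exp2r _ _ (isT : 0 < 4)%N) -expnM.
  by apply: leq_trans root_scale; rewrite leq_pmull.
split=> //; first exact: leq_trans tD.
rewrite /A divn_gt0 ?expn_gt0 ?g0 //; apply: leq_trans gY.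
by rewrite leq_pexp2l.
Qed.

(** [totient q / q] is at least [1 / t] with [t <= D]; losing powers of [D] is harmless, as they are
    small against [g]. *)
Lemma coprime_count_lower : (A <= 2 * D ^ 2 * cA)%N.
Proof.
have [D0 tD gY A0] := scale_gt0; have t0 : (0 < t)%N by rewrite expn_gt0.
have [_ h2] := coprime_count_bounds A q0; have h3 := leq_totient_omega q0.
have cA0 : (0 < cA)%N.
  rewrite /cA /coprime_count; case: (A) A0 => // a _.
  by rewrite big_ltn_cond // coprime1n.
apply: (@leq_trans ((cA + t) * t)).
  rewrite -(leq_pmul2r q0); apply: (@leq_trans (A * totient q * t)).
    by rewrite -mulnA leq_mul2l h3 orbT.
  by rewrite [X in (_ <= X)%N]mulnAC leq_mul2r h2 orbT.
apply: (@leq_trans ((2 * t * cA) * t)).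
  by rewrite leq_mul2r; apply/orP; right; move: cA0 t0; generalize cA t => u v; clear; nia.
have -> : (2 * t * cA * t = 2 * t ^ 2 * cA)%N by rewrite expnS expn1; lia.
by rewrite leq_mul2r leq_mul2l leq_exp2r // tD !orbT.
Qed.

Lemma sqrt_bounds : [/\ 0 < sq, (g ^ r)%N%:R <= sq, sq <= (2 ^ r * g ^ r)%N%:R & sq ^+ 2 = q%:R].
Proof.
have r0 : (0 < r)%N by rewrite expn_gt0.
have sqK : sq ^+ 2 = q%:R by rewrite sqrtCK.
have sq0 : 0 <= sq by rewrite sqrtC_ge0 ler0n.
split=> //.
- by rewrite sqrtC_gt0 ltr0n.
- by rewrite -(@ler_sqr _ (g ^ r)%N%:R) ?nnegrE ?ler0n // sqK -natrX ler_nat -expnM muln2 -addnn.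
- rewrite -(@ler_sqr _ sq) ?nnegrE ?ler0n // sqK -natrX ler_nat -expnMn -expnM muln2 -addnn.
  exact: ltnW.
Qed.

Let W := (r ^ (r + r) * 2 ^ r + (r + r) * D ^ (r + r) * (2 * D) ^ (r + r).-1)%N.

Lemma moment_le : \sum_(x < q) `|\sum_(b < g) chi (x + b)| ^+ (r + r) <=
  (g ^ (r + r) * W)%N%:R * sq.
Proof.
have [sq0 _ sq_up sqK] := sqrt_bounds; have [D0 tD _ _] := scale_gt0.
have r0 : (0 < r)%N by rewrite expn_gt0.
apply: le_trans (moment_bound g q0 chiP chiPr cf r0) _; rewrite -/sq.
rewrite mulnDr natrD mulrDl; apply: lerD.
  rewrite natrM -sqK expr2 mulrA ler_pM2r //.
  apply: (@le_trans _ _ ((r ^ (r + r) * g ^ r)%N%:R * (2 ^ r * g ^ r)%N%:R)).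
    by rewrite ler_wpM2l.
  by rewrite -natrM ler_nat (expnD g r r); apply: eq_leq; ring.
rewrite ler_pM2r // ler_nat [X in (_ <= X)%N]mulnC leq_mul2r; apply/orP; right.
apply: leq_mul; last first.
  rewrite leq_exp2r; last by move: r8; generalize r => u; clear; lia.
  by rewrite leq_mul2l D_ge ?orbT // -{1}[q]expn1 leq_pexp2l.
rewrite expnS leq_mul2l; apply/orP; right.
apply: (@leq_trans ((2 ^ (r + r)) ^ size (primes q))).
  have [->|w0] := posnP (size (primes q)); first by rewrite !expn0.
  by rewrite leq_exp2r // ltnW // ltn_expl.
rewrite -expnM mulnC expnM leq_exp2r //.
by move: r8; generalize r => u; clear; lia.
Qed.

Lemma burgess_core : h%:R * `|char_sum chi Y| <= Y%:R.
Proof.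
have [sq0 sq_lo sq_up sqK] := sqrt_bounds; have [D0 tD gY A0] := scale_gt0.
have r0 : (0 < r)%N by rewrite expn_gt0.
have q4 n : (0 < n <= A * Y)%N -> (num_divisors n <= D)%N.
  move=> /andP[_ le_n]; apply: D_ge; apply: leq_trans le_n _.
  have : (A <= q ^ 2)%N by apply: leq_trans (leq_div _ _) Y_le.
  by move=> AY; rewrite (expnD q 2 2); apply: leq_mul.
have := @average_le q chi q0 chiP A g Y D s q4.
rewrite -/cA -/r muln2 -addnn.
have cA0 : (0 < cA)%N.
  by have := coprime_count_lower; case: (cA) => //; rewrite muln0 leqNgt A0.
set S := `|char_sum chi Y|; have S0 : 0 <= S by rewrite normr_ge0.
move=> avg.
have {avg} avg : (cA * g)%N%:R ^+ (r + r) * S ^+ (r + r) <= 2%:R ^+ (r + r) *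
   ((cA * Y)%N%:R ^+ (r.-1 * 2) * (cA * Y * ((A * Y) %/ q).+1 * D)%N%:R * ((g ^ (r + r) * W)%N%:R * sq) +
    (cA * g * (2 * (A * g)))%N%:R ^+ (r + r)).
  rewrite -exprMn; apply: le_trans avg _.
  rewrite ler_wpM2l ?exprn_ge0 // lerD2r ler_wpM2l ?mulr_ge0 ?exprn_ge0 //.
  exact: moment_le.
set n := (r + r)%N in avg *; set E := ((A * Y) %/ q).+1 in avg.
have n0 : (0 < n)%N by rewrite addn_gt0 r0.
have nat0 (m : nat) : 0 <= (m%:R : algC) by rewrite ler0n.
have Y0 : (0 < Y)%N by apply: leq_trans gY; rewrite expn_gt0 g0.
have Ag : (A * g ^ 2 <= Y)%N by apply: leq_trunc_div.
have YA : (Y <= A * (2 * g ^ 2))%N.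
  by have := ltn_ceil Y (_ : 0 < g ^ 2)%N; rewrite -/A expn_gt0 g0 => /(_ isT); move: A0; generalize A (g ^ 2)%N => u v; clear; nia.
have Ysq : sq * (g ^ 8)%N%:R <= (Y ^ 2)%N%:R.
  rewrite -(@ler_sqr _ (sq * _)) ?nnegrE ?mulr_ge0 ?(ltW sq0) // exprMn sqK -!natrX -natrM ler_nat.
  by rewrite -!expnM; exact: root_scale.
(* [c1] and [c2] treat the two parts of [E], the summand 1 and the quotient [A * Y %/ q], each with
   a gain of [g ^ 6]. *)
have c1 : (g ^ 6)%N%:R * sq <= (2 * (A * Y))%N%:R.
  rewrite -(@ler_pM2r _ (g ^ 2)%N%:R) ?ltr0n ?expn_gt0 ?g0 // mulrAC -!natrM -expnD mulrC.
  apply: le_trans Ysq _; rewrite ler_nat -mulnn; move: YA; generalize A (g ^ 2)%N => u v; clear; nia.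
have c2 : (g ^ 6)%N%:R * (((A * Y) %/ q)%N%:R * sq) <= (A * Y)%N%:R.
  apply: (@le_trans _ _ (((A * Y) %/ q * q)%N%:R)); last by rewrite ler_nat leq_trunc_div.
  rewrite natrM -sqK expr2 mulrCA; apply: ler_wpM2l => //.
  rewrite ler_pM2r //; apply: le_trans sq_lo; rewrite ler_nat leq_pexp2l //.
  exact: leq_trans r8.
have c3 : (g ^ 6)%N%:R * (E%:R * sq) <= (3 * (A * Y))%N%:R.
  rewrite /E -(addn1 (_ %/ _)) natrD mulrDl mul1r mulrDr.
  have -> : (3 * (A * Y) = A * Y + 2 * (A * Y))%N by rewrite -mulSn.
  by rewrite natrD lerD.
pose P' := (h ^ n * 4 ^ r * D * W)%N.
have c4 : (2 * P' * E)%N%:R * sq <= (cA * Y)%N%:R.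
  rewrite -(@ler_pM2l _ (3 * (2 * D ^ 2))%N%:R); last by rewrite ltr0n !muln_gt0 D0.
  apply: (@le_trans _ _ ((3 * (A * Y))%N%:R)); last first.
    rewrite -natrM ler_nat -!mulnA leq_mul2l /=.
    by have := coprime_count_lower; rewrite -(leq_pmul2r Y0) !mulnA.
  apply: le_trans c3; rewrite mulrA -natrM mulrA -natrM ler_pM2r // ler_nat.
  rewrite !mulnA leq_mul2r; apply/orP; right; apply: leq_trans D_le.
  by apply: eq_leq; rewrite /P' /W -/n; ring.
have c5 : (2 * (h ^ n * (2 ^ n * (2 * (A * g)) ^ n)) <= Y ^ n)%N.
  apply: (@leq_trans (2 ^ n * (h ^ n * (2 ^ n * (2 * (A * g)) ^ n)))).
    by rewrite leq_mul2r; apply/orP; right; rewrite -{1}[2%N]expn1 leq_pexp2l.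
  rewrite -!expnMn leq_exp2r //; apply: leq_trans Ag.
  have -> : (2 * (h * (2 * (2 * (A * g)))) = 8 * h * (A * g))%N by clear; lia.
  by rewrite -mulnn [X in (_ <= X)%N]mulnCA leq_mul2r h_le orbT.
have G0 : 0 < ((cA * g)%N%:R : algC) by rewrite ltr0n muln_gt0 cA0.
rewrite -(@ler_pXn2r _ n) ?nnegrE ?mulr_ge0 // exprMn.
rewrite -(@ler_pM2l _ (2%:R * (cA * g)%N%:R ^+ n)) ?mulr_gt0 ?exprn_gt0 //.
have -> : 2%:R * (cA * g)%N%:R ^+ n * (h%:R ^+ n * S ^+ n) =
   2%:R * h%:R ^+ n * ((cA * g)%N%:R ^+ n * S ^+ n) :> algC by ring.
apply: le_trans (ler_wpM2l _ avg) _; first by rewrite mulr_ge0 ?exprn_ge0.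
have nE : n = (r.-1 * 2).+2 by rewrite /n; move: r0; generalize r => u; clear; lia.
have four : (4 ^ r)%N%:R = 2%:R ^+ n :> algC by rewrite -natrX /n addnn -mul2n expnM.
have -> : 2%:R * h%:R ^+ n * (2%:R ^+ n * ((cA * Y)%N%:R ^+ (r.-1 * 2) * (cA * Y * E * D)%N%:R *
     ((g ^ n * W)%N%:R * sq) + (cA * g * (2 * (A * g)))%N%:R ^+ n)) =
   (cA * Y)%N%:R ^+ (r.-1 * 2).+1 * g%:R ^+ n * ((2 * P' * E)%N%:R * sq) +
   (cA * g)%N%:R ^+ n * (2 * (h ^ n * (2 ^ n * (2 * (A * g)) ^ n)))%N%:R :> algC.
  rewrite /P' !natrM four !natrX exprS !natrM !exprMn; ring.
(* The target is doubled and written as a sum of two equal halves: [c4] places the moment term below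
   one, [c5] the shift error below the other. *)
have -> : 2%:R * (cA * g)%N%:R ^+ n * Y%:R ^+ n =
   (cA * Y)%N%:R ^+ (r.-1 * 2).+1 * g%:R ^+ n * (cA * Y)%N%:R + (cA * g)%N%:R ^+ n * Y%:R ^+ n :> algC.
  have -> : (cA * Y)%N%:R ^+ (r.-1 * 2).+1 * g%:R ^+ n * (cA * Y)%N%:R =
     (cA * Y)%N%:R ^+ n * g%:R ^+ n :> algC 
    by rewrite mulrAC -exprSr -nE.
  by rewrite !natrM !exprMn; ring.
apply: lerD.
  by apply: ler_wpM2l c4; rewrite mulr_ge0 ?exprn_ge0.
by apply: ler_wpM2l; rewrite ?exprn_ge0 // -natrX ler_nat.
Qed.
End BurgessCore.

(* The saving is stated through an integer [h] in place of a power of the modulus. *)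
Lemma burgess_primitive k : (0 < k)%N -> exists K F0, (0 < K)%N /\ forall q chi Y h,
  (F0 <= q)%N -> (1 < q)%N -> (forall p, prime p -> ~~ (p ^ 3 %| q)%N) -> dchar q chi ->
  primitive q chi -> (q ^ (k + 4) <= Y ^ (4 * k))%N -> (h ^ K <= q)%N ->
  h%:R * `|char_sum chi Y| <= Y%:R.
Proof.
(* This choice gives [r = 2 ^ s] both [8 <= r] and [2 * k <= r]. *)
move=> k0; pose s := (2 * k + 3)%N; have [r rE] : exists r, (r = 2 ^ s)%N by exists (2 ^ s)%N.
have sr : (s < r)%N by rewrite rE; apply: ltn_expl.
have r8 : (8 <= r)%N by rewrite rE -[8%N]/(2 ^ 3)%N leq_exp2l // /s; clear; lia.
have rk : (2 * k <= r)%N by move: sr; rewrite /s; clear; lia.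
have [c cE] : exists c, c = (4 ^ r * (12 * (r ^ (r + r) * 2 ^ r + (r + r) * 2 ^ (r + r).-1)))%N by exists (4 ^ r * (12 * (r ^ (r + r) * 2 ^ r + (r + r) * 2 ^ (r + r).-1)))%N.
(* Large enough for the total exponent [4 * r + 2] of [D] in the hypothesis [D_le] of the core
   bound. *)
pose e := (4 * r + 3)%N.
have [C C0 HC] := uniform_divisor_bound (e * (16 * r)).
pose G0 := (128 + c + 2 * C)%N.
exists (4 * r * (r + r))%N, ((2 * G0) ^ (r + r))%N; split; first by rewrite !muln_gt0; clear -r8; lia.
move=> q chi Y h F0q q1 cf chiP prim Yk hK; have q0 := ltnW q1.
have hq : (h <= q)%N.
  have [->//|h0] := posnP h; apply: leq_trans hK.
  by rewrite -{1}[h]expn1 leq_pexp2l // !muln_gt0; clear -r8; lia.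
(* For [Y] beyond [q ^ 2] the bound of the sum by [q] suffices, as [h <= q]. *)
have [Yq|qY] := leqP Y (q ^ 2); last first.
  have chiN : nonprincipal q chi.
    have [b [cb _ bN]] := prim _ (pdiv_prime q1) (pdiv_dvd q).
    by exists b.
  apply: (@le_trans _ _ (q%:R * q%:R)); last by rewrite -natrM ler_nat mulnn ltnW.
  by rewrite ler_pM ?ler_nat // (char_sum_le_modulus q0 chiP).
have rr0 : (0 < r + r)%N by rewrite addn_gt0 (leq_trans _ r8).
have [g [g0 g_le g_lt]] := exists_root rr0 q0.
have gG : (G0 < g)%N.
  by rewrite -(ltn_pmul2l (isT : 0 < 2)%N) -(ltn_exp2r _ _ rr0) (leq_ltn_trans F0q).
have q40 : (0 < q ^ 4)%N by rewrite expn_gt0 q0.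
have [D [D0 DC D_ge]] := HC _ q40.
have De : (D ^ e <= g)%N.
  have r16 : (0 < 16 * r)%N by clear -r8; lia.
  rewrite -(leq_exp2r _ _ r16).
  rewrite -expnM; apply: leq_trans DC _.
  apply: (@leq_trans (C * ((2 * g) ^ (r + r)) ^ 4)).
    by rewrite leq_mul2l leq_exp2r // ltnW ?orbT.
  have -> : (((2 * g) ^ (r + r)) ^ 4 = (2 * g) ^ (8 * r))%N by rewrite -expnM; congr (_ ^ _)%N; clear; lia.
  have -> : (g ^ (16 * r) = g ^ (8 * r) * g ^ (8 * r))%N by rewrite -expnD; congr (_ ^ _)%N; clear; lia.
  rewrite expnMn mulnA leq_mul2r; apply/orP; right.
  apply: (@leq_trans ((C * 2) ^ (8 * r))); last by rewrite leq_exp2r; [by move: gG; rewrite /G0; clear; lia | by clear -r8; lia].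
  rewrite expnMn leq_mul2r; apply/orP; right; rewrite -{1}[C]expn1 leq_pexp2l //; clear -r8; lia.
have hg : ((h ^ (r + r)) ^ 2 <= 2 * g)%N.
  rewrite -(leq_exp2r _ _ rr0).
  rewrite -!expnM; apply: leq_trans (ltnW g_lt); apply: leq_trans hK.
  by apply: eq_leq; congr (_ ^ _)%N; clear; lia.
have hg1 : (h ^ (r + r) <= g)%N.
  rewrite leqNgt; apply/negP => lt_g; move: hg; apply/negP; rewrite -ltnNge -mulnn.
  by move: gG lt_g; rewrite /G0; generalize (h ^ (r + r))%N => u; clear; nia.
have hg8 : (8 * h <= g)%N.
  have h2 : (h <= h ^ (r + r))%N.
    have [->//|h0] := posnP h; by rewrite -{1}[h]expn1 leq_pexp2l.
  by move: hg h2 gG; rewrite -mulnn /G0; generalize (h ^ (r + r))%N => u; clear; nia.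
apply: (@burgess_core q chi s k g h D Y); rewrite -?rE //.
apply: (@leq_trans (g * (c * D ^ e))); last first.
  apply: (@leq_trans (g * (g * g))).
    by rewrite leq_mul2l; apply/orP; right; apply: leq_mul => //; move: gG; rewrite /G0; lia.
  by rewrite mulnn -expnS leq_pexp2l.
apply: leq_mul => //; rewrite cE -!mulnA leq_mul2l; apply/orP; right.
have rrE : (r + r = (r + r).-1.+1)%N by rewrite prednK.
have eE : (D ^ e = D ^ 3 * (D ^ (r + r) * D ^ (r + r)))%N by rewrite -!expnD; congr (_ ^ _)%N; rewrite /e; clear; lia.
rewrite expnMn; set m := (r + r).-1 in rrE *.
have Dm : (D ^ m <= D ^ (r + r))%N by rewrite leq_pexp2l // [X in (_ <= X)%N]rrE.
have D1 : (1 <= D ^ (r + r) * D ^ (r + r))%N by rewrite muln_gt0 expn_gt0 D0.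
rewrite eE.

have -> : (6 * (2 * (D * (D * (D * (r ^ (r + r) * 2 ^ r + (r + r) * (D ^ (r + r) * (2 ^ m * D ^ m))))))) =
  12 * (r ^ (r + r) * 2 ^ r * D ^ 3 + (r + r) * 2 ^ m * D ^ 3 * (D ^ (r + r) * D ^ m)))%N.
  by rewrite !expnS expn0 muln1; clear; lia.
have -> : (12 * ((r ^ (r + r) * 2 ^ r + (r + r) * 2 ^ m) * (D ^ 3 * (D ^ (r + r) * D ^ (r + r)))) =
  12 * (r ^ (r + r) * 2 ^ r * D ^ 3 * (D ^ (r + r) * D ^ (r + r)) +
    (r + r) * 2 ^ m * D ^ 3 * (D ^ (r + r) * D ^ (r + r))))%N by clear; lia.
rewrite leq_mul2l /=; apply: leq_add; first by rewrite leq_pmulr.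
by rewrite leq_mul2l leq_mul2l Dm !orbT.
Qed.

(** * From primitive to arbitrary nonprincipal characters *)

Definition cube_free_nat q := forall p, prime p -> ~~ (p ^ 3 %| q)%N.

(** Being trivial on the units that are 1 modulo [q / p], [chi] depends on units only modulo
    [q / p]. If [p] still divides [q / p], the same function serves; otherwise it vanishes at
    multiples of [p], and the component [dchar_l] extends it there. *)
Lemma nonprimitive_descent q chi : (0 < q)%N -> dchar q chi -> ~ primitive q chi ->
  exists p chi', [/\ prime p, (p %| q)%N, dchar (q %/ p) chi' & forall n, coprime n q -> chi n = chi' n].
Proof.
move=> q0 chiP nprim.
have [p [p_pr pq triv]] : exists p, [/\ prime p, (p %| q)%N &
    forall n, coprime n q -> n = 1 %[mod q %/ p] -> chi n = 1].
  have [/hasP[p]|/hasPn H] := boolP (has (fun p => [forall n : 'I_q,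
      coprime n q ==> (n == 1 %[mod q %/ p]) ==> (chi n == 1)]) (primes q)).
    rewrite mem_primes => /and3P[p_pr _ pq] /forallP H; exists p; split=> // n cn n1.
    have := H (Ordinal (ltn_pmod n q0)); rewrite /= coprime_modl cn /= modn_dvdm; last first.
      by rewrite -{2}(divnK pq) dvdn_mulr.
    by rewrite n1 eqxx /= => /eqP <-; apply/(dchar_mod chiP); rewrite modn_mod.
  case: nprim => p p_pr pq; have := H p; rewrite mem_primes p_pr q0 pq => /(_ isT).
  rewrite negb_forall => /existsP[n]; rewrite !negb_imply => /and3P[cn /eqP n1 nN].
  by exists n.
set q' := (q %/ p)%N; have qE : q = (q' * p)%N by rewrite /q' divnK.
have q'0 : (0 < q')%N by move: q0; rewrite qE muln_gt0 => /andP[].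
have eqmod a b : coprime a q -> coprime b q -> a = b %[mod q'] -> chi a = chi b.
  move=> ca cb ab; pose c := (b ^ (totient q).-1)%N.
  have bc : (b * c = 1 %[mod q])%N by apply: inv_mod.
  have cc : coprime c q by rewrite coprimeXl.
  have c0 : chi c != 0 by rewrite (dchar_neq0 chiP).
  apply: (mulIf c0); rewrite -!(dcharM chiP) (dchar_mod chiP bc) (dchar1 chiP).
  have red x y : x = y %[mod q] -> x = y %[mod q'].
    by move=> xy; rewrite -(modn_dvdm x (_ : q' %| q)%N) ?xy ?modn_dvdm // qE dvdn_mulr.
  by apply: triv; rewrite ?coprimeMl ?ca // -modnMml ab modnMml; apply: red.
have [pq'|pq'] := boolP (p %| q')%N.
  have copE n : coprime n q = coprime n q'.
    rewrite qE coprimeMr andbC; case: (boolP (coprime n q')) => [cn|]; last by rewrite andbF.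
    by rewrite (coprime_dvdr pq' cn).
  exists p, chi; split=> //; case: (chiP) => h1 hM _ h0; split=> // n; last by rewrite h0 copE.
  case: (boolP (coprime n q)) => [cn|cn]; last first.
    by rewrite !(dchar_eq0 chiP) // copE -/q' ?coprime_modl -?copE.
  by apply: eqmod; rewrite ?modn_mod // copE coprime_modl -copE.
have cop : coprime q' p by rewrite coprime_sym prime_coprime.
have chiP' : dchar (q' * p) chi by rewrite -qE.
exists p, (dchar_l q' p chi); split=> //; first exact: dchar_lP.
move=> n cn; apply: eqmod => //; last by rewrite chinese_modl.
move: cn; rewrite qE !coprimeMr => /andP[cn _].
rewrite -coprime_modl chinese_modl // coprime_modl cn.
by rewrite -coprime_modl chinese_modr // coprime_modl coprime1n.
Qed.

Lemma nonprincipal_gt1 q chi : (0 < q)%N -> dchar q chi -> nonprincipal q chi -> (1 < q)%N.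
Proof.
move=> q0 chiP [b cb]; rewrite ltn_neqAle q0 andbT; apply: contra_neq => q1.
by rewrite -(dchar1 chiP); apply: (dchar_mod chiP); rewrite -q1 !modn1.
Qed.

Lemma inducing_character q chi : (0 < q)%N -> dchar q chi -> nonprincipal q chi ->
  exists f chi', [/\ (f %| q)%N, (1 < f)%N, dchar f chi', primitive f chi' &
    forall n, coprime n q -> chi n = chi' n].
Proof.
elim/ltn_ind: q chi => q IH chi q0 chiP chiN.
have q1 := nonprincipal_gt1 q0 chiP chiN.
have [prim|nprim] := boolp.pselect (primitive q chi); first by exists q, chi.
have [p [chi' [p_pr pq chiP' chiE]]] := nonprimitive_descent q0 chiP nprim.
have copE n : coprime n q -> coprime n (q %/ p) by apply: coprime_dvdr; rewrite -{2}(divnK pq) dvdn_mulr.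
have q'0 : (0 < q %/ p)%N by rewrite divn_gt0 ?prime_gt0 // dvdn_leq.
have lt_q' : (q %/ p < q)%N by rewrite ltn_Pdiv // prime_gt1.
have chiN' : nonprincipal (q %/ p) chi' by case: chiN => b cb bN; exists b; rewrite ?copE // -chiE.
have [f [psi [fq f1 psiP psiPr psiE]]] := IH _ lt_q' chi' q'0 chiP' chiN'.
exists f, psi; split=> // [|n cn]; last by rewrite chiE // psiE // copE.
by apply: dvdn_trans fq _; rewrite -{2}(divnK pq) dvdn_mulr.
Qed.

(** Each sieving prime replaces a sum by two, the second one shorter and with a coefficient of
    modulus at most 1. *)
Lemma norm_sieve_le (f : nat -> algC) l X M : (forall m n, f (m * n)%N = f m * f n) ->
  (forall n, `|f n| <= 1) -> uniq l -> all prime l ->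
  (forall Y, (Y <= X)%N -> `|char_sum f Y| <= M) -> `|sieve f l X| <= (2 ^ size l)%N%:R * M.
Proof.
move=> fM f1; elim: l X => [|p l IHl] X /=.
  by move=> _ _ /(_ X (leqnn X)); rewrite mul1r.
move=> /andP[pl l_uniq] /andP[p_pr l_pr] H; rewrite sieve_cons // expnS mul2n -addnn natrD mulrDl.
apply: le_trans (ler_normB _ _) (lerD _ _); first exact: IHl.
rewrite normrM; apply: (@le_trans _ _ `|sieve f l (X %/ p)|).
  by rewrite -[X in _ <= X]mul1r ler_wpM2r.
apply: IHl => // Y le_Y; apply: H; exact: leq_trans le_Y (leq_div _ _).
Qed.

(** The inducing character [psi] has conductor [f], and coprimality to [q] costs the sieve factor
    [t], hence [H = t * h]. If [f ^ 8 <= q], the bound by [f] suffices; otherwise a long sum falls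
    under the primitive case and a short one is bounded by its length. The exponent [k + 8] leaves
    [q ^ 4] to absorb [H ^ (4 * k)] in the last case. *)
Lemma burgess k : (0 < k)%N -> exists K F0, (0 < K)%N /\ forall q chi X h,
  (F0 <= q)%N -> (0 < q)%N -> cube_free_nat q -> dchar q chi -> nonprincipal q chi ->
  (q ^ (k + 8) <= X ^ (4 * k))%N -> (h ^ K <= q)%N ->
  h%:R * `|char_sum chi X| <= X%:R.
Proof.
move=> k0; have [K0 [F0 [K00 HF]]] := burgess_primitive k0.
have [e eE] : exists e, e = (8 * K0 * k)%N by exists (8 * K0 * k)%N.
have e0 : (0 < e)%N by rewrite eE !muln_gt0 K00.
have [C C0 HC] := uniform_divisor_bound (4 * e).
exists (4 * e)%N, (F0 ^ 8 + C)%N; split; first by rewrite muln_gt0.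
move=> q chi X h Fq q0 cf chiP chiN Xk hK.
have [->|h0] := posnP h; first by rewrite mul0r.
have [f [psi [fq f1 psiP psiPr psiE]]] := inducing_character q0 chiP chiN.
have f0 := ltnW f1; have fleq := dvdn_leq q0 fq.
set t := (2 ^ size (primes q))%N; have t0 : (0 < t)%N by rewrite expn_gt0.
have [D [D0 DC D_ge]] := HC q q0.
have tD : (t <= D)%N by apply: leq_trans (exp2_omega_le q0) (D_ge _ _).
set H := (t * h)%N; have H0 : (0 < H)%N by rewrite muln_gt0 t0.
have He : (H ^ e <= q)%N.
  rewrite -(leq_exp2r _ _ (isT : 0 < 4)%N) -expnM (mulnC e) expnMn.
  apply: (@leq_trans ((C * q) * q)).
    by apply: leq_mul => //; apply: leq_trans DC; rewrite leq_exp2r // muln_gt0.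
  rewrite (expnD q 2 2) -mulnA mulnn; apply: leq_mul => //.
  by rewrite -mulnn; apply: leq_trans (leq_addl (F0 ^ 8) C) _; apply: leq_trans Fq _; rewrite leq_pmulr.
have Hle a : (a <= e)%N -> (H ^ a <= q)%N by move=> ae; apply: leq_trans He; rewrite leq_pexp2l.
have psi_le Y : (Y <= X)%N -> H%:R * `|char_sum psi Y| <= X%:R.
  move=> YX; have [f8|f8] := leqP (f ^ 8) q.
    apply: (@le_trans _ _ (H%:R * f%:R)).
      rewrite ler_wpM2l //; apply: (char_sum_le_modulus f0 psiP Y f1).
      by have [b [cb _ bN]] := psiPr _ (pdiv_prime f1) (pdiv_dvd f); exists b.
    rewrite -natrM ler_nat -(leq_exp2r _ _ (isT : 0 < 8)%N) expnMn.
    apply: (@leq_trans (q * q)).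
      by apply: leq_mul => //; apply: Hle; rewrite eE -mulnA leq_pmulr // muln_gt0 K00.
    have X4 : (q <= X ^ 4)%N.
      rewrite -(leq_exp2r _ _ k0) -expnM; apply: leq_trans Xk.
      by rewrite leq_pexp2l // leq_addr.
    by rewrite (expnD X 4 4); apply: leq_mul.
  have [YF|YF] := leqP (f ^ (k + 4)) (Y ^ (4 * k)).
    apply: (@le_trans _ _ Y%:R); last by rewrite ler_nat.
    apply: (HF f psi Y H) => // [|p p_pr|].
    - rewrite leqNgt; apply/negP => lt_f; move: f8; apply/negP; rewrite -leqNgt.
      apply: leq_trans Fq; apply: leq_trans (leq_addr _ _); by rewrite leq_exp2r // ltnW.
    - by apply: contra (cf p p_pr) => /dvdn_trans; apply.
    rewrite leqNgt; apply/negP => lt_f; move: f8; apply/negP; rewrite -leqNgt.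
    apply: (@leq_trans ((H ^ K0) ^ 8)); first by rewrite leq_exp2r // ltnW.
    by rewrite -expnM; apply: Hle; rewrite eE mulnC leq_pmulr.
  apply: (@le_trans _ _ (H%:R * Y%:R)).
    rewrite ler_wpM2l //; apply: le_trans (ler_norm_sum _ _ _) _.
    apply: (@le_trans _ _ (\sum_(1 <= i < Y.+1) 1)).
      by apply: ler_sum => i _; exact: (dchar_norm_le1 psiP).
    by rewrite sumr_const_nat subn1.
  have k40 : (0 < 4 * k)%N by rewrite muln_gt0.
  rewrite -natrM ler_nat -(leq_exp2r _ _ k40) expnMn; apply: leq_trans Xk.
  rewrite mulnC (_ : k + 8 = (k + 4) + 4)%N ?(expnD q (k + 4)); last by clear; lia.
  apply: leq_mul.
    by apply: leq_trans (ltnW YF) _; rewrite leq_exp2r // addnS.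
  rewrite mulnC expnM leq_exp2r //; apply: Hle.
  by rewrite eE leq_pmull // muln_gt0 K00.
have -> : char_sum chi X = sieve psi (primes q) X.
  rewrite sieve_coprime // /char_sum (bigID (fun n => coprime n q)) /=.
  rewrite [X in _ + X]big1 ?addr0 => [|n cn]; last exact: (dchar_eq0 chiP).
  by apply: eq_bigr => n cn; exact: psiE.
rewrite -(@ler_pM2l _ t%:R) ?ltr0n // mulrA -natrM -/H.
have H0' : 0 < (H%:R : algC) by rewrite ltr0n.
have := @norm_sieve_le psi (primes q) X (X%:R / H%:R) (dcharM psiP) (dchar_norm_le1 psiP) (primes_uniq q).
move=> Hs; rewrite mulrC -ler_pdivlMr // -mulrA; apply: Hs.
  by apply/allP => p; rewrite mem_primes => /andP[].
by move=> Y YX; rewrite ler_pdivlMr // mulrC psi_le.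
Qed.

(** * The mean value theorem for products of character sums *)

Section MeanValue.
Variables (q : nat) (q1 : (1 < q)%N) (J : finType) (M : nat) (L : J -> nat) (w : J -> nat -> algC).
Variables (T : nat).
Hypothesis w_le1 : forall j n, `|w j n| <= 1.
Hypothesis w_supp : forall j n, w j n != 0 -> (0 < n <= L j)%N.
Hypothesis L_lt : forall j, (L j < M)%N.
Let Y := (\prod_j L j)%N.
Hypothesis fiberT : forall n, (0 < n <= Y)%N -> (num_divisors n ^ #|J| <= T)%N.

Definition weight_product (f : {ffun J -> 'I_M}) := \prod_j w j (f j).
Definition residue_weight a := \sum_(f : {ffun J -> 'I_M} | \prod_j f j == a %[mod q]) weight_product f.

Lemma residue_weight_sum chi : dchar q chi ->
  \sum_(a < q) residue_weight a * chi a = \prod_j \sum_(n < M) w j n * chi n.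
Proof.
move=> chiP; rewrite bigA_distr_bigA /=.
pose r (f : {ffun J -> 'I_M}) : 'I_q := Ordinal (ltn_pmod (\prod_j f j)%N (ltnW q1)).
rewrite [RHS](partition_big r xpredT) //=; apply: eq_bigr => a _.
rewrite mulr_suml; apply: eq_big => [f|f].
  by rewrite -(inj_eq val_inj) /= [X in _ == X]modn_small.
by move=> /eqP fa; rewrite big_split /= -(dchar_prod chiP) (dchar_mod chiP fa).
Qed.

Let supp : pred {ffun J -> 'I_M} := [pred f : {ffun J -> 'I_M} | [forall j, (0 < f j <= L j)%N]].

Lemma card_supp : #|[set f | supp f]| = Y.
Proof.
pose F j : pred 'I_M := [pred x : 'I_M | (0 < x <= L j)%N].
rewrite (eq_card (B := family F)) => [|f]; last first.
  by rewrite inE; apply/forallP/familyP => H j; have := H j; rewrite inE.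
rewrite card_family; rewrite /Y foldrE big_map big_enum /=; apply: eq_bigr => j _.
rewrite -sum1_card (eq_bigl (fun x : 'I_M => (0 < x <= L j)%N)) //.
rewrite -(big_mkord (fun x => 0 < x <= L j)%N (fun=> 1%N)).
rewrite (@big_cat_nat _ _ _ (L j).+1) //= -[RHS]addn0; congr (_ + _)%N; last first.
  rewrite big_nat_cond big_pred0 // => i; apply/negP => /andP[/andP[lt1 _] /andP[_ le1]].
  by rewrite ltnNge le1 in lt1.
rewrite big_ltn_cond //= big_nat_cond (eq_bigl (fun i => (1 <= i < (L j).+1) && true)%N).
  by rewrite -big_nat_cond sum_nat_const_nat subn1 muln1.
by move=> i; rewrite ltnS andbT andbb.
Qed.

Lemma weight_product_le f : `|weight_product f| <= (supp f)%:R.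
Proof.
rewrite /weight_product normr_prod; case: (boolP (supp f)) => [_|].
  by apply: prodr_ile1 => j _; rewrite normr_ge0 w_le1.
rewrite negb_forall => /existsP[j fj]; rewrite (bigD1 j) //=.
suff -> : w j (f j) = 0 by rewrite normr0 mul0r.
by apply/eqP/negPn; apply: contra fj => /w_supp.
Qed.

(** Parseval leaves the second moment of the residue weights. For [q <= Y] a residue class is
    represented at most [2 * Y * T / q] times, and the total number of tuples is [Y]. *)
Lemma mean_value : (q <= Y)%N ->
  \sum_(i : dirichlet_index q) `|\prod_j \sum_(n < M) w j n * dirichlet i n| ^+ 2 <=
  (2 * T * Y ^ 2)%N%:R * (totient q)%:R / q%:R.
Proof.
move=> qY; have q0 := ltnW q1; have q0' : 0 < (q%:R : algC) by rewrite ltr0n.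
under eq_bigr => i _ do rewrite -(residue_weight_sum (dirichlet_dchar q1 i)).
rewrite (dirichlet_parseval q1) [X in _ <= X]mulrAC [X in _ <= X]mulrC; apply: ler_wpM2l; first by rewrite ler0n.
pose N1 (a : nat) := #|[set f | supp f && (\prod_j f j == a %[mod q])%N]|.
have wN a : `|residue_weight a| <= (N1 a)%:R.
  apply: le_trans (ler_norm_sum _ _ _) _.
  apply: (@le_trans _ _ (\sum_(f : {ffun J -> 'I_M} | \prod_j f j == a %[mod q]) (supp f)%:R)).
    by apply: ler_sum => f _; exact: weight_product_le.
  rewrite -natr_sum ler_nat /N1 -sum1_card [X in (X <= _)%N]big_mkcond [X in (_ <= X)%N]big_mkcond /=.
  by apply: leq_sum => f _; rewrite inE; case: (supp f); case: (_ == _ %[mod q]).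
have N1T a : (N1 a <= (Y %/ q).+1 * T)%N.
  apply: (card_congruent (v := fun f : {ffun J -> 'I_M} => \prod_j f j)%N) => //.
    by move=> f /forallP H; apply: leq_prod => j _; have /andP[] := H j.
  move=> n nY; have [n0|n0] := posnP n.
    rewrite (eq_card0 (A := [set _ | _])) // => f; rewrite !inE; apply/negP => /andP[/forallP H].
    rewrite n0 -leqn0 leqNgt prodn_gt0 // => j; by have /andP[] := H j.
  have nT : (0 < n <= Y)%N by rewrite n0.
  apply: leq_trans (fiberT nT).
  apply: leq_trans (card_product_fiber J M n0); apply/subset_leq_card/subsetP => f.
  by rewrite !inE => /andP[].
have sumN : (\sum_(a < q) N1 a = Y)%N.
  rewrite -card_supp -sum1_card.
  pose r (f : {ffun J -> 'I_M}) : 'I_q := Ordinal (ltn_pmod (\prod_j f j)%N q0).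
  rewrite [RHS](partition_big r xpredT) //=; apply: eq_bigr => a _.
  rewrite /N1 -sum1_card; apply: eq_bigl => f; rewrite !inE; congr (_ && _).
  by rewrite -(inj_eq val_inj) /= [X in _ == X]modn_small.
rewrite ler_pdivlMr //.
apply: (@le_trans _ _ ((\sum_(a < q) (N1 a * ((Y %/ q).+1 * T))%N%:R) * q%:R)).
  rewrite ler_pM2r // [X in X <= _]big_mkcond; apply: ler_sum => a _; case: ifP => _; last by rewrite ler0n.
  apply: (@le_trans _ _ ((N1 a)%:R ^+ 2)).
    by rewrite lerXn2r ?nnegrE ?ler0n.
  by rewrite -natrX ler_nat -mulnn leq_mul2l N1T orbT.
rewrite -natr_sum -natrM ler_nat -big_distrl /= sumN.
have : ((Y %/ q).+1 * q <= 2 * Y)%N.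
  by rewrite mulSn mul2n -addnn; apply: leq_add => //; exact: leq_trunc_div.
move: (_ %/ _).+1 => E le.
have -> : (Y * (E * T) * q = (E * q) * (Y * T))%N by ring.
have -> : (2 * T * Y ^ 2 = 2 * Y * (Y * T))%N by ring.
by rewrite leq_mul2r le orbT.
Qed.
End MeanValue.

(** * The exceptional set *)

Local Open Scope nat_scope.

Lemma leq_totient n : totient n <= n.
Proof.
rewrite totient_count_coprime big_mkord -[X in _ <= X]card_ord -sum1_card.
by apply: leq_sum => i _; exact: leq_b1.
Qed.

Definition smooth N n := all (fun p => p <= N) (primes n).

Lemma divisor_le_max n N : 0 < n -> 0 < N -> exists d,
  [/\ d %| n, d <= N & forall e, e %| n -> e <= N -> e <= d].
Proof.
move=> n0 N0; have ex : exists d, (d %| n) && (d <= N) by exists 1; rewrite dvd1n.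
have bnd d : (d %| n) && (d <= N) -> d <= N by case/andP.
case: (ex_maxnP ex bnd) => d /andP[dn dN] dmax; exists d; split=> // e en eN.
by apply: dmax; rewrite en.
Qed.

(* If [w1] is the largest divisor of [n] below [N] and [w2] that of [n / w1], then a prime [p] of the
   remaining cofactor [w3] satisfies [w2 * p > N] and [p <= w1], so that [w3 <= n / (w1 * w2) < N]. *)
Lemma smooth_three_factors N n : 0 < N -> 0 < n -> n <= N ^ 2 -> smooth N n ->
  exists w1 w2 w3, [/\ n = w1 * w2 * w3, 0 < w1 <= N, 0 < w2 <= N & 0 < w3 <= N].
Proof.
move=> N0 n0 nN sm; have [w1 [w1n w1N w1max]] := divisor_le_max n0 N0.
have [v nE] := dvdnP w1n; have v0 : 0 < v by move: n0; rewrite nE muln_gt0 => /andP[].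
have w10 : 0 < w1 by move: n0; rewrite nE muln_gt0 => /andP[].
have [w2 [w2v w2N w2max]] := divisor_le_max v0 N0.
have [w3 vE] := dvdnP w2v; have w30 : 0 < w3 by move: v0; rewrite vE muln_gt0 => /andP[].
have w20 : 0 < w2 by move: v0; rewrite vE muln_gt0 => /andP[].
have nE' : n = w1 * w2 * w3 by rewrite nE vE -mulnA [w3 * _]mulnC mulnC [w2 * _]mulnC; lia.
exists w1, w2, w3; split=> //; rewrite ?w10 ?w20 ?w30 //=.
have [w31|w31] := leqP w3 1; first exact: leq_trans w31 N0.
have p_pr := pdiv_prime w31; have pw3 := pdiv_dvd w3; set p := pdiv w3 in p_pr pw3.
have pN : p <= N.
  by apply: (allP sm); rewrite mem_primes p_pr n0 nE' dvdn_mull.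
have pw1 : p <= w1 by apply: w1max; rewrite // nE' dvdn_mull.
have w2p : N < w2 * p.
  rewrite ltnNge; apply/negP => le; have := w2max (w2 * p).
  rewrite vE [w3 * _]mulnC dvdn_pmul2l // pw3 le => /(_ isT isT).
  by rewrite -{2}[w2]muln1 leq_pmul2l // leqNgt prime_gt1.
have N12 : N < w1 * w2 by apply: leq_trans w2p _; rewrite mulnC leq_mul2r pw1 orbT.
rewrite leqNgt; apply/negP => lt; move: nN; rewrite nE' leqNgt -mulnn => /negP; apply.
exact: ltn_mul.
Qed.

Definition seven_product N q a := exists n : 'I_7 -> nat,
  \prod_i n i = a %[mod q] /\ forall i, 1 <= n i <= N.

(** As long as some factor has room, it takes the next [z]. Were none to have room, all seven
    [b i * z0] would exceed [N]; the extra exponent 6, together with one for the current [z],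
    supplies the seven powers of [z0] for the contradiction. *)
Lemma pack_seven N z0 (s : seq nat) (b : 'I_7 -> nat) : 
  (forall i, 1 <= b i <= N) -> (forall z, z \in s -> 1 <= z <= z0) ->
  \prod_i b i * z0 ^ (size s + 6) <= N ^ 7 ->
  exists b' : 'I_7 -> nat, (forall i, 1 <= b' i <= N) /\ \prod_i b' i = \prod_i b i * \prod_(z <- s) z.
Proof.
elim: s b => [|z s IHs] b bN sz le; first by exists b; rewrite big_nil muln1.
have /andP[z1 zz0] := sz z (mem_head _ _).
have [/existsP[i biz]|/existsPn H] := boolP [exists i, b i * z <= N]; last first.
  have: \prod_(i < 7) N.+1 <= \prod_i b i * z0 ^ (size (z :: s) + 6).
    apply: (@leq_trans (\prod_i (b i * z0))).
      apply: leq_prod => i _; have := H i; rewrite -ltnNge => /leq_trans; apply.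
      by rewrite leq_mul2l zz0 orbT.
    rewrite big_split /= prod_nat_const card_ord leq_mul2l; apply/orP; right.
    by rewrite leq_pexp2l ?(leq_trans z1) //= addSn -addnS leq_addl.
  move=> /leq_trans/(_ le); rewrite prod_nat_const card_ord leq_exp2r //.
  by rewrite ltnn.
pose b1 j := if j == i then b i * z else b j.
have prodE : \prod_j b1 j = \prod_j b j * z.
  rewrite [LHS](bigD1 i) // [X in _ = X * _](bigD1 i) //= /b1 eqxx -!mulnA; congr (_ * _).
  by rewrite mulnC; congr (_ * _); apply: eq_bigr => j /negPf->.
have [|y ys||b' [b'N b'E]] := IHs b1.
- move=> j; rewrite /b1; case: eqP => // _; rewrite biz muln_gt0 z1.
  by have /andP[-> _] := bN i.
- by apply: sz; rewrite inE ys orbT.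
- rewrite prodE -mulnA; apply: leq_trans le; rewrite leq_mul2l; apply/orP; right.
  by rewrite /= addSn expnS leq_mul2r zz0 orbT.
by exists b'; split=> //; rewrite b'E prodE big_cons mulnA.
Qed.

Lemma smooth_pair_seven N z0 X u v (s : seq nat) : 0 < N -> 0 < u <= X -> 0 < v <= X -> X <= N ^ 2 ->
  smooth N u -> smooth N v -> (forall z, z \in s -> 1 <= z <= z0) ->
  X ^ 2 * z0 ^ (size s + 6) <= N ^ 7 ->
  exists b : 'I_7 -> nat, (forall i, 1 <= b i <= N) /\ \prod_i b i = u * v * \prod_(z <- s) z.
Proof.
move=> N0 /andP[u0 uX] /andP[v0 vX] XN su sv sz le.
have [u1 [u2 [u3 [uE u1N u2N u3N]]]] := smooth_three_factors N0 u0 (leq_trans uX XN) su.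
have [v1 [v2 [v3 [vE v1N v2N v3N]]]] := smooth_three_factors N0 v0 (leq_trans vX XN) sv.
(* The seventh factor starts at 1 and is filled by the [z] only. *)
pose b (i : 'I_7) := nth 1 [:: u1; u2; u3; v1; v2; v3; 1] i.
have bE : \prod_i b i = u * v.
  by rewrite !big_ord_recl big_ord0 /b /= uE vE; lia.
have bN i : 1 <= b i <= N.
  rewrite /b; case: i => [[|[|[|[|[|[|[|i]]]]]]] /= _] //; by rewrite ?N0 ?andbT ?nth_nil.
have [|b' [b'N b'E]] := @pack_seven N z0 s b bN sz.
  by rewrite bE; apply: leq_trans le; rewrite leq_mul2r -mulnn leq_mul ?orbT.
by exists b'; split=> //; rewrite b'E bE.
Qed.

Local Open Scope ring_scope.

Lemma sum_truncate (R : nmodType) M L (F : nat -> R) : (L < M)%N ->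
  (forall n, ~~ (0 < n <= L)%N -> F n = 0) -> \sum_(n < M) F n = \sum_(1 <= n < L.+1) F n.
Proof.
move=> LM F0; rewrite -(big_mkord xpredT) (@big_cat_nat _ _ _ L.+1) //= [X in _ + X]big_nat.
rewrite [X in _ + X]big1 ?addr0 => [|n /andP[lt _]]; last by rewrite F0 // negb_and -[X in _ || X]ltnNge lt orbT.
by rewrite big_ltn // F0 ?add0r.
Qed.

(** * The variance of the signed count of solutions *)

Section ExceptionalSet.
Variables (q : nat) (q1 : (1 < q)%N) (X N z0 m k tau T : nat).
Hypotheses (N0 : (0 < N)%N) (z00 : (0 < z0)%N) (X_le : (X <= N ^ 2)%N).
Hypothesis pack : (X ^ 2 * z0 ^ (m.+1 + 6) <= N ^ 7)%N.
Hypotheses (q_le1 : (q <= X ^ 2 * z0 ^ m)%N) (q_le2 : (q <= z0 ^ k)%N).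
Hypothesis fiberT1 : forall n, (0 < n <= X ^ 2 * z0 ^ m)%N -> (num_divisors n ^ m.+2 <= T)%N.
Hypothesis fiberT2 : forall n, (0 < n <= z0 ^ k)%N -> (num_divisors n ^ k <= T)%N.
Hypothesis burgess_saving : forall chi, dchar q chi -> nonprincipal q chi ->
  (tau ^ k.+1)%N%:R * `|char_sum chi X| <= X%:R.

Let U n := (0 < n <= X)%N && coprime n q.
Let Z n := (0 < n <= z0)%N && coprime n q.
Let wA n : algC := if U n then (if smooth N n then 1 else -1) else 0.
Let w (j n : nat) : algC := if j == 0%N then wA n else if j == 1%N then (U n)%:R else (Z n)%:R.
Let L (j : nat) := if (j < 2)%N then X else z0.
Let M := (maxn X z0).+1.
Let wc (i : dirichlet_index q) j := \sum_(n < M) w j n * dirichlet i n.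

Local Lemma w_le1 j n : `|w j n| <= 1.
Proof.
rewrite /w /wA; case: ifP => _; [|by case: ifP => _; rewrite normr_nat lern1 leq_b1].
by case: ifP => _; [case: ifP|]; rewrite ?normrN ?normr1 ?normr0.
Qed.

Local Lemma w_supp j n : w j n != 0 -> (0 < n <= L j)%N.
Proof.
rewrite /w /wA /L; case: j => [|[|j]] /=.
- by case: ifP => [/andP[]|]; rewrite ?eqxx.
- by rewrite pnatr_eq0 eqb0 negbK => /andP[].
- by rewrite pnatr_eq0 eqb0 negbK => /andP[].
Qed.

Local Lemma L_lt j : (L j < M)%N.
Proof. by rewrite /L /M ltnS; case: ifP => _; rewrite ?leq_maxl ?leq_maxr. Qed.

Lemma prod_ord_const_tail (R : comPzSemiRingType) (F : nat -> R) n c : (forall j, F j.+2 = c) ->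
  \prod_(j < n.+2) F j = F 0%N * F 1%N * c ^+ n.
Proof.
move=> Fc; rewrite !big_ord_recl /= mulrA; congr (_ * _).
by rewrite (eq_bigr (fun=> c)) ?prodr_const ?card_ord // => j _; exact: Fc.
Qed.

Local Lemma prod_L n : (\prod_(j < n.+2) L j = X ^ 2 * z0 ^ n)%N.
Proof. by rewrite !big_ord_recl /= mulnA mulnn (eq_bigr (fun=> z0)) ?prod_nat_const ?card_ord. Qed.

Local Lemma prod_wc i n : \prod_(j < n.+2) wc i j = wc i 0 * wc i 1 * wc i 2 ^+ n.
Proof. by apply: prod_ord_const_tail => j; rewrite /wc. Qed.

Local Lemma wc_le i j : `|wc i j| <= (L j)%:R.
Proof.
apply: le_trans (ler_norm_sum _ _ _) _.
rewrite (@sum_truncate _ M (L j) (fun n => `|w j n * dirichlet i n|)) ?L_lt // => [|n nL].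
  apply: (@le_trans _ _ (\sum_(1 <= n < (L j).+1) 1)).
    apply: ler_sum => n _; rewrite normrM mulr_ile1 ?normr_ge0 ?w_le1 //.
    exact: (dchar_norm_le1 (dirichlet_dchar q1 i)).
  by rewrite sumr_const_nat subn1.
case: (boolP (w j n == 0)) => [/eqP->|/w_supp nL']; first by rewrite mul0r normr0.
by rewrite nL' in nL.
Qed.

Local Lemma wc1 i : wc i 1 = char_sum (dirichlet i) X.
Proof.
have dc := dirichlet_dchar q1 i.
rewrite /wc (@sum_truncate _ M X (fun n => w 1 n * dirichlet i n)) ?(L_lt 0) // => [|n nX].
  rewrite /char_sum big_nat [RHS]big_nat; apply: eq_bigr => n nX.
  rewrite /w /= /U -ltnS nX /=; case: (boolP (coprime n q)) => cn; first by rewrite mul1r.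
  by rewrite mul0r (dchar_eq0 dc).
by rewrite /w /= /U (negPf nX) mul0r.
Qed.

Let cA := (\sum_(1 <= n < X.+1 | coprime n q) smooth N n)%N.
Let cB := (\sum_(1 <= n < X.+1 | coprime n q) ~~ smooth N n)%N.

Local Lemma wc_principal : [/\ wc 0 0 = cA%:R - cB%:R, wc 0 1 = (coprime_count q X)%:R &
  wc 0 2 = (coprime_count q z0)%:R].
Proof.
have dc := dirichlet_dchar q1 0.
have F j : wc 0 j = \sum_(1 <= n < (L j).+1 | coprime n q) w j n.
  rewrite /wc (@sum_truncate _ M (L j) (fun n => w j n * dirichlet 0 n)) ?L_lt // => [|n nL]; last first.
    case: (boolP (w j n == 0)) => [/eqP->|/w_supp nL']; first by rewrite mul0r.
    by rewrite nL' in nL.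
  rewrite [RHS]big_mkcond; apply: eq_bigr => n _; rewrite (dirichlet0 q1).
  by case: ifP; rewrite ?mulr1 ?mulr0.
have bnd (G H : nat -> algC) Y : (forall n, (0 < n <= Y)%N -> coprime n q -> G n = H n) ->
    \sum_(1 <= n < Y.+1 | coprime n q) G n = \sum_(1 <= n < Y.+1 | coprime n q) H n.
  by move=> GH; apply: congr_big_nat => // n /andP[cn nY]; apply: GH.
split; rewrite F /=.
- rewrite /cA /cB !natr_sum -sumrB; apply: bnd => n nX cn.
  by rewrite /w /wA /U nX cn; case: ifP; rewrite ?subr0 ?sub0r.
- by rewrite /coprime_count natr_sum; apply: bnd => n nX cn; rewrite /w /U nX cn.
- by rewrite /coprime_count natr_sum; apply: bnd => n nX cn; rewrite /w /Z nX cn.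
Qed.

(** There are [m + 1] tiny factors, one more than [q_le1] counts, so that one can be given up in
    [variance_le]. *)
Let J : finType := 'I_m.+1.+2.
Let D := @residue_weight q J M (fun j : J => w j).
Let exceptional : pred 'I_q := [pred a : 'I_q | coprime a q && ~~ boolp.asbool (seven_product N q a)].

Local Lemma D_sum i : \sum_(a < q) D a * dirichlet i a = wc i 0 * wc i 1 * wc i 2 ^+ m.+1.
Proof.
by rewrite (residue_weight_sum q1 M (fun j : J => w j) (dirichlet_dchar q1 i)) prod_wc.
Qed.

Local Lemma D_real a : D a \is Num.real.
Proof.
apply: rpred_sum => f _; apply: rpred_prod => j _.
rewrite /w /wA; do ![case: ifP => _]; by rewrite ?rpredN ?rpred1 ?rpred0 ?realn.
Qed.

(* Swapping the two large factors replaces the sign of the first by the mean of both signs, and this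
   is positive only when both factors are smooth. *)
Local Lemma D_exceptional a : exceptional a -> D a <= 0.
Proof.
move=> /andP[ca /boolp.asboolPn exc].
pose j0 : J := ord0; pose j1 : J := lift ord0 ord0.
pose sw (f : {ffun J -> 'I_M}) : {ffun J -> 'I_M} := [ffun j => f (tperm j0 j1 j)].
have swK : involutive sw by move=> f; apply/ffunP => j; rewrite !ffunE tpermK.
have sw_prod (f : {ffun J -> 'I_M}) : (\prod_j sw f j = \prod_j f j)%N.
  rewrite [RHS](reindex_inj (@perm_inj _ (tperm j0 j1))) /=.
  by apply: eq_bigr => j _; rewrite ffunE.
have tail (f : {ffun J -> 'I_M}) : weight_product (fun j : J => w j) f =
   wA (f j0) * (U (f j1))%:R * \prod_(j < m.+1) ((Z (f (lift ord0 (lift ord0 j))))%:R : algC).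
  by rewrite /weight_product !big_ord_recl mulrA.
have D2 : D a + D a <= 0.
  rewrite {2}/D /residue_weight (reindex_inj (inv_inj swK)) /= (eq_bigl (fun f : {ffun J -> 'I_M} =>
    \prod_j f j == a %[mod q])) => [|f]; last by rewrite sw_prod.
  rewrite /D /residue_weight -big_split /=; apply: sumr_le0 => f /eqP fa.
  rewrite !tail; have -> : sw f j0 = f j1 by rewrite ffunE tpermL.
  have -> : sw f j1 = f j0 by rewrite ffunE tpermR.
  under [X in _ * X + _]eq_bigr => j _ do rewrite ?ffunE.
  have eqj j : sw f (lift ord0 (lift ord0 j)) = f (lift ord0 (lift ord0 j)).
    by rewrite ffunE tpermD.
  under [X in _ + _ * X]eq_bigr => j _ do rewrite eqj.
  case: (boolP [forall j : 'I_m.+1, Z (f (lift ord0 (lift ord0 j)))]) => [/forallP Zf|]; last first.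
    rewrite negb_forall => /existsP[j /negPf Zj].
    by rewrite (bigD1 j) //= Zj mul0r !mulr0 addr0.
  rewrite big1 => [|j _]; last by rewrite Zf.
  rewrite !mulr1 /wA; case: (boolP (U (f j0))) => U0; last by rewrite mul0r mulr0 addr0.
  case: (boolP (U (f j1))) => U1; last by rewrite mul0r mulr0 addr0.
  rewrite !mulr1; case: (boolP (smooth N (f j0))) => s0; case: (boolP (smooth N (f j1))) => s1;
    rewrite ?subrr ?addNr //; last by rewrite -opprD oppr_le0 addr_ge0 ?ler01.
  case: exc; pose s := [seq nat_of_ord (f (lift ord0 (lift ord0 j))) | j : 'I_m.+1].
  have [||||b [bN bE]] := @smooth_pair_seven N z0 X (f j0) (f j1) s N0 _ _ X_le s0 s1.
  - by case/andP: U0.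
  - by case/andP: U1.
  - by move=> z /mapP[j _ ->]; have /andP[] := Zf j.
  - by rewrite size_map size_enum_ord.
  exists b; split=> //; rewrite bE -fa !big_ord_recl mulnA; congr (_ * _ %% _)%N.
  by rewrite big_map big_enum /= big_ord_recl.
rewrite real_leNgt ?D_real ?real0 //; apply/negP => D0.
by move: (lt_le_trans (addr_gt0 D0 D0) D2); rewrite ltxx.
Qed.

Let S := (cA%:R - cB%:R) * (coprime_count q X)%:R * (coprime_count q z0)%:R ^+ m.+1 : algC.
Let V := \sum_(i : dirichlet_index q | i != 0) `|wc i 0 * wc i 1 * wc i 2 ^+ m.+1| ^+ 2.

(** Chebyshev's inequality: over the units [D] has the mean [S / totient q], the nonprincipal
    characters make up its variance, and where [D <= 0] the deviation from a nonnegative mean is at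
    least that mean. *)
Local Lemma exceptional_variance : 0 <= S -> #|exceptional|%:R * S ^+ 2 <= (totient q)%:R * V.
Proof.
move=> S0; have phi0 : 0 <= (totient q)%:R :> algC by rewrite ler0n.
have S_sum : \sum_(a < q | coprime a q) D a = S.
  have [w0 w1 w2] := wc_principal.
  rewrite /S -w0 -w1 -w2 -D_sum big_mkcond; apply: eq_bigr => a _.
  by rewrite (dirichlet0 q1); case: ifP; rewrite ?mulr1 ?mulr0.
have S_real : S \is Num.real by apply: ger0_real.
have VE : V = (totient q)%:R * (\sum_(a < q | coprime a q) D a ^+ 2) - S ^+ 2.
  have := dirichlet_parseval q1 D; rewrite (bigD1 0) //=.
  under [X in _ + X = _]eq_bigr => i _ do rewrite D_sum.
  have [w0 w1 w2] := wc_principal; rewrite D_sum w0 w1 w2 -/S real_normK // -/V.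
  under [X in _ = _ * X -> _]eq_bigr => a _ do rewrite real_normK ?D_real //.
  by move=> <-; rewrite addrC addKr.
have phiE : \sum_(a < q | coprime a q) 1 = (totient q)%:R :> algC.
  by rewrite totient_count_coprime big_mkord natr_sum [LHS]big_mkcond; apply: eq_bigr => a _; rewrite coprime_sym; case: coprime.
have -> : (totient q)%:R * V = \sum_(a < q | coprime a q) ((totient q)%:R * D a - S) ^+ 2.
  rewrite (eq_bigr (fun a : 'I_q => (totient q)%:R ^+ 2 * D a ^+ 2 - 2%:R * (totient q)%:R * S * D a + S ^+ 2 * 1)).
    rewrite big_split sumrB /= -!mulr_sumr S_sum phiE VE; ring.
  by move=> a _; ring.
rewrite (bigID exceptional) /= -[X in X <= _]addr0; apply: lerD; last first.
  apply: sumr_ge0 => a _; rewrite real_exprn_even_ge0 // rpredB // rpredM ?realn ?D_real //.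
rewrite (eq_bigl exceptional) => [|a]; last by rewrite /= andbA andbb.
rewrite mulr_natl -sumr_const; apply: ler_sum => a aE.
have D0 := D_exceptional aE.
have le : S <= S - (totient q)%:R * D a by rewrite lerDl oppr_ge0 mulr_ge0_le0.
by rewrite -[X in _ <= X]sqrrN opprB lerXn2r // nnegrE // (le_trans S0).
Qed.

(* Characters with [|wc i 2|] at most [z0 / tau] lose one small factor; for the others [|wc i 1|] is
   small and the loss is compensated by the rarity of large values of [|wc i 2|]. *)
Local Lemma variance_le : (tau ^ 2)%N%:R * V <= (4 * T * X ^ 4 * z0 ^ (2 * m.+1))%N%:R.
Proof.
have zR : 0 < (z0%:R : algC) by rewrite ltr0n.
have q0R : 0 < (q%:R : algC) by rewrite ltr0n ltnW.
pose r : algC := (X ^ 4 * z0 ^ (2 * m.+1))%N%:R / z0%:R ^+ (2 * k).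
have r0 : 0 <= r by rewrite mulr_ge0 ?invr_ge0 ?exprn_ge0 ?ler0n.
have step i : i != 0 -> (tau ^ 2)%N%:R * `|wc i 0 * wc i 1 * wc i 2 ^+ m.+1| ^+ 2 <=
    z0%:R ^+ 2 * `|wc i 0 * wc i 1 * wc i 2 ^+ m| ^+ 2 + r * `|wc i 2 ^+ k| ^+ 2.
  move=> i0; rewrite !normrM !normrX.
  have [le|lt] := real_leP (rpredM (realn _ tau) (normr_real (wc i 2))) (realn _ z0).
    rewrite -[X in X <= _]addr0; apply: lerD; last by rewrite mulr_ge0 ?exprn_ge0.
    rewrite [X in X <= _](_ : _ = (tau%:R * `|wc i 2|) ^+ 2 * (`|wc i 0| * `|wc i 1| * `|wc i 2| ^+ m) ^+ 2).
      by rewrite ler_wpM2r ?exprn_ge0 ?mulr_ge0 ?exprn_ge0 // lerXn2r ?nnegrE ?mulr_ge0 ?ler0n.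
    by rewrite natrX (exprS _ m); ring.
  rewrite -[X in X <= _]add0r; apply: lerD.
    by rewrite mulr_ge0 ?exprn_ge0 ?mulr_ge0 ?exprn_ge0 ?ler0n.
  have tau0 : 0 < (tau%:R : algC).
    rewrite ltr0n lt0n; apply: contraTneq lt => ->; rewrite mul0r.
    by apply/negP => /(lt_trans zR); rewrite ltxx.
  (* Of the [k + 1] powers of [tau] saved here, [k] are spent on replacing [z0 ^ k] by the power of
     [tau] times the large value of [|wc i 2|]; the last one is the gain. *)
  have bU : tau%:R ^+ k.+1 * `|wc i 1| <= X%:R.
    by rewrite -natrX wc1; apply: burgess_saving; [exact: dirichlet_dchar|exact: dirichlet_nonprincipal].
  rewrite /r [X in _ <= X]mulrAC ler_pdivlMr ?exprn_gt0 //.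
  apply: (@le_trans _ _ ((X%:R * (tau%:R ^+ k.+1 * `|wc i 1|) * z0%:R ^+ m.+1 * `|wc i 2| ^+ k) ^+ 2)); last first.
    rewrite [X in _ <= X](_ : _ = (X%:R * X%:R * z0%:R ^+ m.+1 * `|wc i 2| ^+ k) ^+ 2); last first.
      by rewrite natrM !natrX (mulnC 2) (exprM _ m.+1); ring.
    rewrite lerXn2r ?nnegrE ?mulr_ge0 ?exprn_ge0 ?ler0n //.
    by rewrite ler_wpM2r ?exprn_ge0 // ler_wpM2r ?exprn_ge0 ?ler0n // ler_wpM2l ?ler0n.
  rewrite [X in X <= _](_ : _ = (tau%:R * (`|wc i 0| * `|wc i 1| * `|wc i 2| ^+ m.+1) * z0%:R ^+ k) ^+ 2); last first.
    by rewrite natrX (mulnC 2) (exprM _ k); ring.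
  rewrite lerXn2r ?nnegrE ?mulr_ge0 ?exprn_ge0 ?ler0n //.
  have wX : `|wc i 0| <= X%:R := wc_le i 0.
  have wZ : `|wc i 2| ^+ m.+1 <= z0%:R ^+ m.+1 by rewrite lerXn2r ?nnegrE ?ler0n // (wc_le i 2).
  have zk : z0%:R ^+ k <= (tau%:R * `|wc i 2|) ^+ k.
    by rewrite lerXn2r ?nnegrE ?mulr_ge0 ?ler0n // ltW.
  have -> : X%:R * (tau%:R ^+ k.+1 * `|wc i 1|) * z0%:R ^+ m.+1 * `|wc i 2| ^+ k =
     tau%:R * (X%:R * `|wc i 1| * z0%:R ^+ m.+1) * (tau%:R * `|wc i 2|) ^+ k :> algC.
    by rewrite exprS exprMn; ring.
  apply: ler_pM; rewrite ?mulr_ge0 ?exprn_ge0 ?ler0n // ler_wpM2l ?ler0n //.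
  by apply: ler_pM; rewrite ?mulr_ge0 ?exprn_ge0 ?ler0n // ler_wpM2r.
apply: (@le_trans _ _ (z0%:R ^+ 2 * (\sum_(i : dirichlet_index q) `|wc i 0 * wc i 1 * wc i 2 ^+ m| ^+ 2) +
    r * \sum_(i : dirichlet_index q) `|wc i 2 ^+ k| ^+ 2)).
  rewrite !mulr_sumr -big_split big_mkcond; apply: ler_sum => i _; case: ifP => [|_]; first exact: step.
  by apply: addr_ge0; [apply: mulr_ge0|apply: (mulr_ge0 r0)]; rewrite exprn_ge0 ?ler0n.
have mv1 : \sum_(i : dirichlet_index q) `|wc i 0 * wc i 1 * wc i 2 ^+ m| ^+ 2 <=
    (2 * T * (X ^ 2 * z0 ^ m) ^ 2)%N%:R.
  have := @mean_value q q1 'I_m.+2 M (fun j => L j) (fun j => w j) T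
    (fun j => w_le1 j) (fun j => @w_supp j) (fun j => L_lt j).
  rewrite prod_L card_ord => /(_ fiberT1 q_le1) mv.
  under eq_bigr => i _ do rewrite -prod_wc.
  by apply: le_trans mv _; rewrite ler_pdivrMr // ler_wpM2l ?ler0n // ler_nat leq_totient.
have mv2 : \sum_(i : dirichlet_index q) `|wc i 2 ^+ k| ^+ 2 <= (2 * T * (z0 ^ k) ^ 2)%N%:R.
  have := @mean_value q q1 'I_k M (fun j => L 2) (fun j => w 2) T
    (fun j => w_le1 2) (fun j => @w_supp 2) (fun j => L_lt 2).
  rewrite prod_nat_const card_ord => /(_ fiberT2 q_le2) mv.
  have powE i : wc i 2 ^+ k = \prod_(j < k) wc i 2 by rewrite prodr_const card_ord.
  under eq_bigr => i _ do rewrite powE.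
  by apply: le_trans mv _; rewrite ler_pdivrMr // ler_wpM2l ?ler0n // ler_nat leq_totient.
apply: le_trans (lerD (ler_wpM2l _ mv1) (ler_wpM2l r0 mv2)) _; first by rewrite exprn_ge0 ?ler0n.
rewrite le_eqVlt; apply/orP; left; apply/eqP.
have zk0 : z0%:R ^+ (2 * k) != 0 :> algC by rewrite expf_neq0 // gt_eqF.
have -> : r * (2 * T * (z0 ^ k) ^ 2)%N%:R = (2 * T)%N%:R * (X ^ 4 * z0 ^ (2 * m.+1))%N%:R.
  by rewrite natrM -expnM natrX (mulnC k) /r mulrCA divfK.
rewrite -natrX -!natrM -natrD; congr (_%:R).
by rewrite (mulnC 2 m.+1) (expnM z0 m.+1 2) (expnS z0 m); ring.
Qed.

(** The difference [cA - cB] is truncated: the left-hand side is 0 when rough integers prevail,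
    which disposes of the sign condition on [S]. *)
Lemma exceptional_set_bound :
  (#|exceptional| * tau ^ 2 * ((cA - cB) * coprime_count q X * coprime_count q z0 ^ m.+1) ^ 2 <=
   4 * T * totient q * X ^ 4 * z0 ^ (2 * m.+1))%N.
Proof.
have [le|/ltnW lt] := leqP cB cA; last first.
  by have /eqP-> : (cA - cB == 0)%N := lt; rewrite !mul0n muln0.
have SE : S = ((cA - cB) * coprime_count q X * coprime_count q z0 ^ m.+1)%N%:R.
  by rewrite /S -natrB // -natrX -!natrM.
have := exceptional_variance (_ : 0 <= S); rewrite {1}SE ler0n => /(_ isT) ev.
rewrite -(ler_nat algC); apply: (@le_trans _ _ ((tau ^ 2)%N%:R * ((totient q)%:R * V))).
  apply: le_trans (ler_wpM2l (ler0n _ _) ev); rewrite SE -natrX -!natrM ler_nat.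
  by apply: eq_leq; ring.
rewrite mulrCA; apply: le_trans (ler_wpM2l (ler0n _ _) variance_le) _.
by rewrite -natrM ler_nat; apply: eq_leq; ring.
Qed.
End ExceptionalSet.

(** * Primes *)

Local Open Scope nat_scope.

Lemma prod_primes_dvd n (s : seq nat) : uniq s -> (forall p, p \in s -> prime p && (p %| n)) ->
  \prod_(p <- s) p %| n.
Proof.
elim: s => [|p s IHs] /=; first by rewrite big_nil dvd1n.
move=> /andP[ps s_uniq] H; rewrite big_cons; have /andP[p_pr pn] := H p (mem_head _ _).
rewrite Gauss_dvd ?pn ?IHs // => [r rs|]; first by apply: H; rewrite inE rs orbT.
rewrite coprime_sym big_seq; elim/big_ind: _ => [|x y cx cy|r rs]; first exact: coprime1n.
  by rewrite coprimeMl cx cy.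
have /andP[r_pr _] : prime r && (r %| n) by apply: H; rewrite inE rs orbT.
by rewrite prime_coprime // dvdn_prime2 //; apply: contra ps => /eqP <-.
Qed.

Definition primorial n := \prod_(0 <= p < n.+1 | prime p) p.

Lemma prime_product_range a b n : (forall p, prime p -> a <= p < b -> p %| n) -> 0 < n ->
  \prod_(a <= p < b | prime p) p <= n.
Proof.
move=> H n0; apply: dvdn_leq => //; rewrite -big_filter; apply: prod_primes_dvd.
  by rewrite filter_uniq ?iota_uniq.
by move=> p; rewrite mem_filter mem_index_iota => /andP[p_pr /(H _ p_pr) ->]; rewrite p_pr.
Qed.

Lemma prime_dvd_fact p k : prime p -> (p %| k`!) = (p <= k).
Proof.
move=> p_pr; apply/idP/idP => [|pk]; last by rewrite dvdn_fact // prime_gt0.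
elim: k => [|k IHk]; first by rewrite fact0 dvdn1 => /eqP p1; rewrite p1 in p_pr.
by rewrite factS Euclid_dvdM // => /orP[/dvdn_leq->//|/IHk/leqW].
Qed.

Lemma prime_dvd_bin p n m : prime p -> m < p -> n - m < p -> p <= n -> m <= n -> p %| 'C(n, m).
Proof.
move=> p_pr mp nmp pn mn; have : p %| n`! by rewrite prime_dvd_fact.
rewrite -(bin_fact mn) !Euclid_dvdM // !prime_dvd_fact // => /orP[//|].
by rewrite !(leqNgt p) mp nmp.
Qed.

(** With [m] half of [n] rounded up, the primes in [(m, n]] divide ['C(n, m)], which is at most
    [2 ^ n]. Base 8 makes room for this crude bound and for the rounding, through
    [3 * m <= 2 * n]. *)
Lemma primorial_le n : primorial n <= 8 ^ n.
Proof.
elim/ltn_ind: n => n IH; have [n1|n1] := leqP n 1.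
  by rewrite /primorial; case: n n1 {IH} => [|[|//]] _; rewrite big_mkcond /= /index_iota /= !big_cons big_nil.
pose m := uphalf n; have mn : m < n by rewrite /m; lia.
rewrite /primorial (@big_cat_nat _ _ _ m.+1) //=; last by rewrite ltnS ltnW.
apply: (@leq_trans (8 ^ m * 2 ^ n)).
  apply: leq_mul; first exact: IH.
  apply: leq_trans (bin_le_exp2 n m); apply: prime_product_range.
    by move=> p p_pr /andP[mp pn]; apply: prime_dvd_bin => //; [rewrite /m in mp *; lia|exact: ltnW].
  by rewrite bin_gt0 ltnW.
have -> : 8 ^ m * 2 ^ n = 2 ^ (3 * m + n) by rewrite expnD (expnM 2 3).
by rewrite -[8]/(2 ^ 3) -expnM leq_pexp2l // /m; lia.
Qed.

Lemma fact_prime_prod n : n`! = \prod_(0 <= p < n.+1 | prime p) p ^ logn p n`!.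
Proof.
have le : n`! <= n`! + n by apply: leq_addr.
rewrite -[LHS]partnT ?fact_gt0 // (widen_partn _ le) (@big_cat_nat _ _ _ n.+1) //=; last by rewrite ltnS leq_addl.
rewrite [X in _ * X]big_nat_cond [X in _ * X]big1 ?muln1 => [|p /andP[/andP[np _] _]].
  rewrite [LHS](bigID prime) /= [X in _ * X]big1 ?muln1 // => p.
  by rewrite /logn => /negPf->.
case: (boolP (prime p)) => [p_pr|/negPf np']; last by rewrite /logn np'.
by rewrite lognE p_pr fact_gt0 prime_dvd_fact // leqNgt np.
Qed.

Lemma leq_logn_fact p n : prime p -> n %/ p <= logn p n`!.
Proof.
move=> p_pr; rewrite logn_fact //; have [->|n0] := posnP n; first by rewrite div0n.
by rewrite big_ltn // expn1 leq_addr.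
Qed.

(** Legendre's formula bounded by a geometric series; the induction carries the remainder
    [n %/ p ^ m] so that the sum telescopes. *)
Lemma logn_fact_le p n : prime p -> logn p n`! * p.-1 <= n.
Proof.
move=> p_pr; rewrite logn_fact //; move: {1}n => m; have p0 := prime_gt0 p_pr.
suff : (\sum_(1 <= k < m.+1) n %/ p ^ k) * p.-1 + n %/ p ^ m <= n by apply: leq_trans; rewrite leq_addr.
elim: m => [|m IHm]; first by rewrite big_geq // mul0n divn1.
rewrite big_nat_recr //=; apply: leq_trans IHm; rewrite mulnDl -addnA leq_add2l.
rewrite -[X in _ + X]muln1 -mulnDr addn1 prednK // expnSr divnMA.
exact: leq_trunc_div.
Qed.

(** A union bound over a prime factor beyond [N]; the cofactor remains coprime to [q]. *)
Lemma rough_count_le q N X : 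
  \sum_(1 <= n < X.+1 | coprime n q) ~~ smooth N n <=
  \sum_(N.+1 <= p < X.+1 | prime p) coprime_count q (X %/ p).
Proof.
apply: (@leq_trans (\sum_(1 <= n < X.+1 | coprime n q) \sum_(N.+1 <= p < X.+1 | prime p) (p %| n))).
  rewrite big_nat_cond [X in _ <= X]big_nat_cond; apply: leq_sum => n /andP[/andP[n0 nX] _].
  case: (boolP (smooth N n)) => // /allPn[p]; rewrite mem_primes -ltnNge => /and3P[p_pr _ pn] Np.
  rewrite -big_filter (big_rem p) /=; first by rewrite pn leq_addr.
  by rewrite mem_filter p_pr mem_index_iota Np /= ltnS (leq_trans (dvdn_leq n0 pn)).
rewrite exchange_big /=; apply: leq_sum => p p_pr.
have -> : \sum_(1 <= n < X.+1 | coprime n q) (p %| n) = \sum_(1 <= n < X.+1 | (p %| n) && coprime n q) 1.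
  by rewrite [RHS]big_mkcondl.
rewrite (sum_dvd_multiples _ (fun n => coprime n q) (fun=> 1)) ?prime_gt0 //.
rewrite /coprime_count big_mkcond [X in _ <= X]big_mkcond; apply: leq_sum => m _.
by rewrite coprimeMl; case: coprime; case: coprime.
Qed.

From mathcomp Require Import all_classical all_reals all_analysis.
Import Order.TTheory GRing.Theory Num.Theory.
Import numFieldNormedType.Exports.
Local Open Scope classical_set_scope.
Local Open Scope ring_scope.

Section Mertens.
Variable R : realType.
Local Notation lnn n := (ln (n%:R : R)).

Lemma ln_le_sub1 (x : R) : 0 < x -> ln x <= x - 1.
Proof.
move=> x0; have := @le_ln1Dx R (x - 1); rewrite (addrC 1) subrK; apply; lra.
Qed.

Lemma ln_prod_nat (s : seq nat) (P : pred nat) (F : nat -> nat) : (forall i, P i -> (0 < F i)%N) ->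
  lnn (\prod_(i <- s | P i) F i)%N = \sum_(i <- s | P i) lnn (F i).
Proof.
move=> F0; suff [_ //] : (0 < \prod_(i <- s | P i) F i)%N /\
  lnn (\prod_(i <- s | P i) F i)%N = \sum_(i <- s | P i) lnn (F i).
apply: (big_rec2 (fun (a : nat) (b : R) => (0 < a)%N /\ lnn a = b)); first by rewrite ln1.
move=> i a b Pi [a0 <-]; rewrite muln_gt0 F0 // a0; split=> //.
by rewrite natrM lnM ?posrE ?ltr0n ?F0.
Qed.

Lemma lnnS n : (0 < n)%N -> lnn n.+1 - lnn n <= n%:R^-1.
Proof.
move=> n0; have n0' : 0 < (n%:R : R) by rewrite ltr0n.
rewrite -ln_div ?posrE ?ltr0n //; apply: le_trans (ln_le_sub1 _) _; first by rewrite divr_gt0 ?ltr0n.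
by rewrite -natr1 mulrDl divff ?gt_eqF // addrAC subrr add0r mul1r.
Qed.

Lemma lnn_ge0 n : 0 <= lnn n.
Proof. by case: n => [|n]; [rewrite ln0|rewrite ln_ge0 // ler1n]. Qed.

Lemma ln_factE n : lnn n.+1`! = lnn n.+1 + lnn n`!.
Proof. by rewrite factS natrM lnM ?posrE ?ltr0n ?fact_gt0. Qed.

Lemma ln_fact_le n : lnn n`! <= n%:R * lnn n.
Proof.
elim: n => [|n IHn]; first by rewrite fact0 ln1 mul0r.
rewrite ln_factE -{2}natr1 mulrDl mul1r [X in _ <= X]addrC lerD2l; apply: le_trans IHn _.
case: n => [|n]; first by rewrite !mul0r.
by rewrite ler_wpM2l // ler_ln ?posrE ?ltr0n // ler_nat.
Qed.

Lemma ln_fact_ge n : n%:R * lnn n - n%:R <= lnn n`!.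
Proof.
elim: n => [|n IHn]; first by rewrite fact0 ln1 mul0r subr0.
rewrite ln_factE -{1 3}natr1; case: n IHn => [|n] IHn; first by rewrite !ln1; lra.
have : n.+1%:R * (lnn n.+2 - lnn n.+1) <= 1.
  by rewrite mulrC -ler_pdivlMr ?ltr0n // mul1r lnnS.
move: IHn; rewrite mulrBr; lra.
Qed.

Lemma ln_factE_primes n : lnn n`! = \sum_(0 <= p < n.+1 | prime p) (logn p n`!)%:R * lnn p.
Proof.
rewrite {1}fact_prime_prod ln_prod_nat => [|p p_pr]; last by rewrite expn_gt0 prime_gt0.
by apply: eq_bigr => p p_pr; rewrite natrX lnXn ?ltr0n ?prime_gt0 // mulr_natl.
Qed.

Definition prime_log_sum n : R := \sum_(0 <= p < n.+1 | prime p) lnn p / p%:R.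

Lemma ln8_le : lnn 8 <= 3.
Proof.
rewrite -[X in _ <= X]expRK ler_ln ?posrE ?expR_gt0 ?ltr0n //.
have -> : 3 = (3%:R * 1 : R) by rewrite mulr1.
rewrite expRM_natl (_ : 8 = 2 ^+ 3); last by rewrite -natrX.
rewrite lerXn2r ?nnegrE ?expR_ge0 ?ler0n //.
by have := expR_ge1Dx (1 : R); rewrite -[1 + 1]/2.
Qed.

(** Comparison with [ln n!], where [p] has exponent at least [n %/ p]. Rounding costs [ln p] for
    each prime, in total at most [3 * n] by [primorial_le]. *)
Lemma prime_log_sum_le n : (0 < n)%N -> prime_log_sum n <= lnn n + 3.
Proof.
move=> n0; have n0' : 0 < (n%:R : R) by rewrite ltr0n.
rewrite -(ler_pM2l n0') /prime_log_sum mulr_sumr.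
apply: (@le_trans _ _ (\sum_(0 <= p < n.+1 | prime p) ((logn p n`!)%:R * lnn p + lnn p))).
  apply: ler_sum => p p_pr; have p0 : 0 < (p%:R : R) by rewrite ltr0n prime_gt0.
  rewrite mulrCA mulrC -[X in _ <= _ + X]mul1r -mulrDl ler_wpM2r ?lnn_ge0 //.
  rewrite ler_pdivrMr // natr1 -natrM ler_nat.
  apply: (@leq_trans ((n %/ p).+1 * p)); first by rewrite ltnW // ltn_ceil // prime_gt0.
  by rewrite leq_mul2r ltnS leq_logn_fact ?orbT.
rewrite big_split /= -ln_factE_primes mulrDr; apply: lerD; first exact: ln_fact_le.
rewrite -(@ln_prod_nat _ prime id) => [|p]; last exact: prime_gt0.
apply: le_trans (_ : lnn (8 ^ n) <= _).
  rewrite ler_ln ?posrE ?ltr0n ?expn_gt0 // ?ler_nat ?primorial_le //.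
  by rewrite prodn_cond_gt0 // => p; exact: prime_gt0.
by rewrite natrX lnXn ?ltr0n // -(mulr_natl (ln _) n) ler_wpM2l ?ler0n ?ln8_le.
Qed.

(* [(ln m + 2) / m] decreases by at least the [m]-th summand. *)
Lemma sum_ln_pair_le n : (0 < n)%N ->
  \sum_(2 <= m < n.+1) lnn m / (m%:R * m.-1%:R) <= 2 - (lnn n + 2) / n%:R.
Proof.
case: n => // n _; elim: n => [|n IHn]; first by rewrite big_geq // ln1; lra.
rewrite big_nat_recr //=; apply: le_trans (lerD IHn (lexx _)) _.
have x0 : 0 < (n.+1%:R : R) by rewrite ltr0n.
have y0 : 0 < (n.+2%:R : R) by rewrite ltr0n.
have yE : n.+2%:R = n.+1%:R + 1 :> R by rewrite natr1.
have x1 : 1 <= (n.+1%:R : R) by rewrite ler1n.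
have := lnnS (ltn0Sn n); rewrite -(ler_pM2l (mulr_gt0 y0 x0)).
set x := n.+1%:R in x0 x1 yE *; set y := n.+2%:R in y0 yE *.
set a := ln y; set b := ln x; move=> H; rewrite -subr_ge0.
have -> : 2 - (a + 2) / y - (2 - (b + 2) / x + a / (y * x)) =
   (2 - y * (a - b)) / (y * x).
  by rewrite yE in y0 *; field; rewrite !gt_eqF.
rewrite divr_ge0 ?(ltW (mulr_gt0 y0 x0)) // subr_ge0.
have H2 : y * x * (a - b) <= y by rewrite mulfK ?gt_eqF in H.
have H3 : y * (a - b) <= y / x by rewrite ler_pdivlMr // mulrAC.
apply: le_trans H3 _; rewrite ler_pdivrMr // yE; lra.
Qed.

(** The exponent of [p] in [n!] is at most [n / (p - 1) = n / p + n / (p * (p - 1))]. The second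
    part, weighted by [ln p], sums to at most [2 * n] even over all integers. *)
Lemma prime_log_sum_ge n : (0 < n)%N -> lnn n - 3 <= prime_log_sum n.
Proof.
move=> n0; have n0' : 0 < (n%:R : R) by rewrite ltr0n.
suff : lnn n - 1 <= prime_log_sum n + 2 by lra.
rewrite -(ler_pM2l n0') mulrBr mulr1; apply: le_trans (ln_fact_ge n) _.
rewrite ln_factE_primes.
apply: (@le_trans _ _ (\sum_(0 <= p < n.+1 | prime p) (n%:R * (lnn p / p%:R) +
    n%:R * (lnn p / (p%:R * p.-1%:R))))).
  apply: ler_sum => p p_pr; have p1 := prime_gt1 p_pr; have p0 : 0 < (p%:R : R) by rewrite ltr0n ltnW.
  have p10 : 0 < (p.-1%:R : R) by rewrite ltr0n -ltnS prednK // ltnW.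
  have pE : p%:R = p.-1%:R + 1 :> R by rewrite natr1 prednK // ltnW.
  have -> : n%:R * (lnn p / p%:R) + n%:R * (lnn p / (p%:R * p.-1%:R)) = n%:R / p.-1%:R * lnn p.
    by rewrite pE in p0 *; field; rewrite !gt_eqF.
  by rewrite ler_wpM2r ?lnn_ge0 // ler_pdivlMr // -natrM ler_nat logn_fact_le.
rewrite big_split /= -!mulr_sumr mulrDr lerD2l ler_pM2l //.
apply: (@le_trans _ _ (\sum_(2 <= m < n.+1) lnn m / (m%:R * m.-1%:R))); last first.
  apply: le_trans (sum_ln_pair_le n0) _.
  by rewrite gerBl divr_ge0 ?addr_ge0 ?lnn_ge0.
rewrite (@big_cat_nat _ _ _ 2) //= [X in X + _ <= _]big_nat_cond [X in X + _ <= _]big_pred0 ?add0r.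
  rewrite big_mkcond; apply: ler_sum => m _; case: ifP => // _.
  by rewrite divr_ge0 ?mulr_ge0 ?lnn_ge0.
by case=> [|[|m]].
Qed.

Lemma prime_reciprocal_sum_le y x : (1 < y)%N -> (y <= x)%N ->
  \sum_(y.+1 <= p < x.+1 | prime p) (p%:R^-1 : R) <= ln (lnn x) - ln (lnn y) + 6 / lnn y.
Proof.
move=> y1 yx; have lny : 0 < lnn y by rewrite ln_gt0 // ltr1n.
have pos n : (1 < n)%N -> 0 < lnn n by move=> n1; rewrite ln_gt0 // ltr1n.
pose E n := prime_log_sum n - lnn n.
have E_le n : (0 < n)%N -> -3 <= E n <= 3.
  by move=> n0; rewrite /E; have := prime_log_sum_le n0; have := prime_log_sum_ge n0; lra.
(* Abel summation, carried as an invariant of the induction on [x]. *)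
suff H : \sum_(y.+1 <= p < x.+1 | prime p) (p%:R^-1 : R) <=
    ln (lnn x) - ln (lnn y) + E x / lnn x + 3 * (2 / lnn y - (lnn x)^-1).
  apply: le_trans H _; have lnx := pos x (leq_trans y1 yx).
  have /andP[_ Ex] := E_le x (leq_trans (ltnW y1) yx).
  have : E x / lnn x <= 3 / lnn x by rewrite ler_pM2r ?invr_gt0.
  lra.
elim: x yx => [|x IHx]; first by rewrite leqn0 => /eqP y0; rewrite y0 in y1.
rewrite leq_eqVlt => /orP[/eqP <-|yx].
  rewrite big_geq //; have /andP[Ey _] := E_le y (ltnW y1).
  have : -3 / lnn y <= E y / lnn y by rewrite ler_pM2r ?invr_gt0.
  by rewrite subrr add0r; lra.
have {IHx} := IHx yx; have x1 : (1 < x)%N by exact: (leq_trans y1 (yx : (y <= x)%N)).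
rewrite [in X in _ -> X](big_mkcond prime) big_nat_recr //= -big_mkcond => IH.
apply: le_trans (lerD IH (lexx _)) _.
have lx := pos x x1; have lS := pos x.+1 (leqW x1).
have step : (if prime x.+1 then x.+1%:R^-1 else 0 : R) = (lnn x.+1 - lnn x + E x.+1 - E x) / lnn x.+1.
  have -> : lnn x.+1 - lnn x + E x.+1 - E x = prime_log_sum x.+1 - prime_log_sum x by rewrite /E; ring.
  rewrite /prime_log_sum (big_mkcond prime) big_nat_recr //= -big_mkcond addrAC subrr add0r.
  case: ifP => _; last by rewrite mul0r.
  by rewrite mulrAC divff ?mul1r // gt_eqF.
rewrite step; have [_ Ex] := andP (E_le x (ltnW x1)).
have lm : lnn x <= lnn x.+1 by rewrite ler_ln ?posrE ?ltr0n ?ler_nat // ltnW.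
have key : (lnn x.+1 - lnn x) / lnn x.+1 <= ln (lnn x.+1) - ln (lnn x).
  have := @ln_le_sub1 (lnn x / lnn x.+1) (divr_gt0 lx lS).
  by rewrite ln_div ?posrE // mulrBl divff ?gt_eqF //; lra.
have inv_le : (lnn x.+1)^-1 <= (lnn x)^-1 by rewrite lef_pV2 ?posrE.
(* Abel summation leaves [E x] times the difference of reciprocals. Since [E x <= 3], the last part
   of the invariant absorbs it. *)
have : (3 - E x) * ((lnn x)^-1 - (lnn x.+1)^-1) >= 0 by rewrite mulr_ge0 ?subr_ge0.
have -> : (3 - E x) * ((lnn x)^-1 - (lnn x.+1)^-1) =
  3 * (lnn x)^-1 - 3 * (lnn x.+1)^-1 - E x / lnn x + E x / lnn x.+1 by ring.
have -> : (lnn x.+1 - lnn x + E x.+1 - E x) / lnn x.+1 =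
  (lnn x.+1 - lnn x) / lnn x.+1 + E x.+1 / lnn x.+1 - E x / lnn x.+1 by ring.
move: key; move: ((lnn x.+1 - lnn x) / lnn x.+1) => d; lra.
Qed.
End Mertens.

(** * Density of smooth numbers *)

(** [tau] is the rounded [n]-th root of [q], a small power. The divisor bound of exponent
    [mx * (8 * n)] keeps the whole loss [T] from divisors below one factor [tau]. *)
Lemma scale_and_divisor_bound n mx B : (0 < n)%N -> (0 < mx)%N ->
  \forall q \near \oo, exists tau T, [/\ (tau ^ n <= q)%N, (B <= tau)%N, (T <= tau)%N &
    forall v, (0 < v <= q ^ 4)%N -> (num_divisors v ^ mx <= T)%N].
Proof.
move=> n0 mx0; have [C C0 HC] := uniform_divisor_bound (mx * (8 * n)).
exists ((2 * B) ^ n + C * 2 ^ (8 * n))%N => // q /= Qq.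
have q0 : (0 < q)%N by apply: leq_trans Qq; rewrite addn_gt0 orbC muln_gt0 C0 expn_gt0.
have [tau [tau0 tau_le tau_gt]] := exists_root n0 q0.
have [|D [D0 DC D_ge]] := HC (q ^ 4)%N; first by rewrite expn_gt0 q0.
exists tau, (D ^ mx)%N; split=> //.
- rewrite -(leq_pmul2l (isT : 0 < 2)%N) -(leq_exp2r _ _ n0) ltnW //.
  by apply: leq_ltn_trans tau_gt; apply: leq_trans Qq; exact: leq_addr.
- have n80 : (0 < 8 * n)%N by rewrite muln_gt0.
  rewrite -(leq_exp2r _ _ n80) -expnM; apply: leq_trans DC _.
  rewrite -(@leq_pmul2r (2 ^ (8 * n))) ?expn_gt0 // -expnMn (mulnC tau).
  apply: (@leq_trans (q ^ 8)); last by rewrite (mulnC 8 n) expnM leq_exp2r // ltnW.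
  rewrite (expnD q 4 4) mulnAC leq_mul2r; apply/orP; right.
  apply: (@leq_trans q); first by apply: leq_trans Qq; exact: leq_addl.
  by rewrite -{1}[q]expn1 leq_pexp2l.
by move=> v /andP[v0 vq]; rewrite leq_exp2r // D_ge.
Qed.

Section Powers.
Variable R : realType.
Local Notation P a q := ((q%:R : R) `^ a).

Lemma near_powR_ge (a C : R) : 0 < a -> \forall q \near \oo, C <= P a q.
Proof.
move=> a0; pose M := Num.max C 1.
have M0 : 0 <= M by rewrite le_max ler01 orbT.
exists (Num.truncn (M `^ a^-1)).+1 => // q /= Qq.
apply: (@le_trans _ _ M); first by rewrite le_max lexx.
have ME : M = (M `^ a^-1) `^ a by rewrite -powRrM mulVf ?gt_eqF // powRr1.
rewrite [X in X <= _]ME.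
rewrite ge0_ler_powR ?nnegrE ?powR_ge0 ?ler0n ?(ltW a0) // ltW //.
by apply: lt_le_trans (truncnS_gt _) _; rewrite ler_nat.
Qed.

Lemma near_ln_ge (C : R) : \forall q \near \oo, C <= ln (q%:R : R).
Proof.
exists (Num.truncn (expR C)).+1 => // q /= Qq.
have q0 : 0 < (q%:R : R) by rewrite ltr0n; apply: leq_trans Qq.
rewrite -(ler_expR) lnK ?posrE //.
by rewrite ltW //; apply: lt_le_trans (truncnS_gt _) _; rewrite ler_nat.
Qed.

Definition floor_power (a : R) q := Num.truncn (P a q).

Lemma floor_power_le a q : (floor_power a q)%:R <= P a q.
Proof. by rewrite truncn_le powR_ge0. Qed.

Lemma powR_ge1 a q : (0 < q)%N -> 0 <= a -> 1 <= P a q.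
Proof.
move=> q0 a0; have q1 : 1 <= (q%:R : R) by rewrite ler1n.
by have := ler_powR q1 a0; rewrite powRr0.
Qed.

Lemma floor_power_gt0 a q : (0 < q)%N -> 0 <= a -> (0 < floor_power a q)%N.
Proof. by move=> q0 a0; rewrite truncn_gt0 powR_ge1. Qed.

Lemma floor_power_ge a q : (0 < q)%N -> 0 <= a -> P a q <= 2 * (floor_power a q)%:R.
Proof.
move=> q0 a0; have := truncnS_gt (P a q); rewrite -/(floor_power a q) => /ltW lt.
apply: le_trans lt _; rewrite -natr1 mulrDl mul1r lerD2l ler1n floor_power_gt0 //.
Qed.

Lemma powRDn a b q : (0 < q)%N -> P (a + b) q = P a q * P b q.
Proof. by move=> q0; rewrite powRD // pnatr_eq0 -lt0n q0 implybT. Qed.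

Lemma powRXn a n q : P a q ^+ n = P (a * n%:R) q.
Proof. by rewrite powRrM powR_mulrn ?powR_ge0. Qed.

Lemma near_num_divisors_le (a C : R) : 0 < a -> 0 <= C ->
  \forall q \near \oo, C * (num_divisors q)%:R <= P a q.
Proof.
move=> a0 C0; pose K := (Num.truncn (2 / a)).+1.
have aK : 2 <= a * K%:R by rewrite mulrC -ler_pdivrMr // ltW // truncnS_gt.
have [C1 C10 HC] := divisor_bound K.
near=> q.
have q0 : (0 < q)%N by near: q; exists 1%N.
have Cq : C ^+ K * C1%:R <= q%:R.
  have : C ^+ K * C1%:R <= P 1 q by near: q; apply: near_powR_ge.
  by rewrite powRr1.
rewrite -(@ler_pXn2r _ K) ?nnegrE ?powR_ge0 ?mulr_ge0 // powRXn exprMn.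
apply: (@le_trans _ _ (P 2 q)); last by rewrite ler_powR // ler1n.
rewrite (_ : P 2 q = q%:R * q%:R); last by rewrite powR_mulrn ?expr2.
apply: (@le_trans _ _ (C ^+ K * (C1%:R * q%:R))).
  by rewrite ler_wpM2l ?exprn_ge0 // -natrX -natrM ler_nat HC.
by rewrite mulrA ler_wpM2r.
Unshelve. all: by end_near. Qed.

(** The sieve error is at most the divisor count of [q], hence below every power of [q] and below
    half the main term. *)
Lemma near_coprime_count_ge (a eta : R) : 0 < a -> 0 < eta ->
  \forall q \near \oo, eta * q%:R <= (totient q)%:R -> forall Y, P a q <= 2 * Y%:R ->
    eta / 2 * Y%:R <= (coprime_count q Y)%:R.
Proof.
move=> a0 eta0; near=> q; move=> phi Y YP.
have q0 : (0 < q)%N by near: q; exists 1%N.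
have q0' : 0 < (q%:R : R) by rewrite ltr0n.
have [_ lo] := coprime_count_bounds Y q0.
have tD : (4 / eta) * (num_divisors q)%:R <= P a q.
  by near: q; apply: near_num_divisors_le => //; rewrite divr_ge0 // ltW.
have t_le : (2 ^ size (primes q))%:R <= eta / 2 * Y%:R.
  apply: (@le_trans _ _ (num_divisors q)%:R); first by rewrite ler_nat exp2_omega_le.
  have : 4 / eta * (num_divisors q)%:R <= 2 * Y%:R by apply: le_trans tD YP.
  by rewrite mulrAC ler_pdivrMr //; lra.
have : Y%:R * (totient q)%:R <= ((coprime_count q Y)%:R + (2 ^ size (primes q))%:R) * q%:R :> R.
  by rewrite -natrD -!natrM ler_nat.
have : Y%:R * (eta * q%:R) <= Y%:R * (totient q)%:R by rewrite ler_wpM2l.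
move=> /le_trans h /h; rewrite mulrA ler_pM2r //; lra.
Unshelve. all: by end_near. Qed.

(** With [L = ln q], [ln X <= x * L] and [ln N >= c * L - 2], where the 2 comes from the factor 4
    that allows for rounding. The errors add up to [8 / (c * L - 2)], and the lower bounds [L1] and
    [L2] make this at most [e]. *)
Lemma near_prime_sum_le (x c e : R) : 0 < c -> c <= x -> 0 < e ->
  \forall q \near \oo, forall X N : nat, X%:R <= P x q -> (N <= X)%N -> P c q <= 4 * N%:R ->
   \sum_(N.+1 <= p < X.+1 | prime p) (p%:R^-1 : R) <= ln (x / c) + e.
Proof.
move=> c0 cx e0; have x0 := lt_le_trans c0 cx; near=> q.
have L1 : 20 / (c * e) <= ln (q%:R : R) by near: q; apply: near_ln_ge.
have L2 : 6 / c <= ln (q%:R : R) by near: q; apply: near_ln_ge.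
have q0 : (0 < q)%N by near: q; exists 1%N.
move=> X N XP NX NP; have ce : 0 < c * e by rewrite mulr_gt0.
set L := ln (q%:R : R) in L1 L2 *.
have q0' : 0 < (q%:R : R) by rewrite ltr0n.
have cL : 6 <= c * L by rewrite mulrC -ler_pdivrMr.
have ln4 : ln (4 : R) <= 2.
  rewrite -[X in _ <= X]expRK ler_ln ?posrE ?expR_gt0 ?ltr0n //.
  have := expR_ge1Dx (1 : R) => h.
  have -> : 2 = 2%:R * 1 :> R by rewrite mulr1.
  rewrite expRM_natl; have -> : 4 = 2 ^+ 2 :> R by ring.
  by rewrite lerXn2r ?nnegrE ?expR_ge0.
have N0 : (0 < N)%N.
  by rewrite lt0n; apply: contraTneq NP => ->; rewrite mulr0 -ltNge powR_gt0.
have N0' : 0 < (N%:R : R) by rewrite ltr0n.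
have X0' : 0 < (X%:R : R) by rewrite ltr0n (leq_trans N0).
have lnN : c * L - 2 <= ln N%:R.
  have : ln (P c q) <= ln (4 * N%:R) by rewrite ler_ln ?posrE ?powR_gt0 ?mulr_gt0.
  rewrite ln_powR lnM ?posrE // -/L; lra.
have N1 : (1 < N)%N.
  rewrite ltn_neqAle N0 andbT; apply: contraTneq lnN => <-; rewrite ln1 -ltNge; lra.
have lnX : ln X%:R <= x * L by rewrite -ln_powR ler_ln ?posrE ?powR_gt0.
have X1 : (1 < X)%N by apply: leq_trans NX.
have lnX0 : 0 < ln (X%:R : R) by rewrite ln_gt0 // ltr1n.
have lnN0 : 0 < ln (N%:R : R) by rewrite ln_gt0 // ltr1n.
have L0 : 0 < L by rewrite -(pmulr_rgt0 _ c0); lra.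
apply: le_trans (prime_reciprocal_sum_le R N1 NX) _.
have s1 : ln (ln (X%:R : R)) <= ln x + ln L by rewrite -lnM ?posrE // ler_ln ?posrE ?mulr_gt0.
have s2 : ln c + ln L - ln (ln (N%:R : R)) <= 2 / (c * L - 2).
  rewrite -lnM ?posrE // -ln_div ?posrE ?mulr_gt0 //.
  apply: le_trans (ln_le_sub1 _) _; first by rewrite divr_gt0 ?mulr_gt0.
  have d0 : 0 < c * L - 2 by lra.
  apply: (@le_trans _ _ (c * L / (c * L - 2) - 1)).
    by rewrite lerD2r ler_pM2l ?mulr_gt0 // lef_pV2 ?posrE.
  by rewrite le_eqVlt; apply/orP; left; apply/eqP; field; rewrite gt_eqF.
have s3 : 6 / ln (N%:R : R) <= 6 / (c * L - 2).
  by rewrite ler_pM2l // lef_pV2 ?posrE //; lra.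
have s4 : 8 / (c * L - 2) <= e.
  have : 20 <= e * (c * L).
    have -> : e * (c * L) = L * (c * e) by ring.
    by rewrite -ler_pdivrMr.
  rewrite ler_pdivrMr; last by lra.
  rewrite mulrBr; have : e * 6 <= e * (c * L) by rewrite ler_pM2l. lra.
rewrite ln_div ?posrE //.
lra.
Unshelve. all: by end_near. Qed.

(* A rough number has a prime factor in [(N, X]]; the primes above [X / q ^ om] are counted trivially. *)
Lemma near_smooth_excess (x c eta : R) : 0 < c -> c < x -> ln (x / c) < 2^-1 -> 0 < eta -> eta <= 1 ->
  exists2 kappa : R, 0 < kappa & \forall q \near \oo, eta * q%:R <= (totient q)%:R ->
    let X := floor_power x q in let N := floor_power c q in
    kappa * X%:R <= ((\sum_(1 <= n < X.+1 | coprime n q) smooth N n)%N%:R -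
      (\sum_(1 <= n < X.+1 | coprime n q) ~~ smooth N n)%N%:R : R).
Proof.
move=> c0 cx rho_lt eta0 eta1; have x0 := lt_trans c0 cx.
(* [d] is the margin in Mertens' estimate and [k] the resulting density. The exponent [om] separates
   the primes: those up to [X / q ^ om] add at most [t * Y] to the sieve error, and the larger ones
   have a reciprocal sum of at most [k / 8]. *)
have [d dE] : exists d, d = 2^-1 - ln (x / c) by exists (2^-1 - ln (x / c)).
have d0 : 0 < d by rewrite dE subr_gt0.
have d1 : d <= 2^-1.
  by rewrite dE gerBl ln_ge0 // ler_pdivlMr // mul1r ltW.
have [k kE] : exists k, k = d * eta by exists (d * eta).
have k0 : 0 < k by rewrite kE mulr_gt0.
have k1 : k <= 2^-1 by rewrite kE -[X in _ <= X]mulr1; apply: ler_pM => //; exact: ltW.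
have [om omE] : exists om, om = x * k / 32 by exists (x * k / 32).
have om0 : 0 < om by rewrite omE divr_gt0 ?mulr_gt0.
have om1 : om <= x / 64.
  have : x * k <= x * 2^-1 by rewrite ler_pM2l.
  by rewrite omE; clear; lra.
have xom0 : 0 < x - om by clear -om1 x0; lra.
exists k => //; near=> q.
have q0 : (0 < q)%N by near: q; exists 1%N.
have tq : 64 / k * (num_divisors q)%:R <= (q%:R : R) `^ om.
  by near: q; apply: near_num_divisors_le => //; rewrite divr_ge0 // ltW.
have PxE4 : 4 <= (q%:R : R) `^ (x - om) by near: q; apply: near_powR_ge.
have mert1 : forall X N : nat, X%:R <= (q%:R : R) `^ x -> (N <= X)%N -> (q%:R : R) `^ c <= 4 * N%:R ->
   \sum_(N.+1 <= p < X.+1 | prime p) (p%:R^-1 : R) <= ln (x / c) + d / 4.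
  by near: q; apply: near_prime_sum_le => //; [exact: ltW|rewrite divr_gt0].
have mert2 : forall X N : nat, X%:R <= (q%:R : R) `^ x -> (N <= X)%N -> (q%:R : R) `^ (x - om) <= 4 * N%:R ->
   \sum_(N.+1 <= p < X.+1 | prime p) (p%:R^-1 : R) <= ln (x / (x - om)) + k / 16.
  by near: q; apply: near_prime_sum_le => //; [rewrite gerBl ltW|rewrite divr_gt0].
move=> phi; set X := floor_power x q; set N := floor_power c q; set W := floor_power om q; set Y := (X %/ W)%N.
have q0' : 0 < (q%:R : R) by rewrite ltr0n.
have W0 : (0 < W)%N by apply: floor_power_gt0 => //; exact: ltW.
have W0' : 0 < (W%:R : R) by rewrite ltr0n.
have PX : (q%:R : R) `^ x <= 2 * X%:R by apply: floor_power_ge => //; exact: ltW.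
have XP : X%:R <= (q%:R : R) `^ x := floor_power_le x q.
have WP : W%:R <= (q%:R : R) `^ om := floor_power_le om q.
have PW : (q%:R : R) `^ om <= 2 * W%:R by apply: floor_power_ge => //; exact: ltW.
have X0 : (0 < X)%N by apply: floor_power_gt0 => //; exact: ltW.
have X0' : 0 < (X%:R : R) by rewrite ltr0n.
have NX : (N <= X)%N by apply: le_truncn; apply: ler_powR; rewrite ?ler1n // ltW.
have YX : (Y <= X)%N := leq_div _ _.
have PE : (q%:R : R) `^ x = (q%:R : R) `^ (x - om) * (q%:R : R) `^ om by rewrite -powRDn // subrK.
have PY : (q%:R : R) `^ (x - om) <= 4 * Y%:R.
  have lt : (X < Y.+1 * W)%N by apply: ltn_ceil.
  have : X%:R <= (Y%:R + 1) * W%:R :> R by rewrite natr1 -natrM ler_nat ltnW.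
  have le : (q%:R : R) `^ (x - om) * W%:R <= 2 * X%:R.
    by apply: le_trans PX; rewrite PE ler_wpM2l ?powR_ge0.
  move=> le2; have : (q%:R : R) `^ (x - om) * W%:R <= (2 * (Y%:R + 1)) * W%:R.
    by apply: le_trans le _; rewrite -mulrA ler_pM2l.
  by rewrite ler_pM2r //; clear -PxE4; lra.
have M1 := mert1 X N XP NX (le_trans (floor_power_ge q0 (ltW c0)) _).
have {}M1 : \sum_(N.+1 <= p < X.+1 | prime p) (p%:R^-1 : R) <= ln (x / c) + d / 4.
  by apply: M1; rewrite ler_wpM2r ?ler0n // ler_nat.
have M2 := mert2 X Y XP YX PY.
have om_ln : ln (x / (x - om)) <= k / 16.
  apply: le_trans (ln_le_sub1 _) _; first by rewrite divr_gt0.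
  have -> : x / (x - om) - 1 = om / (x - om) by field; rewrite gt_eqF.
  have kx : k * (x / 2) <= k * (x - om) by rewrite ler_pM2l //; clear -om1 x0; lra.
  rewrite ler_pdivrMr // (_ : k / 16 * (x - om) = k * (x - om) / 16); last by ring.
  by apply: (@le_trans _ _ (k * (x / 2) / 16)); [rewrite omE le_eqVlt; apply/orP; left; apply/eqP; field|rewrite ler_pM2r].
pose t : R := (2 ^ size (primes q))%N%:R.
have t0 : 0 <= t by rewrite ler0n.
have tP : 64 / k * t <= (q%:R : R) `^ om.
  apply: le_trans tq; rewrite ler_pM2l ?divr_gt0 // ler_nat; exact: exp2_omega_le.
pose f : R := (totient q)%:R / q%:R.
have f_ge : eta <= f by rewrite ler_pdivlMr.
have cc_bounds Z : f * Z%:R - t <= (coprime_count q Z)%:R <= f * Z%:R + t.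
  have [h1 h2] := coprime_count_bounds Z q0.
  have h1' : (coprime_count q Z)%:R * q%:R <= Z%:R * (totient q)%:R + t * q%:R :> R.
    by rewrite -!natrM -natrD ler_nat.
  have h2' : Z%:R * (totient q)%:R <= ((coprime_count q Z)%:R + t) * q%:R :> R.
    by rewrite -natrD -!natrM ler_nat.
  have fE : f * Z%:R * q%:R = Z%:R * (totient q)%:R by rewrite /f; field; rewrite gt_eqF.
  by apply/andP; split; rewrite -(ler_pM2r q0') ?mulrBl ?mulrDl fE; clear -h1' h2'; lra.
have cc_le Z : (coprime_count q Z)%:R <= Z%:R :> R.
  rewrite ler_nat /coprime_count big_mkcond; apply: (@leq_trans (\sum_(1 <= n < Z.+1) 1)).
    by apply: leq_sum => n _; case: ifP.
  by rewrite sum_nat_const_nat subn1 muln1.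
set cA := (\sum_(1 <= n < X.+1 | _) _)%N; set cB := (\sum_(1 <= n < X.+1 | _) ~~ _)%N.
have cAB : (cA + cB = coprime_count q X)%N.
  by rewrite /cA /cB /coprime_count -big_split; apply: eq_bigr => n _ /=; case: smooth.
have cB_le : cB%:R <= f * X%:R * (ln (x / c) + d / 4) + t * Y%:R + X%:R * (ln (x / (x - om)) + k / 16).
  apply: (@le_trans _ _ (\sum_(N.+1 <= p < X.+1 | prime p) (coprime_count q (X %/ p))%:R)).
    by rewrite -natr_sum ler_nat rough_count_le.
  apply: (@le_trans _ _ (\sum_(N.+1 <= p < X.+1 | prime p) (f * X%:R * p%:R^-1 + t * (p <= Y)%N%:R +
      X%:R * (if (Y < p)%N then p%:R^-1 else 0)))).
    rewrite big_nat_cond [X in _ <= X]big_nat_cond; apply: ler_sum => p /andP[/andP[Np pX] p_pr].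
    have p0 : 0 < (p%:R : R) by rewrite ltr0n prime_gt0.
    have dv : (X %/ p)%:R <= X%:R * p%:R^-1 :> R.
      by rewrite ler_pdivlMr // -natrM ler_nat leq_trunc_div.
    have f0 : 0 <= f by apply: le_trans f_ge; exact: ltW.
    case: (leqP p Y) => pY /=; rewrite ?mulr0 ?addr0 ?mulr1.
      have /andP[_ h] := cc_bounds (X %/ p)%N; apply: le_trans h _.
      by rewrite lerD2r -mulrA ler_wpM2l.
    apply: le_trans (cc_le _) _; apply: le_trans dv _.
    by rewrite lerDr mulr_ge0 ?mulr_ge0 ?invr_ge0 ?ler0n.
  rewrite !big_split /= -!mulr_sumr; apply: lerD; first apply: lerD.
  - by rewrite ler_wpM2l // mulr_ge0 ?ler0n // (le_trans (ltW eta0)).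
  - rewrite ler_wpM2l // -natr_sum ler_nat.
    apply: (@leq_trans (\sum_(1 <= p < Y.+1) 1)); last by rewrite sum_nat_const_nat subn1 muln1.
    rewrite [X in (_ <= X)%N](_ : _ = \sum_(1 <= p < X.+1) (p <= Y))%N; last first.
      rewrite (@big_cat_nat _ _ _ Y.+1 1 X.+1) //= [X in (_ + X)%N]big_nat_cond [X in (_ + X)%N]big1.
        by rewrite addn0; apply: eq_big_nat => p /andP[_]; rewrite ltnS => ->.
      by move=> p /andP[/andP[Yp _] _]; rewrite leqNgt Yp.
    rewrite [X in (_ <= X)%N](@big_cat_nat _ _ _ N.+1) //=; apply: leq_trans (leq_addl _ _).
    by rewrite big_mkcond; apply: leq_sum => p _; case: ifP.
  rewrite ler_wpM2l // -big_mkcondr; apply: le_trans M2.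
  rewrite [X in X <= _](eq_bigl (fun p => (Y < p)%N && prime p)) => [|p]; last by rewrite andbC.
  have [NY|YN] := leqP N Y.
    rewrite (@big_cat_nat _ _ _ Y.+1) //= [X in X + _ <= _]big_nat_cond [X in X + _ <= _]big_pred0 ?add0r.
      rewrite big_nat_cond [X in _ <= X]big_nat_cond.
      by rewrite le_eqVlt; apply/orP; left; apply/eqP; apply: eq_bigl => p; case: leqP.
    by move=> p; apply/negP => /andP[/andP[_ pY] /andP[Yp _]]; rewrite ltnS leqNgt Yp in pY.
  rewrite [X in _ <= X](@big_cat_nat _ _ _ N.+1) //=; last exact: ltnW.
  apply: (@le_trans _ _ (\sum_(N.+1 <= p < X.+1 | prime p) p%:R^-1)); last by rewrite lerDr sumr_ge0.
  rewrite [X in X <= _]big_mkcond [X in _ <= X]big_mkcond; apply: ler_sum => p _.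
  by case: (prime p); case: (leqP p Y) => //=; rewrite invr_ge0 ler0n.
have /andP[cU_ge _] := cc_bounds X.
have cABR : cA%:R + cB%:R = (coprime_count q X)%:R :> R by rewrite -natrD cAB.
have tX : t <= k / 32 * X%:R.
  have Px : (q%:R : R) `^ om <= (q%:R : R) `^ x by apply: ler_powR; rewrite ?ler1n //; clear -om1 x0; lra.
  have : 64 / k * t <= 2 * X%:R by apply: le_trans tP _; apply: le_trans PX.
  by rewrite mulrAC ler_pdivrMr //; clear; lra.
have tY : t * Y%:R <= k / 32 * X%:R.
  have : t <= k / 32 * W%:R.
    have : 64 / k * t <= 2 * W%:R by apply: le_trans tP _.
    by rewrite mulrAC ler_pdivrMr //; clear; lra.
  have YW : Y%:R * W%:R <= X%:R :> R by rewrite -natrM ler_nat leq_trunc_div.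
  move=> tW; apply: (@le_trans _ _ (k / 32 * W%:R * Y%:R)); first by rewrite ler_wpM2r.
  by rewrite -mulrA ler_pM2l ?divr_gt0 // mulrC.
(* The excess is the coprime count minus [2 * cB]. The main terms leave
   [3 / 2 * d * f * X >= 3 / 2 * k * X], and the errors take at most [11 / 32 * k * X]. *)
have fX : k * X%:R <= d * (f * X%:R).
  by rewrite kE -mulrA ler_pM2l // ler_pM2r.
have lnE : ln (x / c) = 2^-1 - d by rewrite dE; ring.
rewrite lnE in cB_le.
have s : X%:R * ln (x / (x - om)) <= X%:R * (k / 16) by rewrite ler_pM2l.
move: cB_le cU_ge; rewrite -cABR mulrDr [X%:R * (_ + _)]mulrDr.
have -> : f * X%:R * (2^-1 - d) = f * X%:R / 2 - d * (f * X%:R) by ring.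
have -> : f * X%:R * (d / 4) = d * (f * X%:R) / 4 by ring.
have -> : X%:R * (k / 16) = k * X%:R / 16 by ring.
move: s; have -> : X%:R * (k / 16) = k * X%:R / 16 by ring.
have e32 : k / 32 * X%:R = k * X%:R / 32 by ring.
rewrite e32 in tX tY.
have kX : 0 <= k * X%:R by rewrite mulr_ge0 ?ltW.
move: (d * (f * X%:R)) fX => a2.
move: (k * X%:R) kX (f * X%:R) (X%:R * ln _) (t * Y%:R) tX tY => a1 a1_ge0 a3 a4 a5; clear -a1_ge0.
lra.
Unshelve. all: by end_near. Qed.
End Powers.

Section Final.
Variable R : realType.

(** [31 / 32 <= expR (- 32^-1)] is squared four times, with rounding down in between. The resulting
    [7 * beta >= 21 / 20] is the room for the seven factors. *)
Lemma beta_bounds : 3 / 20 <= beta R /\ beta R < 4^-1.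
Proof.
split; last first.
  by rewrite /beta -[X in _ < X]mulr1 ltr_pM2l ?invr_gt0 // expR_lt1; lra.
suff h : 3 / 5 <= expR (- 2^-1 : R) by rewrite /beta; lra.
have -> : - 2^-1 = 16%:R * (- (32^-1)) :> R by lra.
rewrite expRM_natl; have h0 : 31 / 32 <= expR (- 32^-1 : R).
  by apply: le_trans (expR_ge1Dx _); lra.
have sq (u v w : R) : 0 <= u -> u <= v -> w <= u * u -> w <= v ^+ 2.
  by move=> u0 uv /le_trans; apply; rewrite expr2 ler_pM.
have e16 (u : R) : u ^+ 16 = u ^+ 2 ^+ 2 ^+ 2 ^+ 2 by rewrite -!exprM.
rewrite e16.
apply: (sq (7752 / 10000)); [lra| |lra].
apply: (sq (8805 / 10000)); [lra| |lra].
apply: (sq (9384 / 10000)); [lra| |lra].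
by apply: (sq (31 / 32)); [lra|exact: h0|lra].
Qed.

Lemma exceptional_count_le (eps eps' : R) q : (0 < q)%N -> eps <= eps' ->
  (exceptional_count eps' q <= exceptional_count eps q)%N.
Proof.
move=> q0 le; rewrite /exceptional_count; apply/subset_leq_card/fintype.subsetP => a; rewrite !inE => /andP[-> H] /=.
apply: contra H => /asboolP[n [nE nb]]; apply/asboolP; exists n; split=> // i.
have [n1 nP] := nb i; split=> //; apply: le_trans nP _.
by apply: ler_powR; rewrite ?ler1n // lerD2l.
Qed.

Lemma exceptional_count_seven (eps : R) q :
  (exceptional_count eps q <= #|[pred a : 'I_q | coprime a q &&
     ~~ `[< seven_product (floor_power (beta R + eps) q) q a >]]|)%N.
Proof.
rewrite /exceptional_count; apply/subset_leq_card/fintype.subsetP => a; rewrite !inE => /andP[-> H] /=.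
apply: contra H => /asboolP[n [nE nb]]; apply/asboolP; exists n; split=> // i.
have /andP[n1 nN] := nb i; split=> //.
by apply: le_trans (floor_power_le _ _); rewrite ler_nat.
Qed.

Lemma exceptional_density (eps eta : R) : 0 < eps -> eps <= 100^-1 -> 0 < eta -> eta <= 1 ->
  \forall q \near \oo, cube_free q -> (exceptional_count eps q)%:R <= eta * q%:R.
Proof.
move=> eps0 eps1 eta0 eta1; have [beta_lo beta_hi] := beta_bounds.
have [x xE] : exists x : R, x = 4^-1 + eps by exists (4^-1 + eps).
have [c cE] : exists c, c = beta R + eps by exists (beta R + eps).
have c0 : 0 < c by rewrite cE; clear -eps0 beta_lo; lra.
have cx : c < x by rewrite cE xE; clear -beta_hi; lra.
have x0 := lt_trans c0 cx.
have rho : ln (x / c) < 2^-1.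
  (* [expR 2^-1 * c] is [4^-1 + expR 2^-1 * eps], which exceeds [x] only thanks to [eps > 0]. *)
  have xc : x / c < expR 2^-1.
    rewrite ltr_pdivrMr // cE mulrDr /beta.
    have -> : expR 2^-1 * (4^-1 * expR (- 2^-1)) = 4^-1 :> R.
      by rewrite mulrCA -expRD subrr expR0 mulr1.
    by rewrite xE ltrD2l ltr_pMl // expR_gt1 invr_gt0.
  by rewrite -ltr_expR lnK // posrE divr_gt0.
have [kappa kappa0 near_kappa] := near_smooth_excess c0 cx rho eta0 eta1.
(* [2 x + m z > 1] is needed for the mean value, [2 x + (m + 7) z < 7 c] for the packing; this leaves
   room because [7 * (3 / 20) > 1]. *)
have [m mE] : exists m, m = 101%N by exists 101%N.
have [k kE] : exists k, k = 201%N by exists 201%N.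
have [z zE] : exists z : R, z = 200^-1 by exists 200^-1.
have z0 : 0 < z by rewrite zE.
have z2 : 0 < 2 * z by rewrite mulr_gt0.
have z10 : 0 < 10 * z by rewrite mulr_gt0.
have mz : z * m%:R = 101 / 200 by rewrite mE zE mulrC.
have kz : z * k%:R = 201 / 200 by rewrite kE zE mulrC.
have [kb kbE] : exists kb, kb = (Num.truncn (9 / (4 * eps))).+1 by exists (Num.truncn (9 / (4 * eps))).+1.
(* Eight for the hypothesis of [burgess], and one for the factor [2 ^ (4 * kb)] lost in rounding [X]
   down. *)
have kb_eps : 9 <= 4 * kb%:R * eps.
  have : 9 / (4 * eps) <= kb%:R by rewrite ltW // kbE truncnS_gt.
  by rewrite ler_pdivrMr ?mulr_gt0 //; have -> : kb%:R * (4 * eps) = 4 * kb%:R * eps by ring.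
have kb0 : (0 < kb)%N by rewrite kbE.
have [K [F0 [K0 burg]]] := burgess kb0.
have n0 : (0 < k.+1 * K)%N by rewrite muln_gt0.
have mx0 : (0 < m.+2 + k)%N by [].
(* The square of the density of the mean: [kappa] from the signed factor and [eta / 2] from each of
   the [m + 2] other factors. *)
have [G GE] : exists G, G = kappa ^+ 2 * (eta / 2) ^+ (2 * m.+2).
  by exists (kappa ^+ 2 * (eta / 2) ^+ (2 * m.+2)).
have G0 : 0 < G by rewrite GE mulr_gt0 ?exprn_gt0 // divr_gt0.
near=> q.
have q1 : (1 < q)%N by near: q; exists 2%N.
have F0q : (F0 <= q)%N by near: q; exists F0.
have kap : eta * q%:R <= (totient q)%:R -> let X := floor_power x q in let N := floor_power c q in
    kappa * X%:R <= ((\sum_(1 <= n < X.+1 | coprime n q) smooth N n)%N%:R -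
      (\sum_(1 <= n < X.+1 | coprime n q) ~~ smooth N n)%N%:R : R) by near: q; exact: near_kappa.
have copX : eta * q%:R <= (totient q)%:R -> forall Y, (q%:R : R) `^ x <= 2 * Y%:R ->
    eta / 2 * Y%:R <= (coprime_count q Y)%:R by near: q; exact: near_coprime_count_ge.
have copZ : eta * q%:R <= (totient q)%:R -> forall Y, (q%:R : R) `^ z <= 2 * Y%:R ->
    eta / 2 * Y%:R <= (coprime_count q Y)%:R by near: q; exact: near_coprime_count_ge.
have [tau [T [tau_le tau_ge T_le fiber]]] : exists tau T, [/\ (tau ^ (k.+1 * K) <= q)%N,
    ((Num.truncn (4 / (G * eta))).+1 <= tau)%N, (T <= tau)%N &
    forall v, (0 < v <= q ^ 4)%N -> (num_divisors v ^ (m.+2 + k) <= T)%N].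
  by near: q; exact: scale_and_divisor_bound.
have P1 : 2 ^+ m.+2 <= (q%:R : R) `^ z by near: q; exact: near_powR_ge _ z0.
have P2 : 2 ^+ k <= (q%:R : R) `^ z by near: q; exact: near_powR_ge _ z0.
have P3 : 2 ^+ 7 <= (q%:R : R) `^ (2 * z) by near: q; exact: near_powR_ge _ z2.
have P4 : 2 ^+ 2 <= (q%:R : R) `^ (10 * z) by near: q; exact: near_powR_ge _ z10.
have P5 : 2 ^+ (4 * kb) <= (q%:R : R) `^ 1 by near: q; exact: near_powR_ge _ (@ltr01 R).
move=> [_ cf]; have q0 := ltnW q1; have q0' : 0 < (q%:R : R) by rewrite ltr0n.
have q1' : 1 <= (q%:R : R) by rewrite ler1n.
(* For small [totient q] the count of units is already small enough. Otherwise all densities are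
   bounded below in terms of [eta]. *)
have [small|large] := leP ((totient q)%:R : R) (eta * q%:R).
  apply: le_trans small; rewrite ler_nat totient_count_coprime big_mkord /exceptional_count -sum1_card.
  rewrite [X in (X <= _)%N]big_mkcond; apply: leq_sum => a _; rewrite inE coprime_sym.
  by case: (coprime q a) => /=; [case: ifP|].
have phi := ltW large.
set X := floor_power x q; set Z := floor_power z q; set N := floor_power c q.
have XP : X%:R <= (q%:R : R) `^ x := floor_power_le x q.
have ZP : Z%:R <= (q%:R : R) `^ z := floor_power_le z q.
have PX : (q%:R : R) `^ x <= 2 * X%:R by apply: floor_power_ge => //; exact: ltW.
have PZ : (q%:R : R) `^ z <= 2 * Z%:R by apply: floor_power_ge => //; exact: ltW.
have PN : (q%:R : R) `^ c <= 2 * N%:R by apply: floor_power_ge => //; exact: ltW.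
have X0 : (0 < X)%N by apply: floor_power_gt0 => //; exact: ltW.
have Z0 : (0 < Z)%N by apply: floor_power_gt0 => //; exact: ltW.
have N0 : (0 < N)%N by apply: floor_power_gt0 => //; exact: ltW.
have Pge0 a : 0 <= (q%:R : R) `^ a by exact: powR_ge0.
have Pmono a b : a <= b -> (q%:R : R) `^ a <= (q%:R : R) `^ b by move=> ab; apply: ler_powR.
have pow_le (u v : R) n : 0 <= u -> u <= v -> u ^+ n <= v ^+ n.
  by move=> u0 uv; rewrite lerXn2r ?nnegrE // (le_trans u0).
have X_le : (X <= N ^ 2)%N.
  rewrite -(ler_nat R) natrX -(@ler_pM2l _ (2 ^+ 2)) // -exprMn.
  apply: (@le_trans _ _ ((q%:R `^ c) ^+ 2)); last by rewrite pow_le.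
  rewrite powRXn; apply: (@le_trans _ _ (q%:R `^ (10 * z) * q%:R `^ x)); first by apply: ler_pM.
  by rewrite -powRDn // Pmono // cE xE zE; clear -beta_lo eps0; lra.
have pack : (X ^ 2 * Z ^ (m.+1 + 6) <= N ^ 7)%N.
  rewrite -(ler_nat R) natrM !natrX -(@ler_pM2l _ (2 ^+ 7)) ?exprn_gt0 // -[X in _ <= X]exprMn.
  apply: (@le_trans _ _ ((q%:R `^ c) ^+ 7)); last by rewrite pow_le.
  apply: (@le_trans _ _ (q%:R `^ (2 * z) * ((q%:R `^ x) ^+ 2 * (q%:R `^ z) ^+ (m.+1 + 6)))).
    by apply: ler_pM; rewrite ?exprn_ge0 ?mulr_ge0 ?exprn_ge0 //; apply: ler_pM; rewrite ?exprn_ge0 ?pow_le.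
  rewrite !powRXn -!powRDn // Pmono //.
  have -> : (m.+1 + 6)%N%:R = m%:R + 7 :> R by rewrite addSnnS natrD.
  (* The exponents on the left total [21 / 20 + 2 * eps], including [2 * z] for the rounding of [N];
     on the right there is at least [21 / 20 + 7 * eps]. *)
  by rewrite (mulrDr z) mz zE cE xE; clear -beta_lo eps0; lra.
have q_le1 : (q <= X ^ 2 * Z ^ m)%N.
  rewrite -(ler_nat R) natrM !natrX -(@ler_pM2l _ (2 ^+ m.+2)) ?exprn_gt0 //.
  have -> : 2 ^+ m.+2 * (X%:R ^+ 2 * Z%:R ^+ m) = (2 * X%:R) ^+ 2 * (2 * Z%:R) ^+ m :> R.
    by rewrite !exprMn (exprD _ 2 m); ring.
  apply: (@le_trans _ _ ((q%:R `^ x) ^+ 2 * (q%:R `^ z) ^+ m)); last first.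
    by apply: ler_pM; rewrite ?exprn_ge0 ?pow_le.
  (* The surplus [q ^ z] covers the powers of 2 lost by rounding [X] and [Z] down. *)
  apply: (@le_trans _ _ (q%:R `^ z * q%:R `^ 1)).
    by apply: ler_pM => //; rewrite ?exprn_ge0 // powRr1.
  rewrite !powRXn -!powRDn // Pmono // mz xE ?zE; clear -eps0; lra.
have q_le2 : (q <= Z ^ k)%N.
  rewrite -(ler_nat R) natrX -(@ler_pM2l _ (2 ^+ k)) ?exprn_gt0 // -[X in _ <= X]exprMn.
  apply: (@le_trans _ _ ((q%:R `^ z) ^+ k)); last by rewrite pow_le.
  apply: (@le_trans _ _ (q%:R `^ z * q%:R `^ 1)).
    by apply: ler_pM => //; rewrite ?exprn_ge0 // powRr1.
  rewrite !powRXn -!powRDn // Pmono // kz ?zE; clear; lra.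
have q4E : (q ^ 4)%N%:R = (q%:R : R) `^ 4 by rewrite natrX powR_mulrn.
have XZ4 : (X ^ 2 * Z ^ m <= q ^ 4)%N.
  rewrite -(ler_nat R) q4E natrM !natrX.
  apply: (@le_trans _ _ ((q%:R `^ x) ^+ 2 * (q%:R `^ z) ^+ m)).
    by apply: ler_pM; rewrite ?exprn_ge0 ?pow_le.
  rewrite !powRXn -!powRDn // Pmono // mz xE ?zE; clear -eps1; lra.
have Zk4 : (Z ^ k <= q ^ 4)%N.
  rewrite -(ler_nat R) q4E natrX.
  apply: (@le_trans _ _ ((q%:R `^ z) ^+ k)); first by rewrite pow_le.
  rewrite !powRXn Pmono // kz ?zE; clear; lra.
have fiber_le v a : (0 < v <= q ^ 4)%N -> (a <= m.+2 + k)%N -> (num_divisors v ^ a <= T)%N.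
  move=> v4 am; apply: leq_trans (fiber v v4); rewrite leq_pexp2l // num_divisors_gt0 //.
  by case/andP: v4.
have fiber1 v : (0 < v <= X ^ 2 * Z ^ m)%N -> (num_divisors v ^ m.+2 <= T)%N.
  by move=> /andP[v0 vX]; rewrite fiber_le ?leq_addr // v0 (leq_trans vX).
have fiber2 v : (0 < v <= Z ^ k)%N -> (num_divisors v ^ k <= T)%N.
  by move=> /andP[v0 vX]; rewrite fiber_le ?leq_addl // v0 (leq_trans vX).
have saving chi : dchar q chi -> nonprincipal q chi ->
    ((tau ^ k.+1)%N%:R * `|char_sum chi X| <= X%:R)%R.
  move=> chiP chiN; apply: (burg q) => //; last by rewrite -expnM.
  rewrite -(ler_nat R) !natrX -(@ler_pM2l _ (2 ^+ (4 * kb))) ?exprn_gt0 // -[X in _ <= X]exprMn.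
  apply: (@le_trans _ _ ((q%:R `^ x) ^+ (4 * kb))); last by rewrite pow_le.
  rewrite -[q%:R ^+ _]powR_mulrn //.
  apply: (@le_trans _ _ (q%:R `^ 1 * q%:R `^ (kb + 8)%:R)); first by rewrite ler_wpM2r.
  rewrite powRXn -powRDn // Pmono // natrD natrM xE.
  have -> : (4^-1 + eps) * (4 * kb%:R) = kb%:R + 4 * kb%:R * eps by field.
  by clear -kb_eps; lra.
have := exceptional_set_bound q1 N0 Z0 X_le pack q_le1 q_le2 fiber1 fiber2 saving.
set E := #|_|; set cA := (\sum_(1 <= n < X.+1 | _) _)%N; set cB := (\sum_(1 <= n < X.+1 | _) ~~ _)%N.
move=> main; have EE : (exceptional_count eps q <= E)%N by rewrite /E /N cE; exact: exceptional_count_seven.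
apply: (@le_trans _ _ E%:R); first by rewrite ler_nat.
have A1 : kappa * X%:R <= (cA - cB)%N%:R.
  apply: le_trans (kap phi) _; rewrite lerBlDr -natrD ler_nat; by rewrite addnC -leq_subLR.
have A2 : eta / 2 * X%:R <= (coprime_count q X)%:R := copX phi X PX.
have A3 : eta / 2 * Z%:R <= (coprime_count q Z)%:R := copZ phi Z PZ.
have e2 : 0 <= eta / 2 by rewrite divr_ge0 // ltW.
have a1 : 0 <= kappa * X%:R by rewrite mulr_ge0 // ltW.
have a2 : 0 <= eta / 2 * X%:R by rewrite mulr_ge0.
have a3 : 0 <= eta / 2 * Z%:R by rewrite mulr_ge0.
have low : kappa * X%:R * (eta / 2 * X%:R) * (eta / 2 * Z%:R) ^+ m.+1 <=
    ((cA - cB) * coprime_count q X * coprime_count q Z ^ m.+1)%N%:R.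
  by rewrite !natrM natrX; apply: ler_pM; [exact: mulr_ge0|exact: exprn_ge0|exact: ler_pM|exact: pow_le].
have Q0 : 0 < X%:R ^+ 4 * Z%:R ^+ (2 * m.+1) :> R by rewrite mulr_gt0 ?exprn_gt0 ?ltr0n.
have tau0 : 0 < tau%:R :> R by rewrite ltr0n (leq_trans _ tau_ge).
(* Of the saving [tau ^ 2] one factor is lost to [T <= tau]; the remaining one exceeds
   [4 / (G * eta)]. *)
have step : E%:R * tau%:R * G <= 4 * q%:R.
  rewrite -(ler_pM2r tau0) -(ler_pM2r Q0).
  apply: (@le_trans _ _ (E * tau ^ 2 * ((cA - cB) * coprime_count q X * coprime_count q Z ^ m.+1) ^ 2)%N%:R).
    rewrite !(natrM R (E * tau ^ 2)) (natrM R E) !natrX.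
    rewrite [X in X <= _](_ : _ = E%:R * tau%:R ^+ 2 *
      (kappa * X%:R * (eta / 2 * X%:R) * (eta / 2 * Z%:R) ^+ m.+1) ^+ 2); last first.
      by rewrite GE (_ : (2 * m.+2 = m.+1 * 2 + 2)%N) 1?(mulnC 2 m.+1) ?exprD ?exprMn ?exprM; [ring|rewrite mulnC -addn1 mulnDl].
    rewrite ler_wpM2l ?mulr_ge0 ?exprn_ge0 ?ler0n // pow_le //.
    by apply: mulr_ge0; [exact: mulr_ge0|exact: exprn_ge0].
  apply: (@le_trans _ _ (4 * T * totient q * X ^ 4 * Z ^ (2 * m.+1))%N%:R); first by rewrite ler_nat.
  have -> : (4 * T * totient q * X ^ 4 * Z ^ (2 * m.+1))%N%:R =
      (4 * (T * totient q))%N%:R * (X%:R ^+ 4 * Z%:R ^+ (2 * m.+1)) :> R.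
    by rewrite -!natrX -!natrM; congr (_%:R); ring.
  rewrite ler_pM2r // -mulrA natrM ler_pM2l // mulrC -natrM ler_nat.
  by rewrite leq_mul // leq_totient.
have tau_ge' : 4 <= tau%:R * G * eta.
  have : 4 / (G * eta) <= tau%:R.
    by apply: le_trans (ltW (truncnS_gt _)) _; rewrite ler_nat.
  by rewrite ler_pdivrMr ?mulr_gt0 // mulrA.
rewrite -(@ler_pM2r _ (tau%:R * G)) ?mulr_gt0 // mulrA; apply: le_trans step _.
have -> : eta * q%:R * (tau%:R * G) = tau%:R * G * eta * q%:R by ring.
by rewrite ler_pM2r.
Unshelve. all: by end_near. Qed.
End Final.

Theorem theorem4 (R : realType) (eps : R) (eps_gt0 : 0 < eps) :
  (fun q : nat => (exceptional_count eps q)%:R : R)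
    =o_cube_free_oo (fun q : nat => q%:R : R).
Proof.
apply/eqoP => eta eta0.
(* Smaller [eps] enlarges the exceptional set and smaller [eta] sharpens the bound, so both may be
   reduced to the range of [exceptional_density]. *)
pose eps1 := Num.min eps 100^-1; pose eta1 := Num.min eta 1.
have [Q _ HQ] : \forall q \near \oo, cube_free q -> (exceptional_count eps1 q)%:R <= eta1 * q%:R.
  by apply: exceptional_density; rewrite ?lt_min ?ge_min ?lexx ?orbT ?eps_gt0 ?eta0 ?ltr01 //= invr_gt0.
exists Q => // q /= Qq cf; rewrite !normr_nat.
have [q0 _] := cf.
apply: le_trans (_ : (exceptional_count eps1 q)%:R <= _).
  by rewrite ler_nat exceptional_count_le // ge_min lexx.
apply: le_trans (HQ q Qq cf) _; rewrite ler_wpM2r //; by rewrite ge_min lexx.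
Qed.
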